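(* Let $n\geq -1$ be an integer, and let $f$ be a function satisfying the following conditions. (1) If $n$ is even, then $f(-x)\neq f(x)$, i.e. $f$ is not an even function; if $n$ is odd, then $f(-x)\neq -f(x)$, i.e. $f$ is not an odd function. (2) $f$ is regular (analytic) at the point $x=0$, and its Taylor series has the form $$f(x)=\sum_{k=0}^{\infty}\frac{g^{(k)}(0)}{k!}\,(-x)^k ,$$ where $(-1)^k g^{(k)}(x)$ is the $k$-th derivative of $f(x)$ (so $g^{(k)}(0)=(-1)^k f^{(k)}(0)$ for $k=0,1,2,\dots$). (3) $x^{1/2}f(x)\to 0$ as $x\to\infty$. (4) $g^{(s)}(0)$ is a regular (analytic, single-valued) function of $s$ defined on the half-plane $H(\delta)=\{s\in\mathbb{C}:\operatorname{Re}(s)\geq-\delta\}$ for some $3/4<\delta<1$, and it satisfies the growth condition $$|g^{(s)}(0)|<C\,a^{\operatorname{Re}(s)}$$ for some constants $C$ and $a>0$ and all $s\in H(\delta)$. Then, for $q>a>0$, the Hankel transform of order $n$ $$\mathcal{H}_n[f(x)](q)=\int_0^{\infty}x f(x)J_n(qx)\,dx$$ can be presented by the absolutely and uniformly convergent series $$\mathcal{H}_n[f(x)](q)=\frac{2}{q^2}\sum_{k=0}^{\infty}\frac{\Gamma(k/2+n/2+1)}{\Gamma(n/2-k/2)\,\Gamma(k+1)}\,f^{(k)}(0)\left(\frac{q}{2}\right)^{-k}.$$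
   Context: $J_\nu$ is the Bessel function of the first kind of order $\nu$ (with $J_{-1}=-J_1$), $\Gamma$ is the Gamma function, and $1/\Gamma(z)$ is taken to be $0$ when $z$ is a non-positive integer. The parameter $q$ is positive and is not assumed to be large. The notation $g^{(s)}(0)$ for complex $s$ denotes a function of the complex variable $s$ whose value at each integer $s=k\geq 0$ is $g^{(k)}(0)=(-1)^k f^{(k)}(0)$. The number $a$ in ''$q>a>0$'' is the constant $a$ of the growth condition. The integral over $[0,\infty)$ is an improper integral.
   Formalization: Uniform convergence is proved on each half-line q ≥ q0 with q0 > a, since on all of q > a it fails (f(x) = e^{-ax}); the Taylor expansion is taken to represent f at every real x, as altering f away from 0 would falsify the formula. *)

(* Defs.v *)
(* Stdlib real numbers with Coquelicot (limits, series, integrals, C). *)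
From Stdlib Require Export Reals ZArith.
From Coquelicot Require Export Coquelicot.
From Stdlib Require Import Lia Lra.

Open Scope R_scope.

(** ** Gamma function of a real argument *)

Definition Euler_Gamma (x : R) : R :=
  RInt_gen (fun t => Rpower t (x - 1) * exp (- t))
    (at_right 0) (Rbar_locally p_infty).

(* x (x+1) ... (x+m-1) *)
Fixpoint rising (x : R) (m : nat) : R :=
  match m with
  | O => 1
  | S m' => rising x m' * (x + INR m')
  end.

(* The least m with 0 < x + m ([up y] is the least integer > y). *)
Definition Gamma_shift (x : R) : nat := Z.to_nat (up (- x)).

(* Extension of Euler's integral to x <= 0 by Gamma (x+1) = x Gamma x; it is
   only meaningful away from the poles 0, -1, -2, ... *)
Definition Gamma (x : R) : R :=
  Euler_Gamma (x + INR (Gamma_shift x)) / rising x (Gamma_shift x).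

(* The entire function 1/Gamma: at a pole of Gamma the numerator vanishes. *)
Definition rGamma (x : R) : R :=
  rising x (Gamma_shift x) / Euler_Gamma (x + INR (Gamma_shift x)).

Lemma rGamma_pole (m : nat) : rGamma (- INR m) = 0.
Proof.
  assert (Hup : up (- - INR m) = (Z.of_nat m + 1)%Z).
  { symmetry; apply tech_up; rewrite plus_IZR, <- INR_IZR_INZ; lra. }
  unfold rGamma, Gamma_shift; rewrite Hup.
  replace (Z.to_nat (Z.of_nat m + 1)) with (S m) by lia.
  cbn [rising]; unfold Rdiv; ring.
Qed.

(** ** Bessel functions of the first kind, of integer order *)

Definition BesselJ_nat (n : nat) (x : R) : R :=
  Series (fun m => (-1) ^ m / (INR (fact m) * INR (fact (m + n)))
                   * (x / 2) ^ (2 * m + n)).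

(* J_{-n} = (-1)^n J_n; in particular J_{-1} = - J_1. *)
Definition BesselJ (n : Z) (x : R) : R :=
  match n with
  | Zneg p => (-1) ^ (Pos.to_nat p) * BesselJ_nat (Pos.to_nat p) x
  | _ => BesselJ_nat (Z.to_nat n) x
  end.

(** ** Complex-valued functions *)

Definition Derive_n_C (f : R -> C) (k : nat) (x : R) : C :=
  (Derive_n (fun t => Re (f t)) k x, Derive_n (fun t => Im (f t)) k x).

(* Half-plane Re s >= - delta. *)
Definition half_plane (delta : R) (s : C) : Prop := - delta <= Re s.

(* Analytic at every point of a set that need not be open: complex
   differentiable in a neighbourhood of each of its points. *)
Definition analytic_on (D : C -> Prop) (phi : C -> C) : Prop :=
  forall s : C, D s ->
    locally s (fun z : C => ex_derive (K := C_AbsRing) (V := C_NormedModule) phi z).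

(* [l] is the value of the convergent improper integral
   int_0^oo x f(x) J_n(q x) dx. *)
Definition is_Hankel (n : Z) (f : R -> C) (q : R) (l : C) : Prop :=
  is_RInt_gen (V := C_R_NormedModule)
    (fun x : R => (RtoC (x * BesselJ n (q * x)) * f x)%C)
    (at_point 0) (Rbar_locally p_infty) l.

Definition Hankel_term (n : Z) (f : R -> C) (q : R) (k : nat) : C :=
  (RtoC (Gamma (INR k / 2 + IZR n / 2 + 1)
         * rGamma (IZR n / 2 - INR k / 2) / Gamma (INR k + 1))
   * Derive_n_C f k 0 * RtoC (/ (q / 2) ^ k))%C.

Definition abs_convergent (u : nat -> C) : Prop := ex_series (fun k => Cmod (u k)).

(* The series of functions [u _ k] converges to [S] uniformly on [D]. *)
Definition unif_series_on (D : R -> Prop) (u : R -> nat -> C) (S : R -> C) : Prop :=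
  forall eps : R, 0 < eps ->
    exists N : nat, forall m : nat, (N <= m)%nat ->
      forall q : R, D q -> Cmod (sum_n (u q) m - S q)%C < eps.

(* Main.v *)
Require Import Defs.
From Stdlib Require Import Lia Lra Psatz.
Open Scope R_scope.

(** After the substitution u = q x and separation of real and imaginary parts, the
    statement concerns a real function f = sum c_k x ^ k / k! with |c_k| <= A al ^ k and
    al < 1, such that h(x) = x f(x) J_n(x) tends to 0, because sqrt x f(x) does and
    J_n = O(x ^ (-1/2)) ([J_bounds]).

    Inserting the Taylor series of f into the integral leads to the divergent moments
    int x ^ (k+1) J_n(x) dx. Their Abel regularizations, the limits as p -> 0 of
    int exp (- p x) x ^ (k+1) J_n(x) dx, do exist, and the classical recurrences of J_n
    show that they are the quotients of Gamma values of the series ([JLap_lim0],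
    [Hankel_weight]). Moreover, for a fixed bound on p > 0, these regularized integrals
    are O((k+1)!): for n = 0 they are essentially Legendre polynomials, bounded
    through a quadratic form that the recurrence decreases ([JLap_0_energy]), and
    the order n is reached by the three-term recurrence ([JLap_bound]). As al < 1, the
    resulting series converges absolutely, even at p = 0.

    It remains to justify the procedure. Let L(p) be the Laplace transform of h, defined
    for Re p > 0. For p > al sum and integral may be exchanged, which expresses the
    Taylor coefficients of L at p by those of the transform of x J_n(x). All terms being
    analytic, the relation continues along the real axis down to p = 0 and shows that
    L is the restriction of a power series G about 0, whose constant term is the
    claimed sum ([transfer_all], [moment_series_integral]). All these continuations
    are done on sequences of Taylor coefficients: a change of centre is an operator of
    the form u |-> (sum_k b_k binom k j u_(k+j))_j, and so is multiplication by f on the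
    transform side; such operators commute ([binom_shift_comm]).

    Finally the integral of h itself converges to G 0 by the Tauberian theorem of
    Fatou and Riesz: h tends to 0 and L is regular at 0. Its proof is Newman's
    contour argument on a small circle ([newman_tauberian]). Instead of Cauchy's
    formula it uses the maximum principle at the centre of a disc for uniform limits
    of polynomials, which follows from averages over roots of unity
    ([poly_approx_max]). *)


(** * Series of complex numbers *)

(* Goals produced by generic lemmas mention the carrier of an algebraic
   structure; ring and field need the concrete type. *)
Ltac Rring := lazymatch goal with |- @eq _ ?a ?b => change (@eq R a b) end; ring.
Ltac Rfield := lazymatch goal with |- @eq _ ?a ?b => change (@eq R a b) end; field.
Ltac Cring := lazymatch goal with |- @eq _ ?a ?b => change (@eq C a b) end; ring.

(** Convergence is taken componentwise, which makes the theory of real series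
    available; it agrees with convergence of partial sums in modulus. *)
Definition is_Cseries (u : nat -> C) (l : C) : Prop :=
  is_series (fun k => Re (u k)) (Re l) /\ is_series (fun k => Im (u k)) (Im l).

Lemma sum_n_Re (u : nat -> C) n : Re (sum_n u n) = sum_n (fun k => Re (u k)) n.
Proof.
  induction n as [|n IH]; [now rewrite !sum_O|].
  rewrite !sum_Sn, <- IH. reflexivity.
Qed.

Lemma sum_n_Im (u : nat -> C) n : Im (sum_n u n) = sum_n (fun k => Im (u k)) n.
Proof.
  induction n as [|n IH]; [now rewrite !sum_O|].
  rewrite !sum_Sn, <- IH. reflexivity.
Qed.

Lemma is_Cseries_ext u v l : (forall k, u k = v k) -> is_Cseries u l -> is_Cseries v l.
Proof.
  intros H [H1 H2]; split.
  - eapply is_series_ext; [|exact H1]; intros k; cbn; now rewrite H.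
  - eapply is_series_ext; [|exact H2]; intros k; cbn; now rewrite H.
Qed.

Lemma is_Cseries_unique u l l' : is_Cseries u l -> is_Cseries u l' -> l = l'.
Proof.
  intros [H1 H2] [H3 H4]. destruct l as [a b], l' as [a' b']. cbn in *.
  apply is_series_unique in H1, H2, H3, H4. congruence.
Qed.

Lemma is_Cseries_scal c u l : is_Cseries u l -> is_Cseries (fun k => c * u k)%C (c * l)%C.
Proof.
  intros [H1 H2]; destruct c as [a b]; split; cbn.
  - exact (is_series_minus _ _ _ _ (is_series_scal a _ _ H1) (is_series_scal b _ _ H2)).
  - exact (is_series_plus _ _ _ _ (is_series_scal a _ _ H2) (is_series_scal b _ _ H1)).
Qed.

Lemma Im_le_Cmod c : Rabs (Im c) <= Cmod c.
Proof. eapply Rle_trans; [apply Rmax_r | apply Rmax_Cmod]. Qed.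

Lemma Cmod_le_Re_Im c : Cmod c <= Rabs (Re c) + Rabs (Im c).
Proof.
  destruct c as [x y].
  replace (x, y) with (RtoC x + RtoC y * Ci)%C
    by (unfold RtoC, Ci, Cplus, Cmult; cbn; f_equal; ring).
  eapply Rle_trans; [apply Cmod_triangle|].
  rewrite Cmod_mult, Cmod_Ci, !Cmod_R; cbn.
  rewrite <- ?RtoC_mult.
  apply Req_le; f_equal; [f_equal; ring | rewrite Rmult_1_r; f_equal; ring].
Qed.

Lemma ex_series_dom (u v : nat -> R) :
  (forall k, Rabs (u k) <= v k) -> ex_series v -> ex_series u.
Proof. intros H Hv. exact (ex_series_le (V := R_CompleteNormedModule) u v H Hv). Qed.

Lemma ex_series_Rscal (c : R) (v : nat -> R) : ex_series v -> ex_series (fun k => c * v k).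
Proof. intros [l H]. exists (c * l). exact (is_series_scal c v l H). Qed.

Definition CSeries (u : nat -> C) : C :=
  (Series (fun k => Re (u k)), Series (fun k => Im (u k))).

Lemma CSeries_correct (u : nat -> C) (v : nat -> R) :
  (forall k, Cmod (u k) <= v k) -> ex_series v -> is_Cseries u (CSeries u).
Proof.
  intros H Hv. split; apply Series_correct; apply (ex_series_dom _ v); auto; intros k.
  - eapply Rle_trans; [apply re_le_Cmod | apply H].
  - eapply Rle_trans; [apply Im_le_Cmod | apply H].
Qed.

Lemma is_lim_seq_Rabs_le (u : nat -> R) (l M : R) :
  is_lim_seq u l -> (forall n, Rabs (u n) <= M) -> Rabs l <= M.
Proof.
  intros H Hb.
  exact (is_lim_seq_le _ _ (Rabs l) M Hb (is_lim_seq_abs _ _ H) (is_lim_seq_const M)).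
Qed.

Lemma Cmod_sum_n (u : nat -> C) n : Cmod (sum_n u n) <= sum_n (fun k => Cmod (u k)) n.
Proof.
  induction n as [|n IH]; [now rewrite !sum_O; apply Rle_refl|].
  rewrite !sum_Sn. eapply Rle_trans; [apply Cmod_triangle|].
  apply Rplus_le_compat; auto; lra.
Qed.

Lemma is_series_zero : is_series (fun _ : nat => 0) 0.
Proof.
  change (is_lim_seq (sum_n (fun _ : nat => 0)) 0).
  eapply is_lim_seq_ext; [|apply is_lim_seq_const]. intros n; rewrite sum_n_const; ring.
Qed.

Lemma is_Cseries_RtoC (u : nat -> R) l :
  is_series u l -> is_Cseries (fun k => RtoC (u k)) (RtoC l).
Proof. intros H; split; [exact H|exact is_series_zero]. Qed.

Lemma is_series_lim_seq (u : nat -> R) l : is_series u l <-> is_lim_seq (sum_n u) l.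
Proof. reflexivity. Qed.

Lemma is_Cseries_eps u l :
  is_Cseries u l <-> forall eps, 0 < eps -> exists N, forall n, (N <= n)%nat ->
    Cmod (sum_n u n - l)%C < eps.
Proof.
  split.
  - intros [H1 H2] eps He.
    apply is_series_lim_seq, is_lim_seq_spec in H1.
    apply is_series_lim_seq, is_lim_seq_spec in H2.
    assert (He2 : 0 < eps / 2) by lra.
    destruct (H1 (mkposreal _ He2)) as [N1 HN1].
    destruct (H2 (mkposreal _ He2)) as [N2 HN2].
    exists (Nat.max N1 N2); intros n Hn.
    eapply Rle_lt_trans; [apply Cmod_le_Re_Im|].
    specialize (HN1 n ltac:(lia)); specialize (HN2 n ltac:(lia)).
    change (pos (mkposreal _ He2)) with (eps / 2) in HN1, HN2.
    rewrite <- sum_n_Re in HN1; rewrite <- sum_n_Im in HN2.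
    replace (Re (sum_n u n - l)%C) with (Re (sum_n u n) - Re l) by (cbn; unfold Re; ring).
    replace (Im (sum_n u n - l)%C) with (Im (sum_n u n) - Im l) by (cbn; unfold Im; ring).
    lra.
  - intros H; split; apply is_series_lim_seq, is_lim_seq_spec; intros eps;
      destruct (H eps (cond_pos eps)) as [N HN]; exists N; intros n Hn;
      specialize (HN n Hn).
    + rewrite <- sum_n_Re.
      replace (Re (sum_n u n) - Re l) with (Re (sum_n u n - l)%C) by (cbn; unfold Re; ring).
      eapply Rle_lt_trans; [apply re_le_Cmod|exact HN].
    + rewrite <- sum_n_Im.
      replace (Im (sum_n u n) - Im l) with (Im (sum_n u n - l)%C) by (cbn; unfold Im; ring).
      eapply Rle_lt_trans; [apply Im_le_Cmod|exact HN].
Qed.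

Lemma le_of_forall_eps (a b : R) : (forall eps, 0 < eps -> a <= b + eps) -> a <= b.
Proof.
  intros H. destruct (Rle_lt_dec a b) as [|Hlt]; auto.
  specialize (H ((a - b) / 2) ltac:(lra)). lra.
Qed.

Lemma sum_n_le_Series (v : nat -> R) n :
  (forall k, 0 <= v k) -> ex_series v -> sum_n v n <= Series v.
Proof.
  intros Hp Hv.
  assert (Hl := Series_correct _ Hv).
  apply (is_lim_seq_incr_compare (sum_n v)); [exact Hl|].
  intros k; rewrite sum_Sn; unfold plus; cbn; specialize (Hp (S k)); lra.
Qed.

Lemma is_Cseries_bound u v l :
  (forall k, Cmod (u k) <= v k) -> ex_series v -> is_Cseries u l -> Cmod l <= Series v.
Proof.
  intros H Hv Hu. apply le_of_forall_eps; intros eps He.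
  destruct (proj1 (is_Cseries_eps _ _) Hu eps He) as [N HN].
  specialize (HN N (le_n N)).
  replace l with (sum_n u N - (sum_n u N - l))%C by ring.
  eapply Rle_trans; [apply Cmod_triangle|]. rewrite Cmod_opp.
  apply Rplus_le_compat; [|lra].
  eapply Rle_trans; [apply Cmod_sum_n|].
  eapply Rle_trans; [apply sum_n_m_le; exact H|].
  apply sum_n_le_Series; auto.
  intros k; eapply Rle_trans; [apply Cmod_ge_0|apply H].
Qed.

(** Comparison with a positive series also controls the remainders; this is the
    Weierstrass test for uniform convergence. *)
Lemma is_Cseries_tail u v l N :
  (forall k, Cmod (u k) <= v k) -> ex_series v -> is_Cseries u l ->
  Cmod (l - sum_n u N) <= Series v - sum_n v N.
Proof.
  intros H Hv Hu.
  assert (Hv0 : forall k, 0 <= v k) by (intros k; eapply Rle_trans; [apply Cmod_ge_0|apply H]).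
  apply le_of_forall_eps. intros e' He'.
  destruct (proj1 (is_Cseries_eps _ _) Hu e' He') as [N' HN'].
  set (M := (N' + S N)%nat). specialize (HN' M ltac:(unfold M; lia)).
  replace (l - sum_n u N)%C with ((sum_n u M - sum_n u N) - (sum_n u M - l))%C by ring.
  eapply Rle_trans; [apply Cmod_triangle|]. rewrite Cmod_opp.
  apply Rplus_le_compat; [|lra].
  assert (E : (sum_n u M - sum_n u N)%C = sum_n_m u (S N) M).
  { unfold sum_n. rewrite (sum_n_m_Chasles u 0 N M) by (unfold M; lia).
    unfold plus; cbn. ring. }
  rewrite E.
  refine (Rle_trans _ _ _ (norm_sum_n_m (V := C_NormedModule) u (S N) M) _).
  apply Rle_trans with (sum_n_m v (S N) M); [apply sum_n_m_le; exact H|].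
  assert (E2 : sum_n_m v (S N) M = sum_n v M - sum_n v N).
  { unfold sum_n. rewrite (sum_n_m_Chasles v 0 N M) by (unfold M; lia).
    unfold plus; cbn. ring. }
  rewrite E2. assert (H1 := sum_n_le_Series v M Hv0 Hv). lra.
Qed.

Lemma Rdiv_lt_1 x y : 0 < y -> x < y -> x / y < 1.
Proof.
  intros Hy H. apply Rmult_lt_reg_r with y; auto.
  unfold Rdiv. rewrite Rmult_assoc, Rinv_l; lra.
Qed.

Lemma Rdiv_le_1 x y : 0 < y -> x <= y -> x / y <= 1.
Proof.
  intros Hy H. apply Rmult_le_reg_r with y; auto.
  unfold Rdiv. rewrite Rmult_assoc, Rinv_l; lra.
Qed.

Lemma exp_le x y : x <= y -> exp x <= exp y.
Proof. intros [H|H]; [now apply Rlt_le, exp_increasing|rewrite H; lra]. Qed.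

Lemma exp_le_1 x : x <= 0 -> exp x <= 1.
Proof. intros H. apply Rle_trans with (exp 0); [now apply exp_le|rewrite exp_0; lra]. Qed.

Lemma RtoC_m1 : RtoC (-1) = (- (1))%C.
Proof. unfold RtoC, Copp; cbn; f_equal; ring. Qed.

Lemma CV_radius_gt (a : nat -> R) x y :
  Rabs x < y -> ex_series (fun n => a n * y ^ n) -> Rbar_lt (Rabs x) (CV_radius a).
Proof.
  intros Hxy Hex. apply Rbar_lt_le_trans with y; [exact Hxy|].
  apply (proj1 (CV_radius_bounded a) y). apply ex_series_lim_0 in Hex.
  destruct (filterlim_bounded (V := R_NormedModule) (fun n => a n * y ^ n)) as [M HM].
  - exists 0. exact Hex.
  - exists M. exact HM.
Qed.

(** * Summation of double series along antidiagonals *)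

Definition diag {G : AbelianMonoid} (a : nat -> nat -> G) (N : nat) : G :=
  sum_n (fun i => a (N - i)%nat i) N.

Lemma sum_n_rev {G : AbelianMonoid} (g : nat -> G) M : sum_n g M = sum_n (fun i => g (M - i)%nat) M.
Proof.
  revert g; induction M as [|M IHM]; intros g; [now rewrite !sum_O|].
  rewrite sum_Sn, IHM.
  unfold sum_n at 2. rewrite sum_Sn_m by lia.
  rewrite Nat.sub_0_r, plus_comm. f_equal.
  rewrite <- sum_n_m_S. reflexivity.
Qed.

Lemma sum_diag (a : nat -> nat -> R) N :
  sum_n (diag a) N = sum_n (fun l => sum_n (a l) (N - l)) N.
Proof.
  induction N as [|N IH].
  - unfold diag. now rewrite !sum_O.
  - rewrite sum_Sn, IH, sum_Sn, Nat.sub_diag, sum_O.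
    replace (sum_n (fun l => sum_n (a l) (S N - l)) N)
      with (sum_n (fun l => plus (sum_n (a l) (N - l)) (a l (S N - l)%nat)) N).
    2:{ apply sum_n_ext_loc; intros l Hl.
        replace (S N - l)%nat with (S (N - l)) by lia. now rewrite sum_Sn. }
    rewrite sum_n_plus, <- plus_assoc. f_equal.
    unfold diag. rewrite sum_n_rev, sum_Sn, Nat.sub_diag, Nat.sub_0_r. f_equal.
    apply sum_n_ext_loc; intros i Hi. f_equal; lia.
Qed.

Lemma sum_n_Rabs (u v : nat -> R) n :
  (forall k, Rabs (u k) <= v k) -> Rabs (sum_n u n) <= sum_n v n.
Proof.
  intros H. induction n as [|n IH]; [rewrite !sum_O; apply H|].
  rewrite !sum_Sn. eapply Rle_trans; [apply Rabs_triang|].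
  apply Rplus_le_compat; auto.
Qed.

Lemma sum_n_le_loc (u v : nat -> R) n :
  (forall k, (k <= n)%nat -> u k <= v k) -> sum_n u n <= sum_n v n.
Proof.
  induction n as [|n IH]; intros H; [rewrite !sum_O; apply H; lia|].
  rewrite !sum_Sn. apply Rplus_le_compat; auto.
Qed.

Lemma sum_n_m_Rabs (u v : nat -> R) m n :
  (forall k, Rabs (u k) <= v k) -> Rabs (sum_n_m u m n) <= sum_n_m v m n.
Proof.
  intros H.
  eapply Rle_trans; [exact (norm_sum_n_m (V := R_NormedModule) u m n)|].
  apply sum_n_m_le; exact H.
Qed.

Lemma is_lim_seq_sum_n (a : nat -> nat -> R) (r : nat -> R) N :
  (forall l, is_lim_seq (a l) (r l)) ->
  is_lim_seq (fun M => sum_n (fun l => a l M) N) (sum_n r N).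
Proof.
  intros H. induction N as [|N IH].
  - rewrite sum_O. eapply is_lim_seq_ext; [|apply H]. intros M; now rewrite sum_O.
  - rewrite sum_Sn. eapply is_lim_seq_ext; [|exact (is_lim_seq_plus' _ _ _ _ IH (H (S N)))].
    intros M; now rewrite sum_Sn.
Qed.

(** The rows up to N contain the antidiagonals up to N, so that the two partial sums
    differ by at most the remainder of the series of antidiagonals of the majorant. *)
Lemma series_diag (a b : nat -> nat -> R) (r : nat -> R) :
  (forall l i, Rabs (a l i) <= b l i) -> ex_series (diag b) ->
  (forall l, is_series (a l) (r l)) ->
  exists S, is_series r S /\ is_series (diag a) S.
Proof.
  intros Hab Hb Hr.
  assert (Hb0 : forall l i, 0 <= b l i)
    by (intros; eapply Rle_trans; [apply Rabs_pos|apply Hab]).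
  assert (Hd : ex_series (diag a)).
  { apply (ex_series_dom _ (diag b)); auto. intros N. unfold diag.
    apply sum_n_Rabs; auto. }
  exists (Series (diag a)). split; [|now apply Series_correct].
  assert (Hdb0 : forall N, 0 <= diag b N).
  { intros N; unfold diag.
    apply Rle_trans with (sum_n (fun _ : nat => 0) N).
    - rewrite sum_n_const; lra.
    - apply sum_n_m_le; auto. }
  set (e := fun N => Series (diag b) - sum_n (diag b) N).
  assert (He : is_lim_seq e 0).
  { replace (Finite 0) with (Finite (Series (diag b) - Series (diag b))) by (f_equal; ring).
    apply is_lim_seq_minus'; [apply is_lim_seq_const|]. exact (Series_correct _ Hb). }
  assert (Hclose : forall N, Rabs (sum_n r N - sum_n (diag a) N) <= e N).
  { intros N.
    assert (Hlim : is_lim_seq (fun M => sum_n (fun l => sum_n (a l) M) N - sum_n (diag a) N)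
              (sum_n r N - sum_n (diag a) N)).
    { apply is_lim_seq_minus'; [|apply is_lim_seq_const].
      apply (is_lim_seq_sum_n (fun l M => sum_n (a l) M)). intros l; exact (Hr l). }
    apply (is_lim_seq_incr_n _ N) in Hlim.
    apply (is_lim_seq_Rabs_le _ _ _ Hlim). intros M.
    rewrite !sum_diag.
    assert (E : forall g : nat -> nat -> R, sum_n (fun l => sum_n (g l) (M + N)) N -
      sum_n (fun l => sum_n (g l) (N - l)) N =
      sum_n (fun l => sum_n_m (g l) (S (N - l)) (M + N)) N).
    { intros g.
      rewrite (sum_n_ext_loc (fun l => sum_n (g l) (M + N))
        (fun l => plus (sum_n (g l) (N - l)) (sum_n_m (g l) (S (N - l)) (M + N)))).
      - rewrite sum_n_plus. unfold plus; cbn; ring.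
      - intros l Hl. unfold sum_n. apply sum_n_m_Chasles; lia. }
    rewrite E.
    apply Rle_trans with (sum_n (fun l => sum_n_m (b l) (S (N - l)) (M + N)) N).
    { apply sum_n_Rabs. intros l. apply sum_n_m_Rabs; auto. }
    rewrite <- E. unfold e. rewrite <- sum_diag.
    apply Rplus_le_compat_r.
    apply Rle_trans with (sum_n (diag b) (M + N + N)); [|now apply sum_n_le_Series].
    rewrite sum_diag.
    apply Rle_trans with (sum_n (fun l => sum_n (b l) (M + N + N - l)) N).
    { apply sum_n_le_loc. intros l Hl. unfold sum_n.
      rewrite (sum_n_m_Chasles (b l) 0 (M + N) (M + N + N - l)) by lia.
      rewrite <- (Rplus_0_r (sum_n_m (b l) 0 (M + N))) at 1.
      apply Rplus_le_compat_l.
      eapply Rle_trans; [|apply sum_n_m_le; apply Hb0]. rewrite sum_n_m_const; lra. }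
    unfold sum_n at 1 3.
    rewrite (sum_n_m_Chasles _ 0 N (M + N + N)) by lia.
    rewrite <- (Rplus_0_r (sum_n_m _ 0 N)) at 1.
    apply Rplus_le_compat_l.
    eapply Rle_trans; [|apply sum_n_m_le; intros l; eapply Rle_trans; [|apply sum_n_m_le; apply Hb0]].
    - instantiate (1 := fun _ => 0). rewrite sum_n_m_const; lra.
    - rewrite sum_n_m_const; lra. }
  apply is_series_lim_seq.
  apply is_lim_seq_ext with (fun N => sum_n (diag a) N + (sum_n r N - sum_n (diag a) N)).
  { intros; ring. }
  replace (Finite (Series (diag a))) with (Finite (Series (diag a) + 0)) by (f_equal; ring).
  apply is_lim_seq_plus'; [exact (Series_correct _ Hd)|].
  apply is_lim_seq_abs_0.
  apply is_lim_seq_le_le with (fun _ => 0) e; [|apply is_lim_seq_const|exact He].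
  intros N; split; [apply Rabs_pos|apply Hclose].
Qed.

Lemma is_Cseries_diag (a : nat -> nat -> C) (b : nat -> nat -> R) (r : nat -> C) :
  (forall l i, Cmod (a l i) <= b l i) -> ex_series (diag b) ->
  (forall l, is_Cseries (a l) (r l)) ->
  exists S, is_Cseries r S /\ is_Cseries (diag a) S.
Proof.
  intros Hab Hb Hr.
  destruct (series_diag (fun l i => Re (a l i)) b (fun l => Re (r l))) as [x [Hx1 Hx2]]; auto.
  { intros l i; eapply Rle_trans; [apply re_le_Cmod|apply Hab]. }
  { intros l; apply Hr. }
  destruct (series_diag (fun l i => Im (a l i)) b (fun l => Im (r l))) as [y [Hy1 Hy2]]; auto.
  { intros l i; eapply Rle_trans; [apply Im_le_Cmod|apply Hab]. }
  { intros l; apply Hr. }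
  exists (x, y); split; split; auto.
  - eapply is_series_ext; [|exact Hx2]. intros N; unfold diag; now rewrite sum_n_Re.
  - eapply is_series_ext; [|exact Hy2]. intros N; unfold diag; now rewrite sum_n_Im.
Qed.

(** * Binomial shifts of sequences *)

(** Indexed by k and j rather than by k + j and k: it is the weight with which the
    Taylor coefficient of order k + j enters that of order j at another centre. *)
Definition binom (k j : nat) : R := INR (fact (k + j)) / (INR (fact k) * INR (fact j)).

Lemma binom_pos k j : 0 < binom k j.
Proof. apply Rdiv_lt_0_compat; [apply INR_fact_lt_0|]. apply Rmult_lt_0_compat; apply INR_fact_lt_0. Qed.

Lemma fact_S_INR n : INR (fact (S n)) = (INR n + 1) * INR (fact n).
Proof. rewrite fact_simpl, mult_INR, S_INR. reflexivity. Qed.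

Lemma binom_0_l j : binom 0 j = 1.
Proof. unfold binom; cbn [Nat.add fact]. cbn [INR]. field. apply INR_fact_neq_0. Qed.

Lemma binom_0_r k : binom k 0 = 1.
Proof. unfold binom; rewrite Nat.add_0_r; cbn [fact]. cbn [INR]. field. apply INR_fact_neq_0. Qed.

Lemma binom_S k j : binom (S k) (S j) = binom k (S j) + binom (S k) j.
Proof.
  unfold binom. replace (S k + S j)%nat with (S (S (k + j))) by lia.
  replace (k + S j)%nat with (S (k + j)) by lia.
  replace (S k + j)%nat with (S (k + j)) by lia.
  rewrite !fact_S_INR, !S_INR, plus_INR.
  field. repeat split; try apply INR_fact_neq_0;
  match goal with |- INR ?k + 1 <> 0 => generalize (pos_INR k); lra end.
Qed.

(** Each term of the binomial expansion of (y + (1 - y)) ^ (k + j) is at most 1. *)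
Lemma binom_weight k j y : 0 <= y <= 1 -> binom k j * y ^ k * (1 - y) ^ j <= 1.
Proof.
  intros Hy. revert j. induction k as [|k IH]; intros j.
  - rewrite binom_0_l. cbn [pow]. rewrite !Rmult_1_l.
    apply Rle_trans with (1 ^ j); [apply pow_incr; lra | rewrite pow1; lra].
  - induction j as [|j IHj].
    + rewrite binom_0_r. cbn [pow]. rewrite Rmult_1_r, Rmult_1_l.
      change (y * y ^ k) with (y ^ S k).
      apply Rle_trans with (1 ^ S k); [apply pow_incr; lra | rewrite pow1; lra].
    + rewrite binom_S. specialize (IH (S j)).
      replace ((binom k (S j) + binom (S k) j) * y ^ S k * (1 - y) ^ S j)
        with (y * (binom k (S j) * y ^ k * (1 - y) ^ S j) +
              (1 - y) * (binom (S k) j * y ^ S k * (1 - y) ^ j)) by (cbn [pow]; ring).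
      apply Rle_trans with (y * 1 + (1 - y) * 1); [|lra].
      apply Rplus_le_compat; apply Rmult_le_compat_l; lra.
Qed.

Lemma pow_div_le (x y : R) n : 0 <= x -> 0 < y -> (x / y) ^ n * y ^ n = x ^ n.
Proof. intros. rewrite <- Rpow_mult_distr. f_equal. field; lra. Qed.

(** The exact sum is (1 - x) ^ (- j - 1); only geometric growth in j matters. *)
Lemma binom_series (x y : R) : 0 <= x < y -> y < 1 -> forall j,
  ex_series (fun k => binom k j * x ^ k) /\
  Series (fun k => binom k j * x ^ k) <= / (1 - x / y) * (/ (1 - y)) ^ j.
Proof.
  intros Hx Hy j.
  assert (Hxy : 0 <= x / y < 1).
  { split; [apply Rdiv_le_0_compat|apply Rdiv_lt_1]; lra. }
  assert (Hle : forall k, 0 <= binom k j * x ^ k <= (/ (1 - y)) ^ j * (x / y) ^ k).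
  { intros k. split.
    - apply Rmult_le_pos; [apply Rlt_le, binom_pos|apply pow_le; lra].
    - rewrite pow_inv. assert (0 < (1 - y) ^ j) by (apply pow_lt; lra).
      apply Rmult_le_reg_r with ((1 - y) ^ j); auto.
      replace (/ (1 - y) ^ j * (x / y) ^ k * (1 - y) ^ j) with ((x / y) ^ k) by (field; lra).
      rewrite <- (pow_div_le x y k) at 1 by lra.
      assert (B := binom_weight k j y ltac:(lra)).
      replace (binom k j * ((x / y) ^ k * y ^ k) * (1 - y) ^ j) with
        ((x / y) ^ k * (binom k j * y ^ k * (1 - y) ^ j)) by ring.
      rewrite <- (Rmult_1_r ((x / y) ^ k)) at 2.
      apply Rmult_le_compat_l; auto. apply pow_le; lra. }
  assert (Hg : is_series (fun k => (/ (1 - y)) ^ j * (x / y) ^ k) ((/ (1 - y)) ^ j * / (1 - x / y))).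
  { apply (is_series_scal ((/ (1 - y)) ^ j) (fun k => (x / y) ^ k)).
    apply is_series_geom. rewrite Rabs_pos_eq; lra. }
  assert (Hex : ex_series (fun k => (/ (1 - y)) ^ j * (x / y) ^ k)) by (eexists; exact Hg).
  split.
  - apply (ex_series_dom _ (fun k => (/ (1 - y)) ^ j * (x / y) ^ k)); auto.
    intros k; rewrite Rabs_pos_eq; apply Hle.
  - rewrite Rmult_comm, <- (is_series_unique _ _ Hg). apply Series_le; auto.
Qed.

(** If u_j = F^(j)(p) / j! and b_k = z ^ k, then v_j = F^(j)(p + z) / j!: this is re-expansion of a power
    series about another centre. With general weights it is the operator
    sum_k b_k D^k / k!, and such operators commute. *)
Definition is_binom_shift (b u v : nat -> C) : Prop :=
  forall j, is_Cseries (fun k => b k * RtoC (binom k j) * u (k + j)%nat)%C (v j).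

(** The weights of a composite of two such operators. *)
Definition binom_conv (c b : nat -> C) : nat -> C :=
  diag (fun l i => RtoC (binom l i) * c l * b i)%C.

Lemma RtoC_sum_n (g : nat -> R) N : RtoC (sum_n g N) = sum_n (fun k => RtoC (g k)) N.
Proof.
  induction N as [|N IH]; [now rewrite !sum_O|].
  rewrite !sum_Sn, <- IH. unfold plus; cbn. now rewrite <- RtoC_plus.
Qed.

Lemma sum_n_Cmult (c : C) (g : nat -> C) N :
  (sum_n (fun k => c * g k) N = c * sum_n g N)%C.
Proof. exact (sum_n_m_mult_l (K := C_Ring) c g 0 N). Qed.

Lemma sum_n_shift (g : nat -> C) N : (sum_n g (S N) = g 0%nat + sum_n (fun i => g (S i)) N)%C.
Proof.
  unfold sum_n. rewrite sum_Sn_m by lia. rewrite <- sum_n_m_S. reflexivity.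
Qed.

Lemma binom_conv_pow (z w : C) N : binom_conv (fun k => z ^ k)%C (fun k => w ^ k)%C N = ((z + w) ^ N)%C.
Proof.
  induction N as [|N IH].
  - unfold binom_conv, diag. rewrite sum_O. cbn. rewrite binom_0_l. ring.
  - cbn [Cpow]. rewrite <- IH. unfold binom_conv, diag.
    (* Pascal's rule applied to each inner term *)
    rewrite sum_n_shift.
    set (t := fun i => (RtoC (binom (N - i) i) * z ^ (N - i) * w ^ i)%C).
    rewrite Cmult_plus_distr_r, <- !sum_n_Cmult.
    destruct N as [|N].
    + rewrite !sum_O. cbn. unfold t; cbn. rewrite !binom_0_l, !binom_0_r. ring.
    + rewrite sum_Sn. rewrite (sum_Sn (fun i => w * t i)%C), (sum_n_shift (fun i => z * t i)%C).
      replace (sum_n (fun i => RtoC (binom (S (S N) - S i) (S i)) * z ^ (S (S N) - S i) * w ^ S i) N)%C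
        with (sum_n (fun i => plus (z * t (S i)) (w * t i)) N)%C.
      * rewrite sum_n_plus. unfold t, plus; cbn -[Nat.sub Cpow sum_n].
        rewrite !Nat.sub_diag, !Nat.sub_0_r, !binom_0_l, !binom_0_r. cbn [Cpow]. ring.
      * apply sum_n_ext_loc. intros i Hi. unfold t, plus; cbn -[Nat.sub Cpow].
        replace (S (S N) - S i)%nat with (S (N - i)) by lia.
        replace (S N - S i)%nat with (N - i)%nat by lia.
        replace (S N - i)%nat with (S (N - i)) by lia.
        rewrite binom_S, RtoC_plus. cbn [Cpow]. ring.
Qed.

Definition geom_bound (K r : R) (u : nat -> C) : Prop := forall j, Cmod (u j) <= K * r ^ j.

Lemma geom_bound_nonneg K r u : geom_bound K r u -> 0 <= K.
Proof.
  intros H. specialize (H 0%nat). cbn in H. rewrite Rmult_1_r in H.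
  eapply Rle_trans; [apply Cmod_ge_0|exact H].
Qed.

Lemma geom_bound_pow z : geom_bound 1 (Cmod z) (fun k => z ^ k)%C.
Proof. intros j. rewrite Cmod_pow. lra. Qed.

Lemma binom_conv_sym b c N : binom_conv b c N = binom_conv c b N.
Proof.
  unfold binom_conv, diag. rewrite sum_n_rev. apply sum_n_ext_loc. intros i Hi.
  replace (N - (N - i))%nat with i by lia.
  replace (binom i (N - i)) with (binom (N - i) i); [Cring|].
  unfold binom. rewrite (Nat.add_comm i), (Rmult_comm (INR (fact i))). reflexivity.
Qed.

Lemma binom_conv_pow_R (z w : R) N : diag (fun l i => binom l i * z ^ l * w ^ i) N = (z + w) ^ N.
Proof.
  apply RtoC_inj. rewrite RtoC_pow, RtoC_plus, <- binom_conv_pow.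
  unfold binom_conv, diag. rewrite RtoC_sum_n. apply sum_n_ext. intros i.
  now rewrite !RtoC_mult, !RtoC_pow.
Qed.

Lemma binom_assoc l i j : binom l j * binom i (l + j) = binom (l + i) j * binom l i.
Proof.
  unfold binom. replace (i + (l + j))%nat with (l + i + j)%nat by lia.
  field. repeat split; apply INR_fact_neq_0.
Qed.

Lemma ex_series_binom x j : 0 <= x < 1 -> ex_series (fun k => binom k j * x ^ k).
Proof.
  intros Hx. apply (binom_series x ((1 + x) / 2)); lra.
Qed.

Lemma Cmod_term_le (p x : C) (P X t : R) : Cmod p <= P -> 0 <= t -> Cmod x <= X ->
  Cmod (p * RtoC t * x)%C <= P * t * X.
Proof.
  intros H1 H2 H3. rewrite !Cmod_mult, Cmod_R, Rabs_pos_eq by auto.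
  apply Rmult_le_compat; auto using Cmod_ge_0.
  - apply Rmult_le_pos; auto using Cmod_ge_0.
  - now apply Rmult_le_compat_r.
Qed.

(** The double series defining the composite operator is dominated by
    sum_N binom N j ((bb + cc) r) ^ N, hence can be summed along antidiagonals. *)
Lemma binom_shift_comp_ex b c u v A B K bb cc r :
  geom_bound A bb b -> geom_bound B cc c -> geom_bound K r u ->
  0 <= bb -> 0 <= cc -> 0 <= r -> (bb + cc) * r < 1 ->
  is_binom_shift b u v -> forall j, exists S,
  is_Cseries (fun k => c k * RtoC (binom k j) * v (k + j)%nat)%C S /\
  is_Cseries (fun k => binom_conv c b k * RtoC (binom k j) * u (k + j)%nat)%C S.
Proof.
  intros Hb Hc Hu Hbb Hcc Hr Hlt HT j.
  assert (HA := geom_bound_nonneg _ _ _ Hb). assert (HB := geom_bound_nonneg _ _ _ Hc).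
  assert (HK := geom_bound_nonneg _ _ _ Hu).
  destruct (is_Cseries_diag
    (fun l i => c l * RtoC (binom l j) * (b i * RtoC (binom i (l + j)) * u (i + (l + j))%nat))%C
    (fun l i => A * B * K * r ^ j * (binom (l + i) j * r ^ (l + i) * (binom l i * cc ^ l * bb ^ i)))
    (fun l => c l * RtoC (binom l j) * v (l + j)%nat)%C) as [S [HS1 HS2]].
  - intros l i.
    replace (binom (l + i) j * r ^ (l + i) * (binom l i * cc ^ l * bb ^ i)) with
      (r ^ (l + i) * ((binom (l + i) j * binom l i) * cc ^ l * bb ^ i)) by ring.
    rewrite <- binom_assoc.
    replace (A * B * K * r ^ j * (r ^ (l + i) * (binom l j * binom i (l + j) * cc ^ l * bb ^ i)))
      with ((B * cc ^ l) * binom l j * ((A * bb ^ i) * binom i (l + j) * (K * r ^ (i + (l + j)))))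
      by (rewrite !pow_add; ring).
    apply Cmod_term_le; [apply Hc|apply Rlt_le, binom_pos|].
    apply Cmod_term_le; [apply Hb|apply Rlt_le, binom_pos|apply Hu].
  - apply ex_series_ext with (fun N => (A * B * K * r ^ j) * (binom N j * ((bb + cc) * r) ^ N)).
    + intros N. unfold diag.
      rewrite Rpow_mult_distr, (Rplus_comm bb), <- binom_conv_pow_R. unfold diag.
      replace (A * B * K * r ^ j *
        (binom N j * (sum_n (fun i => binom (N - i) i * cc ^ (N - i) * bb ^ i) N * r ^ N)))
      with ((A * B * K * r ^ j * binom N j * r ^ N) *
        (sum_n (fun i => binom (N - i) i * cc ^ (N - i) * bb ^ i) N)) by ring.
      rewrite <- (sum_n_mult_l (K := R_Ring)). apply sum_n_ext_loc. intros i Hi.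
      replace (N - i + i)%nat with N by lia. unfold mult; cbn. ring.
    + apply ex_series_Rscal. apply ex_series_binom. split; [|lra].
      apply Rmult_le_pos; lra.
  - intros l. apply is_Cseries_scal. exact (HT (l + j)%nat).
  - exists S. split; auto. eapply is_Cseries_ext; [|exact HS2].
    intros N. unfold binom_conv, diag.
    rewrite <- Cmult_assoc, Cmult_comm, <- sum_n_Cmult. apply sum_n_ext_loc. intros i Hi.
    replace (i + (N - i + j))%nat with (N + j)%nat by lia.
    assert (E := binom_assoc (N - i) i j). replace (N - i + i)%nat with N in E by lia.
    replace (RtoC (binom (N - i) i) * c (N - i)%nat * b i)%C with
      (RtoC (binom (N - i) i) * (c (N - i)%nat * b i))%C by ring.
    transitivity ((RtoC (binom (N - i) j) * RtoC (binom i (N - i + j))) *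
       (c (N - i)%nat * b i * u (N + j)%nat))%C; [Cring|].
    rewrite <- RtoC_mult, E, RtoC_mult. Cring.
Qed.

(** Both composites have the weights of a symmetric convolution. In analytic
    terms: a relation between Taylor coefficients at one centre is carried to
    another centre. *)
Lemma binom_shift_comm b c u v w x A B K bb cc r :
  geom_bound A bb b -> geom_bound B cc c -> geom_bound K r u ->
  0 <= bb -> 0 <= cc -> 0 <= r -> (bb + cc) * r < 1 ->
  is_binom_shift b u v -> is_binom_shift c u w -> is_binom_shift c v x -> is_binom_shift b w x.
Proof.
  intros Hb Hc Hu Hbb Hcc Hr Hlt H1 H2 H3 j.
  destruct (binom_shift_comp_ex b c u v A B K bb cc r Hb Hc Hu Hbb Hcc Hr Hlt H1 j) as [S [HS1 HS2]].
  rewrite (is_Cseries_unique _ _ _ (H3 j) HS1).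
  destruct (binom_shift_comp_ex c b u w B A K cc bb r Hc Hb Hu Hcc Hbb Hr ltac:(lra) H2 j) as [S' [HS1' HS2']].
  replace S with S'; auto.
  apply (is_Cseries_unique _ _ _ HS2'). eapply is_Cseries_ext; [|exact HS2].
  intros k; cbv beta. now rewrite (binom_conv_sym c b).
Qed.

Lemma binom_shift_ext b b' u v : (forall k, b k = b' k) -> is_binom_shift b u v -> is_binom_shift b' u v.
Proof. intros H HT j. eapply is_Cseries_ext; [|apply HT]. intros k; cbn; now rewrite H. Qed.

(** Re-expanding about p + z and then about p + z + w. *)
Lemma binom_shift_pow_add z w u v x K r :
  geom_bound K r u -> 0 <= r -> (Cmod z + Cmod w) * r < 1 ->
  is_binom_shift (fun k => z ^ k)%C u v -> is_binom_shift (fun k => w ^ k)%C v x ->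
  is_binom_shift (fun k => (z + w) ^ k)%C u x.
Proof.
  intros Hu Hr Hlt H1 H2 j.
  destruct (binom_shift_comp_ex _ _ u v 1 1 K _ _ r (geom_bound_pow z) (geom_bound_pow w) Hu
    (Cmod_ge_0 z) (Cmod_ge_0 w) Hr Hlt H1 j) as [S [HS1 HS2]].
  rewrite (is_Cseries_unique _ _ _ (H2 j) HS1).
  eapply is_Cseries_ext; [|exact HS2].
  intros k. cbv beta. now rewrite binom_conv_pow, (Cplus_comm w).
Qed.

Lemma is_Cseries_single (x : C) : is_Cseries (fun k => if k then x else 0%C) x.
Proof.
  apply is_Cseries_eps. intros eps He. exists 0%nat. intros n _.
  set (g := fun k : nat => _).
  assert (E : sum_n g n = x).
  { induction n as [|n IH]; [now rewrite sum_O|].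
    rewrite sum_Sn, IH. unfold plus, g; cbn. ring. }
  rewrite E. replace (x - x)%C with (RtoC 0) by ring. now rewrite Cmod_0.
Qed.

Lemma binom_shift_pow_0 u v : is_binom_shift (fun k => 0 ^ k)%C u v -> forall j, v j = u j.
Proof.
  intros H j. apply (is_Cseries_unique _ _ _ (H j)).
  eapply is_Cseries_ext; [|apply (is_Cseries_single (u j))].
  intros [|k]; cbn; [rewrite binom_0_l|]; ring.
Qed.

Lemma binom_shift_ex b u A K bb r :
  geom_bound A bb b -> geom_bound K r u -> 0 <= bb -> 0 <= r -> bb * r < 1 ->
  exists v, is_binom_shift b u v.
Proof.
  intros Hb Hu Hbb Hr Hlt.
  exists (fun j => CSeries (fun k => b k * RtoC (binom k j) * u (k + j)%nat)%C). intros j.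
  apply CSeries_correct with (fun k => A * K * r ^ j * (binom k j * (bb * r) ^ k)).
  - intros k.
    replace (A * K * r ^ j * (binom k j * (bb * r) ^ k)) with
      (A * bb ^ k * binom k j * (K * r ^ (k + j))) by (rewrite pow_add, Rpow_mult_distr; ring).
    apply Cmod_term_le; [apply Hb|apply Rlt_le, binom_pos|apply Hu].
  - apply ex_series_Rscal. apply ex_series_binom. split; auto.
    apply Rmult_le_pos; auto.
Qed.

(** The bound on the ratio of the image depends on those of [b] and [u] only. *)
Lemma binom_shift_geom_bound b u v A K bb r : geom_bound A bb b -> geom_bound K r u -> 0 <= bb -> 0 <= r -> bb * r < 1 ->
  is_binom_shift b u v -> exists K', geom_bound K' (r * / (1 - (1 + bb * r) / 2)) v.
Proof.
  intros Hb Hu Hbb Hr Hlt HT.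
  set (x := bb * r). set (y := (1 + x) / 2).
  assert (Hx : 0 <= x) by (apply Rmult_le_pos; auto).
  exists (A * K * / (1 - x / y)). fold x y.
  intros j.
  assert (HA := geom_bound_nonneg _ _ _ Hb). assert (HK := geom_bound_nonneg _ _ _ Hu).
  destruct (binom_series x y ltac:(unfold y; fold x in Hlt; lra) ltac:(unfold y; fold x in Hlt; lra) j)
    as [E1 E2].
  eapply Rle_trans.
  - apply (is_Cseries_bound _ (fun k => A * K * r ^ j * (binom k j * x ^ k)) _) with (3 := HT j).
    + intros k.
      replace (A * K * r ^ j * (binom k j * x ^ k)) with
        (A * bb ^ k * binom k j * (K * r ^ (k + j))) by (unfold x; rewrite pow_add, Rpow_mult_distr; ring).
      apply Cmod_term_le; [apply Hb|apply Rlt_le, binom_pos|apply Hu].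
    + apply ex_series_Rscal. exact E1.
  - rewrite (Series_scal_l (A * K * r ^ j)).
    replace (A * K * / (1 - x / y) * (r * / (1 - y)) ^ j) with
      (A * K * r ^ j * (/ (1 - x / y) * (/ (1 - y)) ^ j)) by (rewrite Rpow_mult_distr; ring).
    apply Rmult_le_compat_l; auto. repeat apply Rmult_le_pos; auto. apply pow_le; auto.
Qed.

(** * The complex exponential *)
Definition cexp (z : C) : C := (exp (Re z) * cos (Im z), exp (Re z) * sin (Im z)).

Lemma Cmod_cexp z : Cmod (cexp z) = exp (Re z).
Proof.
  unfold Cmod, cexp; cbn [fst snd].
  replace ((exp (Re z) * cos (Im z)) ^ 2 + (exp (Re z) * sin (Im z)) ^ 2)
    with (exp (Re z) ^ 2 * (Rsqr (sin (Im z)) + Rsqr (cos (Im z)))) by (unfold Rsqr; ring).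
  rewrite sin2_cos2, Rmult_1_r. apply sqrt_pow2. apply Rlt_le, exp_pos.
Qed.

Lemma cexp_plus z w : cexp (z + w)%C = (cexp z * cexp w)%C.
Proof.
  destruct z as [a b], w as [c d]. unfold cexp, Cmult, Cplus, Re, Im; cbn [fst snd].
  rewrite exp_plus, cos_plus, sin_plus. f_equal; ring.
Qed.

Lemma cexp_RtoC x : cexp (RtoC x) = RtoC (exp x).
Proof. unfold cexp, RtoC; cbn. rewrite cos_0, sin_0. f_equal; ring. Qed.

Lemma exp_series x : is_series (fun k => x ^ k / INR (fact k)) (exp x).
Proof.
  eapply is_series_ext; [|exact (proj1 (is_pseries_R _ _ _) (is_exp_Reals x))].
  intros n. apply Rmult_comm.
Qed.

Lemma exp_term_le x k : 0 <= x -> x ^ k / INR (fact k) <= exp x.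
Proof.
  intros Hx.
  assert (Hp : forall n, 0 <= x ^ n / INR (fact n)).
  { intros n. apply Rdiv_le_0_compat; [now apply pow_le|apply INR_fact_lt_0]. }
  rewrite <- (is_series_unique _ _ (exp_series x)).
  eapply Rle_trans; [|apply (sum_n_le_Series _ k Hp); eexists; apply exp_series].
  destruct k as [|k]; [rewrite sum_O; lra|]. rewrite sum_Sn.
  unfold plus; cbn [AbelianMonoid.plus].
  assert (0 <= sum_n (fun k0 => x ^ k0 / INR (fact k0)) k).
  { eapply Rle_trans; [|apply sum_n_le_loc; intros i _; apply Hp]. rewrite sum_n_const; lra. }
  cbn -[sum_n fact pow] in *. lra.
Qed.

Lemma cexp_series_real x : is_Cseries (fun k => RtoC x ^ k / RtoC (INR (fact k)))%C (cexp (RtoC x)).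
Proof.
  rewrite cexp_RtoC.
  apply is_Cseries_ext with (fun k => RtoC (x ^ k / INR (fact k))).
  { intros k. rewrite RtoC_div, RtoC_pow by apply INR_fact_neq_0. reflexivity. }
  apply is_Cseries_RtoC, exp_series.
Qed.

Lemma Ci_pow_even n : (Ci ^ (2 * n))%C = RtoC ((-1) ^ n).
Proof.
  induction n as [|n IH]; [reflexivity|].
  replace (2 * S n)%nat with (S (S (2 * n))) by lia. cbn [Cpow].
  rewrite IH. cbn [pow]. rewrite RtoC_mult.
  unfold Ci, RtoC, Cmult; cbn. f_equal; ring.
Qed.

Lemma Ci_pow_odd n : (Ci ^ (2 * n + 1))%C = (RtoC ((-1) ^ n) * Ci)%C.
Proof.
  replace (2 * n + 1)%nat with (S (2 * n)) by lia. cbn [Cpow]. rewrite Ci_pow_even. ring.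
Qed.

Lemma cexp_imag y : cexp (Ci * RtoC y)%C = (cos y, sin y).
Proof.
  unfold cexp, Ci, RtoC, Cmult; cbn. replace (0 * y - 1 * 0) with 0 by ring.
  replace (0 * 0 + 1 * y) with y by ring. rewrite exp_0. f_equal; ring.
Qed.

Lemma cexp_series_imag y : is_Cseries (fun k => (Ci * RtoC y) ^ k / RtoC (INR (fact k)))%C (cexp (Ci * RtoC y)%C).
Proof.
  rewrite cexp_imag.
  assert (Hterm : forall k, ((Ci * RtoC y) ^ k / RtoC (INR (fact k)))%C =
     (Re (Ci ^ k)%C / INR (fact k) * y ^ k, Im (Ci ^ k)%C / INR (fact k) * y ^ k)).
  { intros k. rewrite Cpow_mult_l, <- RtoC_pow. unfold Cdiv.
    rewrite <- RtoC_inv by apply INR_fact_neq_0.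
    destruct (Ci ^ k)%C as [u v]. unfold RtoC, Cmult; cbn. unfold Rdiv.
    f_equal; ring. }
  split.
  - apply is_series_ext with (fun k => Re (Ci ^ k)%C / INR (fact k) * y ^ k).
    { intros k. rewrite Hterm. reflexivity. }
    cbn [fst Re].
    replace (cos y) with (cos y + y * 0) by ring.
    apply is_pseries_R.
    apply (is_pseries_odd_even (fun k => Re (Ci ^ k)%C / INR (fact k)) y (cos y) 0);
      apply is_pseries_R.
    + unfold cos. destruct (exist_cos (Rsqr y)) as [c Hcc]. unfold cos_in in Hcc.
      apply is_series_Reals in Hcc. eapply is_series_ext; [|exact Hcc].
      intros n. cbv beta. rewrite Ci_pow_even, Rsqr_pow2. reflexivity.
    + apply is_series_ext with (fun _ => 0); [|exact is_series_zero].
      intros n. rewrite Ci_pow_odd. unfold Re, Ci, RtoC, Cmult, Rdiv; cbn [fst snd]. Rring.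
  - apply is_series_ext with (fun k => Im (Ci ^ k)%C / INR (fact k) * y ^ k).
    { intros k. rewrite Hterm. reflexivity. }
    cbn [snd Im].
    unfold sin. destruct (exist_sin (Rsqr y)) as [s Hss]. unfold sin_in in Hss.
    replace (y * s) with (0 + y * s) by ring.
    apply is_pseries_R.
    apply (is_pseries_odd_even (fun k => Im (Ci ^ k)%C / INR (fact k)) y 0 s);
      apply is_pseries_R.
    + apply is_series_ext with (fun _ => 0); [|exact is_series_zero].
      intros n. rewrite Ci_pow_even. unfold Im, RtoC, Rdiv; cbn [fst snd]. Rring.
    + apply is_series_Reals in Hss. eapply is_series_ext; [|exact Hss].
      intros n. cbv beta. rewrite Ci_pow_odd, Rsqr_pow2. unfold sin_n.
      unfold Im, Ci, RtoC, Cmult, Rdiv; cbn [fst snd]. Rring.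
Qed.

(** Up to the factor e, the numbers 1 / j! are their own binomial shift, with
    weights z ^ k and e = exp z. The addition rule for shifts then gives the series
    of exp (x + i y) from those of exp x and exp (i y). *)
Lemma binom_shift_exp z e : is_Cseries (fun k => z ^ k / RtoC (INR (fact k)))%C e ->
  is_binom_shift (fun k => z ^ k)%C (fun j => RtoC (/ INR (fact j))) (fun j => e * RtoC (/ INR (fact j)))%C.
Proof.
  intros H j. rewrite Cmult_comm. eapply is_Cseries_ext; [|apply is_Cseries_scal; exact H].
  intros k. cbv beta. unfold binom, Cdiv. rewrite <- RtoC_inv by apply INR_fact_neq_0.
  transitivity (z ^ k * RtoC (/ INR (fact j) * / INR (fact k)))%C.
  - rewrite RtoC_mult. ring.
  - rewrite <- Cmult_assoc, <- RtoC_mult. do 2 f_equal. field.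
    repeat split; apply INR_fact_neq_0.
Qed.

Lemma geom_bound_inv_fact r : 0 < r -> geom_bound (exp (/ r)) r (fun j => RtoC (/ INR (fact j))).
Proof.
  intros Hr j. rewrite Cmod_R, Rabs_pos_eq by (apply Rlt_le, Rinv_0_lt_compat, INR_fact_lt_0).
  assert (H := exp_term_le (/ r) j ltac:(apply Rlt_le, Rinv_0_lt_compat; auto)).
  rewrite pow_inv in H. assert (Hp : 0 < r ^ j) by now apply pow_lt.
  replace (/ INR (fact j)) with (/ r ^ j / INR (fact j) * r ^ j)
    by (field; split; [apply INR_fact_neq_0|lra]).
  apply Rmult_le_compat_r; lra.
Qed.

Lemma Cre_im (z : C) : z = (RtoC (Re z) + Ci * RtoC (Im z))%C.
Proof. destruct z as [x y]. unfold RtoC, Ci, Cplus, Cmult; cbn. f_equal; ring. Qed.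

Lemma cexp_series z : is_Cseries (fun k => z ^ k / RtoC (INR (fact k)))%C (cexp z).
Proof.
  set (x := RtoC (Re z)). set (y := (Ci * RtoC (Im z))%C).
  set (r := / (Cmod x + Cmod y + 1)).
  assert (Hxy : 0 <= Cmod x + Cmod y) by (apply Rplus_le_le_0_compat; apply Cmod_ge_0).
  assert (Hr : 0 < r) by (apply Rinv_0_lt_compat; lra).
  assert (H1 := binom_shift_exp x _ (cexp_series_real (Re z))).
  assert (H2 : is_binom_shift (fun k => y ^ k)%C (fun j => cexp x * RtoC (/ INR (fact j)))%C
      (fun j => cexp x * (cexp y * RtoC (/ INR (fact j))))%C).
  { intros j. eapply is_Cseries_ext; [|apply is_Cseries_scal; apply (binom_shift_exp y _ (cexp_series_imag (Im z)))].
    intros k. cbv beta. ring. }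
  assert (Hlt : (Cmod x + Cmod y) * r < 1).
  { unfold r. apply Rmult_lt_reg_r with (Cmod x + Cmod y + 1); [lra|].
    rewrite Rmult_assoc, Rinv_l; lra. }
  assert (H := binom_shift_pow_add x y _ _ _ _ r (geom_bound_inv_fact r Hr) (Rlt_le _ _ Hr) Hlt H1 H2 0%nat).
  cbn in H.
  assert (Hz : z = (x + y)%C) by apply Cre_im.
  replace (cexp z) with (cexp x * (cexp y * RtoC (/ 1)))%C
    by (rewrite Hz, cexp_plus, Rinv_1; ring).
  eapply is_Cseries_ext; [|exact H].
  intros k. cbv beta. rewrite binom_0_r, Nat.add_0_r, <- Hz. unfold Cdiv.
  rewrite <- RtoC_inv by apply INR_fact_neq_0. ring.
Qed.

(** * Improper integrals of exponentially decaying functions *)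

Definition cont (w : R -> R) : Prop := forall x, continuous w x.

Lemma cont_ex_RInt w a b : cont w -> ex_RInt w a b.
Proof. intros H. apply (ex_RInt_continuous (V := R_CompleteNormedModule)). intros; apply H. Qed.

Lemma cont_plus u v : cont u -> cont v -> cont (fun x => u x + v x).
Proof. intros Hu Hv x. apply (continuous_plus u v x); auto. Qed.
Lemma cont_mult u v : cont u -> cont v -> cont (fun x => u x * v x).
Proof. intros Hu Hv x. apply (continuous_mult u v x); auto. Qed.
Lemma cont_minus u v : cont u -> cont v -> cont (fun x => u x - v x).
Proof. intros Hu Hv x. apply (continuous_minus u v x); auto. Qed.
Lemma cont_const c : cont (fun _ => c).
Proof. intros x. apply continuous_const. Qed.
Lemma cont_id : cont (fun x => x).
Proof. intros x. apply continuous_id. Qed.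
Lemma cont_scal c u : cont u -> cont (fun x => c * u x).
Proof. intros Hu. apply cont_mult; auto. apply cont_const. Qed.
Lemma cont_ext u v : (forall x, u x = v x) -> cont u -> cont v.
Proof. intros H Hu x. apply (continuous_ext u v x); auto. Qed.
Lemma cont_pow k : cont (fun x => x ^ k).
Proof.
  induction k as [|k IH]; cbn; [apply cont_const|].
  apply cont_mult; auto. apply cont_id.
Qed.
Lemma cont_derive u du : (forall x, is_derive u x (du x)) -> cont u.
Proof. intros H x. apply (ex_derive_continuous (V := R_NormedModule)). eexists; apply H. Qed.
Lemma cont_exp c : cont (fun x => exp (c * x)).
Proof. apply cont_derive with (fun x => c * exp (c * x)). intros x. auto_derive; auto; ring. Qed.

(** A total function: its value is meaningful once the limit exists, for instance
    under [exp_decay] with a positive rate. *)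
Definition Int0oo (w : R -> R) : R := real (Lim (fun T => RInt w 0 T) p_infty).

Definition exp_decay (M s : R) (w : R -> R) : Prop :=
  cont w /\ forall x, 0 <= x -> Rabs (w x) <= M * exp (- s * x).

Lemma exp_decay_nonneg M s w : exp_decay M s w -> 0 <= M.
Proof.
  intros [_ H]. specialize (H 0 (Rle_refl 0)). rewrite Rmult_0_r, exp_0, Rmult_1_r in H.
  eapply Rle_trans; [apply Rabs_pos|exact H].
Qed.

Lemma is_RInt_exp M s a b : s <> 0 ->
  is_RInt (fun x => M * exp (- s * x)) a b (M / s * exp (- s * a) - M / s * exp (- s * b)).
Proof.
  intros Hs.
  replace (M / s * exp (- s * a) - M / s * exp (- s * b))
    with (minus ((fun x => - (M / s) * exp (- s * x)) b) ((fun x => - (M / s) * exp (- s * x)) a))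
    by (unfold minus, plus, opp; cbn; ring).
  apply (is_RInt_derive (V := R_CompleteNormedModule) (fun x => - (M / s) * exp (- s * x))).
  - intros x _. auto_derive; auto. field; auto.
  - intros x _. apply (cont_scal M _ (cont_exp (- s))).
Qed.

Lemma RInt_exp_decay_bound M s w a b : 0 < s -> exp_decay M s w -> 0 <= a <= b ->
  Rabs (RInt w a b) <= M / s * exp (- s * a) - M / s * exp (- s * b).
Proof.
  intros Hs [Hc Hb] Hab.
  eapply Rle_trans; [apply abs_RInt_le; [lra|now apply cont_ex_RInt]|].
  rewrite <- (is_RInt_unique _ _ _ _ (is_RInt_exp M s a b ltac:(lra))).
  apply RInt_le; [lra| | |].
  - apply cont_ex_RInt. intros x. apply continuous_comp; [apply Hc|apply continuous_Rabs].
  - eexists; apply is_RInt_exp; lra.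
  - intros x Hx. apply Hb. lra.
Qed.

Lemma exp_neg_lim s : 0 < s -> is_lim (fun x => exp (- s * x)) p_infty 0.
Proof.
  intros Hs. apply is_lim_comp with m_infty.
  - apply is_lim_exp_m.
  - replace m_infty with (Rbar_mult (- s) p_infty).
    + apply is_lim_scal_l. apply is_lim_id.
    + cbn. destruct Rle_dec; [exfalso; lra|]. reflexivity.
  - exists 0. intros; discriminate.
Qed.

Lemma RInt_exp_decay_tail M s w a b : 0 < s -> exp_decay M s w -> 0 <= a <= b ->
  Rabs (RInt w a b) <= M / s * exp (- s * a).
Proof.
  intros Hs Hw Hab. eapply Rle_trans; [now apply (RInt_exp_decay_bound M s)|].
  assert (0 <= M / s * exp (- s * b)).
  { apply Rmult_le_pos; [|apply Rlt_le, exp_pos].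
    apply Rdiv_le_0_compat; auto. exact (exp_decay_nonneg _ _ _ Hw). }
  lra.
Qed.

Lemma RInt_diff w a b : cont w -> RInt w 0 b - RInt w 0 a = RInt w a b.
Proof.
  intros Hc. rewrite <- (RInt_Chasles w 0 a b) by now apply cont_ex_RInt.
  unfold plus; cbn. ring.
Qed.

Lemma Int0oo_lim M s w : 0 < s -> exp_decay M s w -> is_lim (fun T => RInt w 0 T) p_infty (Int0oo w).
Proof.
  intros Hs Hw.
  assert (He : exists y : R, filterlim (fun T => RInt w 0 T) (Rbar_locally p_infty) (locally y)).
  { apply (filterlim_locally_cauchy (U := R_CompleteSpace)). intros eps.
    assert (HM := exp_decay_nonneg _ _ _ Hw).
    assert (Hl := exp_neg_lim s Hs).
    assert (HMs : 0 <= M / s) by (apply Rdiv_le_0_compat; auto).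
    assert (Hd : 0 < eps / (M / s + 1)) by (apply Rdiv_lt_0_compat; [apply cond_pos|lra]).
    apply is_lim_spec in Hl. destruct (Hl (mkposreal _ Hd)) as [X HX].
    assert (Hsmall : forall a b, Rmax X 0 < a -> a <= b -> Rabs (RInt w a b) < eps).
    { intros a b Ha Hab.
      assert (X < a /\ 0 < a) as [Ha1 Ha2]
        by (split; eapply Rle_lt_trans; [apply Rmax_l|exact Ha|apply Rmax_r|exact Ha]).
      eapply Rle_lt_trans; [apply (RInt_exp_decay_tail M s); auto; lra|].
      specialize (HX a Ha1). cbn in HX. rewrite Rminus_0_r, Rabs_pos_eq in HX by apply Rlt_le, exp_pos.
      apply Rle_lt_trans with ((M / s + 1) * exp (- s * a)).
      - apply Rmult_le_compat_r; [apply Rlt_le, exp_pos|lra].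
      - apply Rmult_lt_reg_l with (/ (M / s + 1)); [apply Rinv_0_lt_compat; lra|].
        rewrite <- Rmult_assoc, Rinv_l, Rmult_1_l by lra.
        rewrite (Rmult_comm _ (pos eps)). exact HX. }
    exists (fun T => Rmax X 0 < T). split; [now exists (Rmax X 0)|].
    intros u v Hu Hv. change (Rabs (RInt w 0 v - RInt w 0 u) < eps).
    destruct (Rle_dec u v) as [Huv|Huv].
    - rewrite RInt_diff by apply Hw. auto.
    - rewrite Rabs_minus_sym, RInt_diff by apply Hw. apply Hsmall; auto; lra. }
  destruct He as [y Hy].
  assert (Hy' : is_lim (fun T => RInt w 0 T) p_infty y) by exact Hy.
  unfold Int0oo. rewrite (is_lim_unique _ _ _ Hy'). exact Hy'.
Qed.

Lemma Int0oo_eq w (l : R) : is_lim (fun T => RInt w 0 T) p_infty l -> Int0oo w = l.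
Proof. intros H. unfold Int0oo. now rewrite (is_lim_unique _ _ _ H). Qed.

Lemma Int0oo_tail M s w T : 0 < s -> exp_decay M s w -> 0 <= T ->
  Rabs (Int0oo w - RInt w 0 T) <= M / s * exp (- s * T).
Proof.
  intros Hs Hw HT.
  assert (Hl := Int0oo_lim M s w Hs Hw).
  assert (Hl' : is_lim (fun S => Rabs (RInt w 0 S - RInt w 0 T)) p_infty (Rabs (Int0oo w - RInt w 0 T))).
  { eapply filterlim_comp; [|apply continuous_Rabs]. apply (is_lim_minus' _ _ _ (Int0oo w) (RInt w 0 T)); auto.
    apply is_lim_const. }
  refine (is_lim_le_loc (fun S => Rabs (RInt w 0 S - RInt w 0 T)) (fun _ => M / s * exp (- s * T))
    p_infty (Finite _) (Finite _) _ _ _).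
  - exists T. intros S HS. rewrite RInt_diff by apply Hw.
    apply (RInt_exp_decay_tail M s); auto; lra.
  - exact Hl'.
  - apply is_lim_const.
Qed.

Lemma Int0oo_bound M s w : 0 < s -> exp_decay M s w -> Rabs (Int0oo w) <= M / s.
Proof.
  intros Hs Hw. assert (H := Int0oo_tail M s w 0 Hs Hw (Rle_refl 0)).
  rewrite RInt_point, Rmult_0_r, exp_0, Rmult_1_r in H.
  unfold zero in H; cbn in H. now rewrite Rminus_0_r in H.
Qed.

Lemma Int0oo_ext u v : (forall x, 0 < x -> u x = v x) -> Int0oo u = Int0oo v.
Proof.
  intros H. unfold Int0oo. f_equal. apply Lim_ext_loc. exists 0. intros T HT.
  apply RInt_ext. intros x Hx. rewrite ?(Rmin_left 0 T), ?(Rmax_right 0 T), ?(Rmin_right T 0), ?(Rmax_left T 0) in Hx by lra.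
  first [apply H; lra | symmetry; apply H; lra].
Qed.

Lemma exp_decay_plus M N s u v : exp_decay M s u -> exp_decay N s v -> exp_decay (M + N) s (fun x => u x + v x).
Proof.
  intros [H1 H2] [H3 H4]; split; [now apply cont_plus|].
  intros x Hx. eapply Rle_trans; [apply Rabs_triang|]. rewrite Rmult_plus_distr_r.
  apply Rplus_le_compat; auto.
Qed.

Lemma exp_decay_scal c M s u : exp_decay M s u -> exp_decay (Rabs c * M) s (fun x => c * u x).
Proof.
  intros [H1 H2]; split; [now apply cont_scal|].
  intros x Hx. rewrite Rabs_mult, Rmult_assoc. apply Rmult_le_compat_l; auto using Rabs_pos.
Qed.

Lemma Int0oo_plus M N s u v : 0 < s -> exp_decay M s u -> exp_decay N s v ->
  Int0oo (fun x => u x + v x) = Int0oo u + Int0oo v.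
Proof.
  intros Hs Hu Hv. apply Int0oo_eq.
  apply is_lim_ext with (fun T => RInt u 0 T + RInt v 0 T).
  { intros T. symmetry. apply (RInt_plus u v); apply cont_ex_RInt; [apply Hu|apply Hv]. }
  apply is_lim_plus'; [now apply (Int0oo_lim M s)|now apply (Int0oo_lim N s)].
Qed.

Lemma Int0oo_scal c M s u : 0 < s -> exp_decay M s u -> Int0oo (fun x => c * u x) = c * Int0oo u.
Proof.
  intros Hs Hu. apply Int0oo_eq.
  apply is_lim_ext with (fun T => c * RInt u 0 T).
  { intros T. symmetry. apply (RInt_scal u). apply cont_ex_RInt, Hu. }
  apply (is_lim_scal_l _ c p_infty (Finite (Int0oo u))). now apply (Int0oo_lim M s).
Qed.

Lemma Int0oo_FTC W w : (forall x, is_derive W x (w x)) -> cont w ->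
  is_lim W p_infty 0 -> Int0oo w = - W 0.
Proof.
  intros HW Hw Hl. apply Int0oo_eq.
  apply is_lim_ext with (fun T => W T - W 0).
  { intros T. symmetry. apply is_RInt_unique.
    apply (is_RInt_derive (V := R_CompleteNormedModule) W w); intros; auto. }
  replace (- W 0) with (0 - W 0) by ring.
  apply is_lim_minus'; auto. apply is_lim_const.
Qed.

(** Real and imaginary parts are integrated separately; the resulting factor 2 in
    the bound of [CInt0oo_bound] is harmless. *)
Definition CInt0oo (w : R -> C) : C := (Int0oo (fun x => Re (w x)), Int0oo (fun x => Im (w x))).

Definition Ccont (w : R -> C) : Prop := cont (fun x => Re (w x)) /\ cont (fun x => Im (w x)).

Definition Cexp_decay (M s : R) (w : R -> C) : Prop :=
  Ccont w /\ forall x, 0 <= x -> Cmod (w x) <= M * exp (- s * x).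

Lemma Cexp_decay_Re M s w : Cexp_decay M s w -> exp_decay M s (fun x => Re (w x)).
Proof.
  intros [[H1 H2] H]; split; auto. intros x Hx.
  eapply Rle_trans; [apply re_le_Cmod|auto].
Qed.

Lemma Cexp_decay_Im M s w : Cexp_decay M s w -> exp_decay M s (fun x => Im (w x)).
Proof.
  intros [[H1 H2] H]; split; auto. intros x Hx.
  eapply Rle_trans; [apply Im_le_Cmod|auto].
Qed.

Lemma Cexp_decay_nonneg M s w : Cexp_decay M s w -> 0 <= M.
Proof. intros H. exact (exp_decay_nonneg _ _ _ (Cexp_decay_Re _ _ _ H)). Qed.

Lemma Ccont_plus u v : Ccont u -> Ccont v -> Ccont (fun x => u x + v x)%C.
Proof.
  intros [H1 H2] [H3 H4]. split.
  - exact (cont_plus _ _ H1 H3).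
  - exact (cont_plus _ _ H2 H4).
Qed.

Lemma Ccont_mult u v : Ccont u -> Ccont v -> Ccont (fun x => u x * v x)%C.
Proof.
  intros [H1 H2] [H3 H4]. split.
  - exact (cont_minus _ _ (cont_mult _ _ H1 H3) (cont_mult _ _ H2 H4)).
  - exact (cont_plus _ _ (cont_mult _ _ H1 H4) (cont_mult _ _ H2 H3)).
Qed.

Lemma Ccont_const c : Ccont (fun _ => c).
Proof. split; [exact (cont_const (Re c))|exact (cont_const (Im c))]. Qed.

Lemma Ccont_RtoC u : cont u -> Ccont (fun x => RtoC (u x)).
Proof. intros H; split; [exact H|exact (cont_const 0)]. Qed.

Lemma Ccont_ext u v : (forall x, u x = v x) -> Ccont u -> Ccont v.
Proof.
  intros H [H1 H2]; split.
  - apply (cont_ext (fun x => Re (u x))); auto. intros x; now rewrite H.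
  - apply (cont_ext (fun x => Im (u x))); auto. intros x; now rewrite H.
Qed.

Lemma Ccont_opp u : Ccont u -> Ccont (fun x => - u x)%C.
Proof.
  intros H. apply Ccont_ext with (fun x => (RtoC (-1) * u x)%C).
  - intros x. rewrite RtoC_m1. ring.
  - apply Ccont_mult; auto. apply Ccont_const.
Qed.

Lemma Ccont_sum (u : nat -> R -> C) N : (forall k, Ccont (u k)) -> Ccont (fun x => sum_n (fun k => u k x) N).
Proof.
  intros H. induction N as [|N IH].
  - eapply Ccont_ext; [|apply (H 0%nat)]. intros x; now rewrite sum_O.
  - eapply Ccont_ext; [|apply Ccont_plus; [exact IH|apply (H (S N))]]. intros x; now rewrite sum_Sn.
Qed.

Lemma Cexp_decay_plus M N s u v : Cexp_decay M s u -> Cexp_decay N s v -> Cexp_decay (M + N) s (fun x => u x + v x)%C.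
Proof.
  intros [H1 H2] [H3 H4]; split; [now apply Ccont_plus|].
  intros x Hx. eapply Rle_trans; [apply Cmod_triangle|]. rewrite Rmult_plus_distr_r.
  apply Rplus_le_compat; auto.
Qed.

Lemma Cexp_decay_scal c M s u : Cexp_decay M s u -> Cexp_decay (Cmod c * M) s (fun x => c * u x)%C.
Proof.
  intros [H1 H2]; split; [apply Ccont_mult; auto using Ccont_const|].
  intros x Hx. rewrite Cmod_mult, Rmult_assoc. apply Rmult_le_compat_l; auto using Cmod_ge_0.
Qed.

Lemma CInt0oo_ext u v : (forall x, 0 < x -> u x = v x) -> CInt0oo u = CInt0oo v.
Proof. intros H. unfold CInt0oo. f_equal; apply Int0oo_ext; intros x Hx; now rewrite H. Qed.

Lemma CInt0oo_plus M N s u v : 0 < s -> Cexp_decay M s u -> Cexp_decay N s v ->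
  CInt0oo (fun x => u x + v x)%C = (CInt0oo u + CInt0oo v)%C.
Proof.
  intros Hs Hu Hv. unfold CInt0oo. apply injective_projections; cbn [fst snd].
  - exact (Int0oo_plus M N s _ _ Hs (Cexp_decay_Re _ _ _ Hu) (Cexp_decay_Re _ _ _ Hv)).
  - exact (Int0oo_plus M N s _ _ Hs (Cexp_decay_Im _ _ _ Hu) (Cexp_decay_Im _ _ _ Hv)).
Qed.

Lemma CInt0oo_scal c M s u : 0 < s -> Cexp_decay M s u -> CInt0oo (fun x => c * u x)%C = (c * CInt0oo u)%C.
Proof.
  intros Hs Hu. destruct c as [a b]. unfold CInt0oo, Cmult; cbn.
  assert (H1 := Cexp_decay_Re _ _ _ Hu). assert (H2 := Cexp_decay_Im _ _ _ Hu).
  rewrite <- (Int0oo_scal a M s _ Hs H1), <- (Int0oo_scal b M s _ Hs H1).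
  rewrite <- (Int0oo_scal a M s _ Hs H2), <- (Int0oo_scal b M s _ Hs H2).
  f_equal.
  - transitivity (Int0oo (fun x => a * Re (u x) + (-1) * (b * Im (u x)))).
    { apply Int0oo_ext; intros x _. unfold Re, Im. ring. }
    rewrite (Int0oo_plus (Rabs a * M) (Rabs (-1) * (Rabs b * M)) s); auto.
    + rewrite (Int0oo_scal (-1) (Rabs b * M) s); auto; [ring|now apply exp_decay_scal].
    + now apply exp_decay_scal.
    + now apply exp_decay_scal, exp_decay_scal.
  - apply (Int0oo_plus (Rabs a * M) (Rabs b * M) s); auto; now apply exp_decay_scal.
Qed.

Lemma CInt0oo_bound M s w : 0 < s -> Cexp_decay M s w -> Cmod (CInt0oo w) <= 2 * M / s.
Proof.
  intros Hs Hw. eapply Rle_trans; [apply Cmod_le_Re_Im|]. cbn.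
  assert (H1 := Int0oo_bound M s _ Hs (Cexp_decay_Re _ _ _ Hw)).
  assert (H2 := Int0oo_bound M s _ Hs (Cexp_decay_Im _ _ _ Hw)).
  unfold Rdiv in *. lra.
Qed.

Lemma CInt0oo_RtoC u : CInt0oo (fun x => RtoC (u x)) = RtoC (Int0oo u).
Proof.
  unfold CInt0oo, RtoC; cbn. f_equal. apply Int0oo_eq.
  apply is_lim_ext with (fun _ => 0); [|apply is_lim_const].
  intros T. rewrite RInt_const. unfold scal; cbn. unfold mult; cbn. ring.
Qed.

Lemma CInt0oo_sum (u : nat -> R -> C) (M : nat -> R) s N : 0 < s -> (forall k, Cexp_decay (M k) s (u k)) ->
  CInt0oo (fun x => sum_n (fun k => u k x) N) = sum_n (fun k => CInt0oo (u k)) N /\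
  Cexp_decay (sum_n M N) s (fun x => sum_n (fun k => u k x) N).
Proof.
  intros Hs H. induction N as [|N [IH1 IH2]].
  - rewrite !sum_O. split.
    + apply CInt0oo_ext; intros x _; now rewrite sum_O.
    + destruct (H 0%nat) as [H1 H2]. split.
      * eapply Ccont_ext; [|exact H1]. intros x; now rewrite sum_O.
      * intros x Hx. rewrite sum_O. auto.
  - rewrite !sum_Sn. assert (Hc := Cexp_decay_plus _ _ _ _ _ IH2 (H (S N))). split.
    + rewrite <- IH1. transitivity (CInt0oo (fun x => sum_n (fun k => u k x) N + u (S N) x)%C).
      * apply CInt0oo_ext; intros x _; now rewrite sum_Sn.
      * apply (CInt0oo_plus (sum_n M N) (M (S N)) s); auto.
    + destruct Hc as [H1 H2]. split.
      * eapply Ccont_ext; [|exact H1]. intros x; now rewrite sum_Sn.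
      * intros x Hx. rewrite sum_Sn. apply H2; auto.
Qed.

(** * Laplace transforms and their Taylor coefficients *)

Lemma pow_fact_exp t k x : 0 < t -> 0 <= x -> x ^ k / INR (fact k) <= (/ t) ^ k * exp (t * x).
Proof.
  intros Ht Hx.
  assert (H := exp_term_le (t * x) k ltac:(apply Rmult_le_pos; lra)).
  rewrite Rpow_mult_distr in H.
  assert (Hp : 0 < t ^ k) by now apply pow_lt.
  rewrite pow_inv.
  apply Rmult_le_reg_l with (t ^ k); auto.
  replace (t ^ k * (/ t ^ k * exp (t * x))) with (exp (t * x)) by (field; lra).
  unfold Rdiv in *. lra.
Qed.

(** A series with coefficients O(t ^ k / k!) is majorized, past the index N and for
    t < t', by (t / t') ^ N times that of exp (t' x): the remainder is small
    relative to an exponential of slightly larger type. *)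
Lemma is_Cseries_exp_tail (d : nat -> C) A t t' x F N :
  geom_bound A t d -> 0 <= t <= t' -> 0 < t' -> 0 <= x ->
  is_Cseries (fun k => d k * RtoC (x ^ k / INR (fact k)))%C F ->
  Cmod (F - sum_n (fun k => d k * RtoC (x ^ k / INR (fact k)))%C N) <= A * (t / t') ^ N * exp (t' * x).
Proof.
  intros Hd Ht Ht' Hx HF.
  assert (HA := geom_bound_nonneg _ _ _ Hd).
  set (u := fun k => (d k * RtoC (x ^ k / INR (fact k)))%C) in *.
  assert (Hpos : forall y k, 0 <= y -> 0 <= y ^ k / INR (fact k)).
  { intros y k Hy. apply Rdiv_le_0_compat; [now apply pow_le|apply INR_fact_lt_0]. }
  assert (Htt : 0 <= t / t' <= 1).
  { split; [apply Rdiv_le_0_compat|apply Rdiv_le_1]; lra. }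
  assert (Hterm : forall k, (N <= k)%nat ->
    Cmod (u k) <= A * (t / t') ^ N * ((t' * x) ^ k / INR (fact k))).
  { intros k Hk. unfold u. rewrite Cmod_mult, Cmod_R, Rabs_pos_eq by now apply Hpos.
    apply Rle_trans with (A * t ^ k * (x ^ k / INR (fact k))).
    { apply Rmult_le_compat_r; [now apply Hpos|apply Hd]. }
    rewrite <- (pow_div_le t t' k) by lra.
    replace (A * ((t / t') ^ k * t' ^ k) * (x ^ k / INR (fact k)))
      with (A * (t / t') ^ k * ((t' * x) ^ k / INR (fact k)))
      by (rewrite Rpow_mult_distr; unfold Rdiv; ring).
    apply Rmult_le_compat_r; [apply Hpos; apply Rmult_le_pos; lra|].
    apply Rmult_le_compat_l; auto.
    replace k with (N + (k - N))%nat by lia. rewrite pow_add.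
    rewrite <- (Rmult_1_r ((t / t') ^ N)) at 2.
    apply Rmult_le_compat_l; [apply pow_le; lra|].
    apply Rle_trans with (1 ^ (k - N)); [apply pow_incr; lra|rewrite pow1; lra]. }
  apply le_of_forall_eps. intros eps He.
  destruct (proj1 (is_Cseries_eps _ _) HF eps He) as [M0 HM0].
  set (M := (M0 + S N)%nat). specialize (HM0 M ltac:(unfold M; lia)).
  replace (F - sum_n u N)%C with ((sum_n u M - sum_n u N) - (sum_n u M - F))%C by ring.
  eapply Rle_trans; [apply Cmod_triangle|]. rewrite Cmod_opp.
  apply Rplus_le_compat; [|lra].
  assert (E : (sum_n u M - sum_n u N)%C = sum_n_m u (S N) M).
  { unfold sum_n. rewrite (sum_n_m_Chasles u 0 N M) by (unfold M; lia).
    unfold plus; cbn. ring. }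
  rewrite E.
  refine (Rle_trans _ _ _ (norm_sum_n_m (V := C_NormedModule) u (S N) M) _).
  apply Rle_trans with (sum_n_m (fun k => A * (t / t') ^ N * ((t' * x) ^ k / INR (fact k))) (S N) M).
  { (* the bound on the terms holds from the index N on only *)
    rewrite <- (sum_n_m_ext_loc (fun k => if le_dec N k then norm (V := C_NormedModule) (u k) else 0)).
    2:{ intros k Hk. destruct le_dec; [reflexivity|lia]. }
    apply sum_n_m_le. intros k. destruct le_dec as [Hk|Hk].
    - now apply Hterm.
    - apply Rmult_le_pos; [apply Rmult_le_pos; auto; apply pow_le; lra|].
      apply Hpos, Rmult_le_pos; lra. }
  rewrite (sum_n_m_mult_l (K := R_Ring)). unfold mult; cbn -[sum_n_m pow fact].
  apply Rmult_le_compat_l; [apply Rmult_le_pos; auto; apply pow_le; lra|].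
  rewrite <- (is_series_unique _ _ (exp_series (t' * x))).
  apply Rle_trans with (sum_n (fun k => (t' * x) ^ k / INR (fact k)) M).
  - assert (H0 : 0 <= sum_n_m (fun k => (t' * x) ^ k / INR (fact k)) 0 N).
    { eapply Rle_trans; [|apply sum_n_m_le; intros i; apply Hpos, Rmult_le_pos; lra].
      rewrite sum_n_m_const; lra. }
    unfold sum_n. rewrite (sum_n_m_Chasles _ 0 N M) by (unfold M; lia).
    refine (Rle_trans _ (0 + _) _ _ (Rplus_le_compat_r _ _ _ H0)). rewrite Rplus_0_l. apply Rle_refl.
  - apply sum_n_le_Series; [|eexists; apply exp_series].
    intros k; apply Hpos, Rmult_le_pos; lra.
Qed.

Lemma cont_monomial j : cont (fun x => x ^ j / INR (fact j)).
Proof.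
  apply cont_ext with (fun x => / INR (fact j) * x ^ j); [intros; unfold Rdiv; ring|].
  apply cont_scal, cont_pow.
Qed.

Lemma Cexp_decay_mult (v w : R -> C) A t M s : Ccont v -> Cexp_decay M s w -> 0 <= A ->
  (forall x, 0 <= x -> Cmod (v x) <= A * exp (t * x)) ->
  Cexp_decay (A * M) (s - t) (fun x => v x * w x)%C.
Proof.
  intros Hv [Hw1 Hw2] HA Hb. split; [now apply Ccont_mult|].
  intros x Hx. rewrite Cmod_mult.
  replace (A * M * exp (- (s - t) * x)) with ((A * exp (t * x)) * (M * exp (- s * x))).
  - apply Rmult_le_compat; auto using Cmod_ge_0.
  - replace (- (s - t) * x) with (t * x + - s * x) by ring. rewrite exp_plus. ring.
Qed.

Lemma pow_lim0 (q : R) : 0 <= q < 1 -> is_lim_seq (fun n => q ^ n) 0.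
Proof. intros Hq. apply is_lim_seq_geom. rewrite Rabs_pos_eq; lra. Qed.

(** Termwise integration of an entire function of exponential type t against a
    weight that decays faster than exp (- t x). *)
Lemma CInt0oo_series (w : R -> C) (d : nat -> C) (F : R -> C) M s A t :
  Cexp_decay M s w -> geom_bound A t d -> 0 <= t < s -> Ccont F ->
  (forall x, 0 <= x -> is_Cseries (fun k => d k * RtoC (x ^ k / INR (fact k)))%C (F x)) ->
  is_Cseries (fun k => d k * CInt0oo (fun x => RtoC (x ^ k / INR (fact k)) * w x))%C (CInt0oo (fun x => F x * w x)%C).
Proof.
  intros Hw Hd Hts HF Hser.
  assert (HA := geom_bound_nonneg _ _ _ Hd). assert (HM := Cexp_decay_nonneg _ _ _ Hw).
  set (t' := (t + s) / 2). assert (Ht' : t < t' < s) by (unfold t'; lra).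
  set (u := fun k x => (d k * (RtoC (x ^ k / INR (fact k)) * w x))%C).
  assert (Hv : forall k, Cexp_decay ((/ t') ^ k * M) (s - t') (fun x => RtoC (x ^ k / INR (fact k)) * w x)%C).
  { intros k. apply Cexp_decay_mult; auto.
    - apply Ccont_RtoC, cont_monomial.
    - apply pow_le, Rlt_le, Rinv_0_lt_compat; lra.
    - intros x Hx. rewrite Cmod_R, Rabs_pos_eq.
      + apply pow_fact_exp; lra.
      + apply Rdiv_le_0_compat; [now apply pow_le|apply INR_fact_lt_0]. }
  assert (Hu : forall k, Cexp_decay (Cmod (d k) * ((/ t') ^ k * M)) (s - t') (u k)).
  { intros k. apply Cexp_decay_scal, Hv. }
  assert (HtN : 0 <= t / t' < 1).
  { split; [apply Rdiv_le_0_compat|apply Rdiv_lt_1]; lra. }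
  assert (Hd' : forall N, Cexp_decay (A * (t / t') ^ N * M) (s - t')
     (fun x => (F x - sum_n (fun k => d k * RtoC (x ^ k / INR (fact k)))%C N) * w x)%C).
  { intros N. apply Cexp_decay_mult; auto.
    - apply Ccont_plus; auto. apply Ccont_opp.
      apply (Ccont_sum (fun k x => d k * RtoC (x ^ k / INR (fact k)))%C).
      intros k. apply Ccont_mult; [apply Ccont_const|]. apply Ccont_RtoC, cont_monomial.
    - apply Rmult_le_pos; auto. apply pow_le; lra.
    - intros x Hx. apply is_Cseries_exp_tail; auto; lra. }
  apply is_Cseries_eps. intros eps He.
  assert (Hlim : is_lim_seq (fun N => 2 * (A * (t / t') ^ N * M) / (s - t')) 0).
  { apply is_lim_seq_ext with (fun N => (2 * A * M / (s - t')) * (t / t') ^ N).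
    { intros; field; lra. }
    replace (Finite 0) with (Rbar_mult (2 * A * M / (s - t')) 0) by (cbn; f_equal; ring).
    apply is_lim_seq_scal_l. now apply pow_lim0. }
  apply is_lim_seq_spec in Hlim. destruct (Hlim (mkposreal eps He)) as [N0 HN0].
  exists N0. intros n Hn. specialize (HN0 n Hn). cbn [pos] in HN0.
  rewrite Rminus_0_r in HN0. eapply Rle_lt_trans; [|eapply Rle_lt_trans; [apply Rle_abs|exact HN0]].
  destruct (CInt0oo_sum u _ (s - t') n ltac:(lra) Hu) as [E1 E2].
  assert (Ec : CInt0oo (fun x => F x * w x)%C = (CInt0oo (fun x => (F x - sum_n (fun k => d k * RtoC (x ^ k / INR (fact k)))%C n) * w x)%C
     + CInt0oo (fun x => sum_n (fun k => u k x) n))%C).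
  { rewrite <- (CInt0oo_plus _ _ (s - t') _ _ ltac:(lra) (Hd' n) E2).
    apply CInt0oo_ext. intros x _.
    replace (sum_n (fun k => u k x) n) with (sum_n (fun k => d k * RtoC (x ^ k / INR (fact k))) n * w x)%C.
    - ring.
    - rewrite Cmult_comm, <- sum_n_Cmult. apply sum_n_ext. intros k. unfold u. Cring. }
  rewrite Ec, E1.
  rewrite (sum_n_ext (fun k => d k * CInt0oo (fun x => RtoC (x ^ k / INR (fact k)) * w x))%C (fun k => CInt0oo (u k))).
  - match goal with |- Cmod (?a - (?b + ?a))%C <= _ => replace (a - (b + a))%C with (- b)%C by ring end.
    rewrite Cmod_opp. apply CInt0oo_bound; [lra|apply Hd'].
  - intros k. symmetry. exact (CInt0oo_scal (d k) _ (s - t') _ ltac:(lra) (Hv k)).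
Qed.

Definition lin_growth (M : R) (g : R -> R) : Prop :=
  cont g /\ forall x, 0 <= x -> Rabs (g x) <= M * (1 + x).

Definition Claplace_fun (g : R -> R) (p : C) (j : nat) (x : R) : C :=
  (RtoC (x ^ j / INR (fact j) * g x) * cexp (- (p * RtoC x)))%C.

(** Up to the sign (-1) ^ j, the coefficient of order j in the Taylor expansion about
    p of the Laplace transform of g. With this sign, moving the centre from p
    to p - z is the binomial shift of weights z ^ k. *)
Definition Claplace (g : R -> R) (p : C) (j : nat) : C := CInt0oo (Claplace_fun g p j).

Lemma cont_cos u : cont u -> cont (fun x => cos (u x)).
Proof. intros H x. apply continuous_comp; [apply H|apply continuous_cos]. Qed.
Lemma cont_sin u : cont u -> cont (fun x => sin (u x)).
Proof. intros H x. apply continuous_comp; [apply H|apply continuous_sin]. Qed.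
Lemma cont_exp_comp u : cont u -> cont (fun x => exp (u x)).
Proof. intros H x. apply continuous_comp; [apply H|apply continuous_exp]. Qed.

Lemma Ccont_cexp u : Ccont u -> Ccont (fun x => cexp (u x)).
Proof.
  intros [H1 H2]. split; cbn.
  - apply cont_mult; [apply (cont_exp_comp _ H1)|apply (cont_cos _ H2)].
  - apply cont_mult; [apply (cont_exp_comp _ H1)|apply (cont_sin _ H2)].
Qed.

Lemma Ccont_lin z : Ccont (fun x => z * RtoC x)%C.
Proof. apply Ccont_mult; [apply Ccont_const|apply Ccont_RtoC, cont_id]. Qed.

Lemma Claplace_fun_Ccont g p j : cont g -> Ccont (Claplace_fun g p j).
Proof.
  intros Hg. apply Ccont_mult.
  - apply Ccont_RtoC, cont_mult; auto. apply cont_monomial.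
  - apply Ccont_cexp, Ccont_opp, Ccont_lin.
Qed.

Lemma Claplace_fun_decay M g p j s : lin_growth M g -> s < Re p -> exists M', Cexp_decay M' s (Claplace_fun g p j).
Proof.
  intros [Hg Hb] Hs.
  assert (HM : 0 <= M).
  { specialize (Hb 0 (Rle_refl 0)). rewrite Rplus_0_r, Rmult_1_r in Hb.
    eapply Rle_trans; [apply Rabs_pos|exact Hb]. }
  set (e := (Re p - s) / 2). assert (He : 0 < e) by (unfold e; lra).
  exists ((/ e) ^ j * (M * (1 + / e))).
  split; [now apply Claplace_fun_Ccont|].
  intros x Hx. unfold Claplace_fun. rewrite Cmod_mult, Cmod_R, Cmod_cexp, Rabs_mult.
  assert (Hmon : 0 <= x ^ j / INR (fact j)).
  { apply Rdiv_le_0_compat; [now apply pow_le|apply INR_fact_lt_0]. }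
  rewrite (Rabs_pos_eq (x ^ j / _)) by auto.
  replace (Re (- (p * RtoC x))%C) with (- (Re p * x)) by (unfold Re, Cmult, Copp, RtoC; cbn; ring).
  assert (Hx1 : 1 + x <= (1 + / e) * exp (e * x)).
  { assert (H1 := exp_ineq1_le (e * x)).
    assert (H2 : 0 <= e * x) by (apply Rmult_le_pos; lra).
    assert (H3 : / e * (e * x) <= / e * exp (e * x)).
    { apply Rmult_le_compat_l; [apply Rlt_le, Rinv_0_lt_compat; auto|lra]. }
    rewrite <- Rmult_assoc, Rinv_l, Rmult_1_l in H3 by lra. lra. }
  assert (H1 := pow_fact_exp e j x He Hx).
  apply Rle_trans with (((/ e) ^ j * exp (e * x)) * (M * ((1 + / e) * exp (e * x))) * exp (- (Re p * x))).
  - apply Rmult_le_compat_r; [apply Rlt_le, exp_pos|].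
    apply Rmult_le_compat; auto using Rabs_pos.
    eapply Rle_trans; [apply Hb; auto|]. apply Rmult_le_compat_l; auto.
  - right. replace (- s * x) with (e * x + e * x + - (Re p * x)) by (unfold e; field).
    rewrite !exp_plus. ring.
Qed.

(** The expansion exp (z x) = sum (z x) ^ k / k! may be integrated termwise as long
    as |z| < Re p. *)
Lemma Claplace_shift M g p z : lin_growth M g -> Cmod z < Re p ->
  is_binom_shift (fun k => z ^ k)%C (Claplace g p) (Claplace g (p - z)%C).
Proof.
  intros Hg Hz j.
  set (s := (Cmod z + Re p) / 2). assert (Hs : Cmod z < s < Re p) by (unfold s; lra).
  destruct (Claplace_fun_decay M g p j s Hg ltac:(lra)) as [M' HM'].
  assert (Hz0 := Cmod_ge_0 z).
  assert (H := CInt0oo_series (Claplace_fun g p j) (fun k => z ^ k)%C (fun x => cexp (z * RtoC x))%C M' s 1 (Cmod z)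
    HM' (geom_bound_pow z) (conj Hz0 (proj1 Hs)) (Ccont_cexp _ (Ccont_lin z))).
  assert (Hser : forall x, 0 <= x -> is_Cseries (fun k => z ^ k * RtoC (x ^ k / INR (fact k)))%C (cexp (z * RtoC x))%C).
  { intros x _. eapply is_Cseries_ext; [|apply cexp_series]. intros k. cbv beta.
    rewrite Cpow_mult_l, RtoC_div, RtoC_pow by apply INR_fact_neq_0. unfold Cdiv. ring. }
  specialize (H Hser).
  replace (Claplace g (p - z)%C j) with (CInt0oo (fun x => cexp (z * RtoC x) * Claplace_fun g p j x)%C).
  - eapply is_Cseries_ext; [|exact H]. intros k. cbv beta.
    rewrite <- Cmult_assoc. f_equal.
    destruct (Claplace_fun_decay M g p (k + j) s Hg ltac:(lra)) as [M'' HM''].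
    unfold Claplace. rewrite <- (CInt0oo_scal (RtoC (binom k j)) M'' s _ ltac:(lra) HM'').
    apply CInt0oo_ext. intros x _. unfold Claplace_fun. rewrite !Cmult_assoc, <- !RtoC_mult. f_equal. f_equal.
    unfold binom. rewrite pow_add. field. repeat split; apply INR_fact_neq_0.
  - unfold Claplace. apply CInt0oo_ext. intros x _. unfold Claplace_fun.
    replace (- ((p - z) * RtoC x))%C with (z * RtoC x + - (p * RtoC x))%C by ring.
    rewrite cexp_plus. ring.
Qed.

(** * A maximum principle for uniform limits of polynomials *)

(** Polynomial functions. The closure rules follow Horner's scheme, which gives
    products and averages over roots of unity by induction. *)
Inductive poly_fun : (C -> C) -> Prop :=
| poly_const c : poly_fun (fun _ => c)
| poly_plus P Q : poly_fun P -> poly_fun Q -> poly_fun (fun z => P z + Q z)%C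
| poly_shift P : poly_fun P -> poly_fun (fun z => z * P z)%C.

Lemma poly_mult P Q : poly_fun P -> poly_fun Q -> exists S, poly_fun S /\ forall z, S z = (P z * Q z)%C.
Proof.
  intros HP HQ. induction HP as [c|P1 P2 H1 [S1 [I1 J1]] H2 [S2 [I2 J2]]|P H [S [I J]]].
  - induction HQ as [d|Q1 Q2 H1 [S1 [I1 J1]] H2 [S2 [I2 J2]]|Q H [S [I J]]].
    + exists (fun _ => (c * d)%C). split; auto. apply poly_const.
    + exists (fun z => (S1 z + S2 z)%C). split; [now apply poly_plus|].
      intros z. rewrite J1, J2. ring.
    + exists (fun z => (z * S z)%C). split; [now apply poly_shift|].
      intros z. rewrite J. ring.
  - exists (fun z => (S1 z + S2 z)%C). split; [now apply poly_plus|].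
    intros z. rewrite J1, J2. ring.
  - exists (fun z => (z * S z)%C). split; [now apply poly_shift|].
    intros z. rewrite J. ring.
Qed.

Lemma poly_bounded P r : poly_fun P -> exists B, 0 <= B /\ forall z, Cmod z <= r -> Cmod (P z) <= B.
Proof.
  intros HP. induction HP as [c|P1 P2 H1 [B1 [I1 J1]] H2 [B2 [I2 J2]]|P H [B [I J]]].
  - exists (Cmod c). split; [apply Cmod_ge_0|intros; lra].
  - exists (B1 + B2). split; [lra|]. intros z Hz.
    eapply Rle_trans; [apply Cmod_triangle|]. apply Rplus_le_compat; auto.
  - exists (Rabs r * B). split; [apply Rmult_le_pos; auto using Rabs_pos|].
    intros z Hz. rewrite Cmod_mult. apply Rmult_le_compat; auto using Cmod_ge_0.
    eapply Rle_trans; [exact Hz|apply Rle_abs].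
Qed.

Definition unity (N : nat) : C := cexp (Ci * RtoC (2 * PI / INR N)).

Lemma cexp_pow z k : (cexp z ^ k)%C = cexp (RtoC (INR k) * z).
Proof.
  induction k as [|k IH].
  - cbn. replace (RtoC 0 * z)%C with (RtoC 0) by ring. rewrite cexp_RtoC, exp_0. reflexivity.
  - cbn [Cpow]. rewrite IH, S_INR, <- cexp_plus. f_equal. rewrite RtoC_plus. ring.
Qed.

Lemma Cmod_unity N : Cmod (unity N) = 1.
Proof.
  unfold unity. rewrite Cmod_cexp. rewrite <- exp_0. f_equal.
  unfold Re, Ci, RtoC, Cmult; cbn. ring.
Qed.

Lemma unity_pow N k : (unity N ^ k)%C = cexp (Ci * RtoC (2 * PI * (INR k / INR N)))%C.
Proof.
  unfold unity. rewrite cexp_pow. f_equal.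
  replace (2 * PI * (INR k / INR N)) with (INR k * (2 * PI / INR N)) by (unfold Rdiv; ring).
  rewrite RtoC_mult. ring.
Qed.

Lemma unity_N N : (0 < N)%nat -> (unity N ^ N)%C = RtoC 1.
Proof.
  intros HN. rewrite unity_pow, cexp_imag.
  replace (INR N / INR N) with 1 by (field; apply not_0_INR; lia).
  rewrite Rmult_1_r, cos_2PI, sin_2PI. reflexivity.
Qed.

Lemma unity_neq N k : (0 < k < N)%nat -> (unity N ^ k)%C <> RtoC 1.
Proof.
  intros Hk H. rewrite unity_pow, cexp_imag in H.
  apply (f_equal fst) in H. cbn in H.
  assert (HN : 0 < INR N) by (apply lt_0_INR; lia).
  assert (Hk1 : 0 < INR k / INR N < 1).
  { split; [apply Rdiv_lt_0_compat; auto; apply lt_0_INR; lia|].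
    apply Rdiv_lt_1; auto. apply lt_INR; lia. }
  assert (HP := PI_RGT_0).
  rewrite Rmult_assoc, cos_2a_sin in H.
  assert (Hs : 0 < sin (PI * (INR k / INR N))).
  { apply sin_gt_0; [apply Rmult_lt_0_compat; lra|].
    rewrite <- (Rmult_1_r PI) at 2. apply Rmult_lt_compat_l; lra. }
  assert (0 < sin (PI * (INR k / INR N)) * sin (PI * (INR k / INR N))) by (apply Rmult_lt_0_compat; auto).
  lra.
Qed.

Lemma geom_sum_C (z : C) n : ((1 - z) * sum_n (fun j => z ^ j) n = 1 - z ^ (S n))%C.
Proof.
  induction n as [|n IH].
  - rewrite sum_O. cbn. ring.
  - rewrite sum_Sn. unfold plus; cbn [AbelianMonoid.plus].
    transitivity ((1 - z) * sum_n (fun j => z ^ j) n + (1 - z) * z ^ S n)%C.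
    { cbn -[sum_n Cpow]. ring. }
    rewrite IH. cbn [Cpow]. ring.
Qed.

Lemma Csolve_zero (w s : C) : w <> RtoC 1 -> ((1 - w) * s = 0)%C -> s = RtoC 0.
Proof.
  intros Hw H. replace s with (((1 - w) * s) / (1 - w))%C.
  - rewrite H. unfold Cdiv. ring.
  - field. intros E. apply Hw. replace w with (1 - (1 - w))%C by ring. rewrite E. ring.
Qed.

Definition unity_sum (r : R) (n : nat) (A : C -> C) : C :=
  sum_n (fun j => A (RtoC r * unity (S n) ^ j)%C) n.

(** Averaging over the N-th roots of unity kills z ^ k for 0 < k < N and leaves the
    value at 0 when N exceeds the degree: a discrete mean value property. The
    factor z ^ m is there for the induction. *)
Lemma unity_sum_poly P r : poly_fun P -> exists d, forall m n, (m + d <= n)%nat ->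
  unity_sum r n (fun z => z ^ m * P z)%C = (if m then RtoC (INR (S n)) * P (RtoC 0) else RtoC 0)%C.
Proof.
  intros HP. induction HP as [c|P1 P2 H1 [d1 I1] H2 [d2 I2]|P H [d I]].
  - exists 0%nat. intros m n Hmn. unfold unity_sum.
    rewrite (sum_n_ext _ (fun j => (c * RtoC r ^ m) * ((unity (S n) ^ m) ^ j))%C).
    2:{ intros j. rewrite Cpow_mult_l, <- !Cpow_mult_r, (Nat.mul_comm m j). Cring. }
    rewrite sum_n_Cmult.
    destruct m as [|m].
    + rewrite (sum_n_ext _ (fun _ => RtoC 1)).
      2:{ intros j. cbn. now rewrite Cpow_1_l. }
      rewrite <- (RtoC_sum_n (fun _ => 1)), sum_n_const, Rmult_1_r. cbn -[INR]. ring.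
    + assert (G := geom_sum_C (unity (S n) ^ S m)%C n).
      rewrite <- Cpow_mult_r, Nat.mul_comm, Cpow_mult_r, unity_N, Cpow_1_l in G by lia.
      assert (Hne := unity_neq (S n) (S m) ltac:(lia)).
      assert (Hz : sum_n (Cpow (unity (S n) ^ S m)%C) n = RtoC 0).
      { apply (Csolve_zero (unity (S n) ^ S m)%C); auto. refine (eq_trans G _). ring. }
      rewrite Hz. ring.
  - exists (Nat.max d1 d2). intros m n Hmn. unfold unity_sum in *.
    rewrite (sum_n_ext _ (fun j => plus ((RtoC r * unity (S n) ^ j) ^ m * P1 (RtoC r * unity (S n) ^ j))%C
      ((RtoC r * unity (S n) ^ j) ^ m * P2 (RtoC r * unity (S n) ^ j))%C)).
    2:{ intros j. unfold plus; cbn -[Cpow]. Cring. }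
    rewrite sum_n_plus, I1, I2 by lia. destruct m; unfold plus; cbn -[INR]; ring.
  - exists (S d). intros m n Hmn. unfold unity_sum in *.
    rewrite (sum_n_ext _ (fun j => (RtoC r * unity (S n) ^ j) ^ (S m) * P (RtoC r * unity (S n) ^ j))%C).
    2:{ intros j. cbn [Cpow]. Cring. }
    rewrite (I (S m)) by lia. destruct m; ring.
Qed.

Lemma poly_max P r B : poly_fun P -> 0 <= r -> (forall z, Cmod z = r -> Cmod (P z) <= B) -> Cmod (P (RtoC 0)) <= B.
Proof.
  intros HP Hr HB. destruct (unity_sum_poly P r HP) as [d Hd].
  specialize (Hd 0%nat d ltac:(lia)). cbn iota in Hd.
  assert (Hn : 0 < INR (S d)) by (apply lt_0_INR; lia).
  apply Rmult_le_reg_l with (INR (S d)); auto.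
  rewrite <- (Rabs_pos_eq (INR (S d))) at 1 by lra.
  rewrite <- Cmod_R, <- Cmod_mult, <- Hd.
  eapply Rle_trans; [apply Cmod_sum_n|].
  apply Rle_trans with (sum_n (fun _ => B) d); [|rewrite sum_n_const; lra].
  apply sum_n_le_loc. intros k _. cbn [Cpow]. rewrite Cmult_1_l. apply HB.
  rewrite Cmod_mult, Cmod_pow, Cmod_unity, pow1, Cmod_R, Rabs_pos_eq; lra.
Qed.

(** Enough of complex analysis for a contour argument: this class of functions on a
    disc is an algebra, contains the sums of power series, and satisfies the
    maximum principle at the centre. *)
Definition poly_approx (r : R) (A : C -> C) : Prop :=
  forall eps, 0 < eps -> exists P, poly_fun P /\ forall z, Cmod z <= r -> Cmod (A z - P z) <= eps.

Lemma poly_approx_poly r P : poly_fun P -> poly_approx r P.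
Proof.
  intros HP eps He. exists P. split; auto. intros z _.
  replace (P z - P z)%C with (RtoC 0) by ring. rewrite Cmod_0. lra.
Qed.

Lemma poly_approx_ext r A B : (forall z, A z = B z) -> poly_approx r A -> poly_approx r B.
Proof.
  intros H HA eps He. destruct (HA eps He) as [P [HP1 HP2]]. exists P. split; auto.
  intros z Hz. rewrite <- H. auto.
Qed.

Lemma poly_approx_plus r A B : poly_approx r A -> poly_approx r B -> poly_approx r (fun z => A z + B z)%C.
Proof.
  intros HA HB eps He.
  destruct (HA (eps / 2) ltac:(lra)) as [P [HP1 HP2]].
  destruct (HB (eps / 2) ltac:(lra)) as [Q [HQ1 HQ2]].
  exists (fun z => (P z + Q z)%C). split; [now apply poly_plus|].
  intros z Hz. replace (A z + B z - (P z + Q z))%C with ((A z - P z) + (B z - Q z))%C by ring.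
  eapply Rle_trans; [apply Cmod_triangle|]. specialize (HP2 z Hz). specialize (HQ2 z Hz). lra.
Qed.

Lemma poly_approx_bounded r A : poly_approx r A -> exists B, 0 <= B /\ forall z, Cmod z <= r -> Cmod (A z) <= B.
Proof.
  intros HA. destruct (HA 1 ltac:(lra)) as [P [HP1 HP2]].
  destruct (poly_bounded P r HP1) as [B [HB1 HB2]].
  exists (B + 1). split; [lra|]. intros z Hz.
  replace (A z) with (P z + (A z - P z))%C by ring.
  eapply Rle_trans; [apply Cmod_triangle|]. specialize (HP2 z Hz). specialize (HB2 z Hz). lra.
Qed.

Lemma poly_approx_mult r A B : poly_approx r A -> poly_approx r B -> poly_approx r (fun z => A z * B z)%C.
Proof.
  intros HA HB eps He.
  destruct (poly_approx_bounded r A HA) as [a [Ha1 Ha2]].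
  destruct (HB (eps / 2 / (a + 1))) as [Q [HQ1 HQ2]].
  { apply Rdiv_lt_0_compat; lra. }
  destruct (poly_bounded Q r HQ1) as [b [Hb1 Hb2]].
  destruct (HA (eps / 2 / (b + 1))) as [P [HP1 HP2]].
  { apply Rdiv_lt_0_compat; lra. }
  destruct (poly_mult P Q HP1 HQ1) as [S [HS1 HS2]].
  exists S. split; auto. intros z Hz. rewrite HS2.
  replace (A z * B z - P z * Q z)%C with (A z * (B z - Q z) + (A z - P z) * Q z)%C by ring.
  eapply Rle_trans; [apply Cmod_triangle|]. rewrite !Cmod_mult.
  apply Rle_trans with (a * (eps / 2 / (a + 1)) + (eps / 2 / (b + 1)) * b).
  { apply Rplus_le_compat; apply Rmult_le_compat; auto using Cmod_ge_0. }
  assert (E : forall t, 0 <= t -> t * (eps / 2 / (t + 1)) <= eps / 2).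
  { intros t Ht. apply Rmult_le_reg_r with (t + 1); [lra|].
    replace (t * (eps / 2 / (t + 1)) * (t + 1)) with (t * (eps / 2)) by (field; lra).
    nra. }
  assert (E1 := E a Ha1). assert (E2 := E b Hb1). lra.
Qed.

Lemma poly_approx_max r A B : poly_approx r A -> 0 <= r ->
  (forall z, Cmod z = r -> Cmod (A z) <= B) -> Cmod (A (RtoC 0)) <= B.
Proof.
  intros HA Hr HB. apply le_of_forall_eps. intros eps He.
  destruct (HA (eps / 2) ltac:(lra)) as [P [HP1 HP2]].
  assert (H : Cmod (P (RtoC 0)) <= B + eps / 2).
  { apply (poly_max P r); auto. intros z Hz.
    replace (P z) with (A z - (A z - P z))%C by ring.
    eapply Rle_trans; [apply Cmod_triangle|]. rewrite Cmod_opp.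
    specialize (HB z Hz). specialize (HP2 z ltac:(lra)). lra. }
  specialize (HP2 (RtoC 0) ltac:(rewrite Cmod_0; lra)).
  replace (A (RtoC 0)) with (P (RtoC 0) + (A (RtoC 0) - P (RtoC 0)))%C by ring.
  eapply Rle_trans; [apply Cmod_triangle|]. lra.
Qed.

Lemma poly_sum (a : nat -> C) n : exists P, poly_fun P /\ forall z, P z = sum_n (fun k => a k * z ^ k)%C n.
Proof.
  revert a. induction n as [|n IH]; intros a.
  - exists (fun _ => a 0%nat). split; [apply poly_const|]. intros z. rewrite sum_O. cbn. ring.
  - destruct (IH (fun k => a (S k))) as [P [HP1 HP2]].
    exists (fun z => a 0%nat + z * P z)%C.
    split; [apply (poly_plus (fun _ => a 0%nat)); [apply poly_const|now apply poly_shift]|].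
    intros z. rewrite sum_n_shift, HP2, <- sum_n_Cmult. f_equal; [cbn; ring|].
    apply sum_n_ext. intros k. cbn [Cpow]. Cring.
Qed.

Lemma poly_approx_series r (a : nat -> C) A : 0 <= r -> ex_series (fun k => Cmod (a k) * r ^ k) ->
  (forall z, Cmod z <= r -> is_Cseries (fun k => a k * z ^ k)%C (A z)) -> poly_approx r A.
Proof.
  intros Hr Ha HA eps He.
  assert (Hl := Series_correct _ Ha). apply is_series_lim_seq, is_lim_seq_spec in Hl.
  destruct (Hl (mkposreal eps He)) as [N HN]. specialize (HN N (le_n N)). cbn [pos] in HN.
  destruct (poly_sum a N) as [P [HP1 HP2]]. exists P. split; auto. intros z Hz.
  rewrite HP2.
  eapply Rle_trans; [apply (is_Cseries_tail _ (fun k => Cmod (a k) * r ^ k)); auto|].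
  - intros k. rewrite Cmod_mult, Cmod_pow. apply Rmult_le_compat_l; [apply Cmod_ge_0|].
    apply pow_incr. split; auto using Cmod_ge_0.
  - rewrite Rabs_minus_sym in HN. apply Rabs_lt_between in HN. lra.
Qed.

(** * Newman's Tauberian theorem *)

Definition CInt (w : R -> C) (a b : R) : C := (RInt (fun x => Re (w x)) a b, RInt (fun x => Im (w x)) a b).

Lemma CInt_plus u v a b : Ccont u -> Ccont v -> CInt (fun x => u x + v x)%C a b = (CInt u a b + CInt v a b)%C.
Proof.
  intros [H1 H2] [H3 H4]. unfold CInt, Cplus; cbn [fst snd].
  apply injective_projections; cbn [fst snd].
  - exact (RInt_plus (fun x => Re (u x)) (fun x => Re (v x)) a b
      (cont_ex_RInt _ _ _ H1) (cont_ex_RInt _ _ _ H3)).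
  - exact (RInt_plus (fun x => Im (u x)) (fun x => Im (v x)) a b
      (cont_ex_RInt _ _ _ H2) (cont_ex_RInt _ _ _ H4)).
Qed.

Lemma CInt_ext u v a b : (forall x, u x = v x) -> CInt u a b = CInt v a b.
Proof. intros H. unfold CInt. f_equal; apply RInt_ext; intros x _; now rewrite H. Qed.

Lemma CInt_scal c u a b : Ccont u -> CInt (fun x => c * u x)%C a b = (c * CInt u a b)%C.
Proof.
  intros [H1 H2]. destruct c as [c d]. unfold CInt, Cmult; cbn [fst snd].
  assert (E1 := fun k => cont_ex_RInt _ a b (cont_scal k _ H1)).
  assert (E2 := fun k => cont_ex_RInt _ a b (cont_scal k _ H2)).
  assert (S1 : forall k, RInt (fun x => k * Re (u x)) a b = k * RInt (fun x => Re (u x)) a b).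
  { intros k. exact (RInt_scal (fun x => Re (u x)) a b k (cont_ex_RInt _ a b H1)). }
  assert (S2 : forall k, RInt (fun x => k * Im (u x)) a b = k * RInt (fun x => Im (u x)) a b).
  { intros k. exact (RInt_scal (fun x => Im (u x)) a b k (cont_ex_RInt _ a b H2)). }
  apply injective_projections; cbn [fst snd].
  - rewrite <- S1, <- S2. exact (RInt_minus _ _ a b (E1 c) (E2 d)).
  - rewrite <- S1, <- S2. exact (RInt_plus _ _ a b (E2 c) (E1 d)).
Qed.

Lemma CInt_bound w (phi : R -> R) a b : Ccont w -> cont phi -> a <= b ->
  (forall x, a <= x <= b -> Cmod (w x) <= phi x) -> Cmod (CInt w a b) <= 2 * RInt phi a b.
Proof.
  intros [H1 H2] Hphi Hab Hb.
  assert (G : forall u, cont u -> (forall x, a <= x <= b -> Rabs (u x) <= phi x) ->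
    Rabs (RInt u a b) <= RInt phi a b).
  { intros u Hu Hle. eapply Rle_trans; [apply abs_RInt_le; auto; now apply cont_ex_RInt|].
    apply RInt_le; auto.
    - apply cont_ex_RInt. intros x. apply continuous_comp; [apply Hu|apply continuous_Rabs].
    - now apply cont_ex_RInt.
    - intros x Hx. apply Hle. lra. }
  eapply Rle_trans; [apply Cmod_le_Re_Im|]. cbn [CInt fst snd Re Im].
  assert (G1 := G _ H1). assert (G2 := G _ H2). cbv beta in G1, G2.
  assert (Rabs (RInt (fun x => Re (w x)) a b) <= RInt phi a b).
  { apply G1. intros x Hx. eapply Rle_trans; [apply re_le_Cmod|auto]. }
  assert (Rabs (RInt (fun x => Im (w x)) a b) <= RInt phi a b).
  { apply G2. intros x Hx. eapply Rle_trans; [apply Im_le_Cmod|auto]. }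
  unfold CInt, Re, Im in *; cbn [fst snd] in *. lra.
Qed.

Lemma CInt_Chasles w a b c : Ccont w -> CInt w a c = (CInt w a b + CInt w b c)%C.
Proof.
  intros [H1 H2]. unfold CInt, Cplus; cbn [fst snd]. f_equal.
  - symmetry. exact (RInt_Chasles (fun x => Re (w x)) a b c (cont_ex_RInt _ _ _ H1) (cont_ex_RInt _ _ _ H1)).
  - symmetry. exact (RInt_Chasles (fun x => Im (w x)) a b c (cont_ex_RInt _ _ _ H2) (cont_ex_RInt _ _ _ H2)).
Qed.

Lemma CInt_RtoC u a b : CInt (fun x => RtoC (u x)) a b = RtoC (RInt u a b).
Proof.
  apply injective_projections; [reflexivity|].
  change (RInt (fun _ => 0) a b = 0). rewrite RInt_const. apply Rmult_0_r.
Qed.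

Lemma CInt_sum (u : nat -> R -> C) a b N : (forall k, Ccont (u k)) ->
  CInt (fun x => sum_n (fun k => u k x) N) a b = sum_n (fun k => CInt (u k) a b) N.
Proof.
  intros H. induction N as [|N IH].
  - rewrite sum_O. apply CInt_ext. intros x; now rewrite sum_O.
  - rewrite sum_Sn, <- IH. rewrite <- (CInt_plus _ _ _ _ (Ccont_sum u N H) (H (S N))).
    apply CInt_ext. intros x. now rewrite sum_Sn.
Qed.

(** Only the size of [w] beyond [T] matters for the remainder. *)
Lemma CInt0oo_tail w M s eps T : 0 < s -> Cexp_decay M s w -> 0 <= T -> 0 <= eps ->
  (forall x, T <= x -> Cmod (w x) <= eps * exp (- s * x)) ->
  Cmod (CInt0oo w - CInt w 0 T) <= 2 * (eps / s * exp (- s * T)).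
Proof.
  intros Hs Hw HT He Hb.
  assert (G : forall u, exp_decay M s u -> (forall x, T <= x -> Rabs (u x) <= eps * exp (- s * x)) ->
    Rabs (Int0oo u - RInt u 0 T) <= eps / s * exp (- s * T)).
  { intros u Hu Hle.
    assert (Hl := Int0oo_lim M s u Hs Hu).
    assert (Hl' : is_lim (fun S => Rabs (RInt u 0 S - RInt u 0 T)) p_infty (Rabs (Int0oo u - RInt u 0 T))).
    { eapply filterlim_comp; [|apply continuous_Rabs]. apply (is_lim_minus' _ _ _ (Int0oo u) (RInt u 0 T)); auto.
      apply is_lim_const. }
    refine (is_lim_le_loc (fun S => Rabs (RInt u 0 S - RInt u 0 T)) (fun _ => eps / s * exp (- s * T))
      p_infty (Finite _) (Finite _) _ Hl' _); [|apply is_lim_const].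
    exists T. intros S HS. rewrite RInt_diff by apply Hu.
    eapply Rle_trans; [apply abs_RInt_le; [lra|apply cont_ex_RInt, Hu]|].
    apply Rle_trans with (RInt (fun x => eps * exp (- s * x)) T S).
    - apply RInt_le; [lra| | |].
      + apply cont_ex_RInt. intros x. apply continuous_comp; [apply Hu|apply continuous_Rabs].
      + apply cont_ex_RInt, cont_scal, cont_exp.
      + intros x Hx. apply Hle. lra.
    - rewrite (is_RInt_unique _ _ _ _ (is_RInt_exp eps s T S ltac:(lra))).
      assert (0 <= eps / s * exp (- s * S)); [|lra].
      apply Rmult_le_pos; [apply Rdiv_le_0_compat; lra|apply Rlt_le, exp_pos]. }
  eapply Rle_trans; [apply Cmod_le_Re_Im|].
  assert (G1 := G _ (Cexp_decay_Re _ _ _ Hw)). assert (G2 := G _ (Cexp_decay_Im _ _ _ Hw)).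
  cbv beta in G1, G2.
  assert (Rabs (Int0oo (fun x => Re (w x)) - RInt (fun x => Re (w x)) 0 T) <= eps / s * exp (- s * T)).
  { apply G1. intros x Hx. eapply Rle_trans; [apply re_le_Cmod|auto]. }
  assert (Rabs (Int0oo (fun x => Im (w x)) - RInt (fun x => Im (w x)) 0 T) <= eps / s * exp (- s * T)).
  { apply G2. intros x Hx. eapply Rle_trans; [apply Im_le_Cmod|auto]. }
  unfold CInt0oo, CInt, Cminus, Cplus, Copp, Re, Im, Rminus in *; cbn [fst snd] in *. lra.
Qed.

Definition lap_kernel (h : R -> R) (z : C) (x : R) : C := (RtoC (h x) * cexp (- (z * RtoC x)))%C.

Lemma lap_kernel_Ccont h z : cont h -> Ccont (lap_kernel h z).
Proof.
  intros H. apply Ccont_mult; [now apply Ccont_RtoC|]. apply Ccont_cexp, Ccont_opp, Ccont_lin.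
Qed.

Lemma Cmod_lap_kernel h z x : Cmod (lap_kernel h z x) = Rabs (h x) * exp (- Re z * x).
Proof.
  unfold lap_kernel. rewrite Cmod_mult, Cmod_R, Cmod_cexp. f_equal. f_equal.
  unfold Re, Cmult, Copp, RtoC; cbn. ring.
Qed.

Lemma poly_approx_truncated_laplace h T r M : cont h -> 0 <= T -> 0 < r -> (forall x, 0 <= x -> Rabs (h x) <= M) ->
  poly_approx r (fun z => CInt (lap_kernel h z) 0 T).
Proof.
  intros Hh HT Hr HM eps He.
  assert (HM0 : 0 <= M) by (eapply Rle_trans; [apply Rabs_pos|apply (HM 0); lra]).
  set (K := 2 * (T * (M * exp (2 * r * T)))).
  assert (HK : 0 <= K).
  { unfold K. apply Rmult_le_pos; [lra|]. apply Rmult_le_pos; auto. apply Rmult_le_pos; auto.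
    apply Rlt_le, exp_pos. }
  assert (Hl := pow_lim0 (/ 2) ltac:(lra)). apply is_lim_seq_spec in Hl.
  assert (Hd : 0 < eps / (K + 1)) by (apply Rdiv_lt_0_compat; lra).
  destruct (Hl (mkposreal _ Hd)) as [N HN]. specialize (HN N (le_n N)). cbn [pos] in HN.
  rewrite Rminus_0_r, Rabs_pos_eq in HN by (apply pow_le; lra).
  destruct (poly_sum (fun k => (RtoC ((-1) ^ k) * CInt (fun x => RtoC (x ^ k / INR (fact k)) * RtoC (h x))%C 0 T)%C) N)
    as [P [HP1 HP2]].
  exists P. split; auto. intros z Hz. rewrite HP2.
  set (u := fun k x => (((-z) ^ k) * (RtoC (x ^ k / INR (fact k)) * RtoC (h x)))%C).
  assert (Hu0 : forall k, Ccont (fun x => RtoC (x ^ k / INR (fact k)) * RtoC (h x))%C).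
  { intros k. apply Ccont_mult; apply Ccont_RtoC; auto. apply cont_monomial. }
  assert (Hu : forall k, Ccont (u k)) by (intros k; apply Ccont_mult; auto using Ccont_const).
  rewrite (sum_n_ext _ (fun k => CInt (u k) 0 T)).
  2:{ intros k. unfold u. rewrite CInt_scal by auto.
      replace (- z)%C with (RtoC (-1) * z)%C by (rewrite RtoC_m1; ring).
      rewrite Cpow_mult_l, <- RtoC_pow. Cring. }
  rewrite <- CInt_sum by auto.
  set (D := fun x => (lap_kernel h z x + RtoC (-1) * sum_n (fun k => u k x) N)%C).
  assert (HD : (CInt (lap_kernel h z) 0 T - CInt (fun x => sum_n (fun k => u k x) N) 0 T)%C = CInt D 0 T).
  { unfold D. rewrite CInt_plus, CInt_scal.
    - rewrite RtoC_m1. ring.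
    - now apply Ccont_sum.
    - now apply lap_kernel_Ccont.
    - apply Ccont_mult; [apply Ccont_const|now apply Ccont_sum]. }
  rewrite HD.
  apply Rle_trans with (2 * RInt (fun _ => M * exp (2 * r * T) * (/ 2) ^ N) 0 T).
  - apply CInt_bound; auto using cont_const.
    + apply Ccont_plus; [now apply lap_kernel_Ccont|].
      apply Ccont_mult; [apply Ccont_const|now apply Ccont_sum].
    + intros x Hx.
      assert (HF : is_Cseries (fun k => (- z) ^ k * RtoC (x ^ k / INR (fact k)))%C (cexp (- (z * RtoC x)))%C).
      { eapply is_Cseries_ext; [|apply cexp_series]. intros k. cbv beta.
        replace (- (z * RtoC x))%C with ((- z) * RtoC x)%C by ring.
        rewrite Cpow_mult_l, RtoC_div, RtoC_pow by apply INR_fact_neq_0. unfold Cdiv. ring. }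
      assert (Hgeo : geom_bound 1 r (fun k => (- z) ^ k)%C).
      { intros k. rewrite Cmod_pow, Cmod_opp, Rmult_1_l. apply pow_incr. split; auto using Cmod_ge_0. }
      assert (B := is_Cseries_exp_tail _ 1 r (2 * r) x _ N Hgeo ltac:(lra) ltac:(lra) ltac:(lra) HF).
      replace (D x) with (RtoC (h x) * (cexp (- (z * RtoC x)) - sum_n (fun k => (- z) ^ k * RtoC (x ^ k / INR (fact k))) N))%C.
      * rewrite Cmod_mult, Cmod_R.
        replace (r / (2 * r)) with (/ 2) in B by (field; lra). rewrite Rmult_1_l in B.
        rewrite Rmult_assoc. apply Rmult_le_compat; auto using Rabs_pos, Cmod_ge_0.
        -- apply HM; lra.
        -- eapply Rle_trans; [exact B|]. rewrite Rmult_comm.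
           apply Rmult_le_compat_r; [apply pow_le; lra|].
           apply exp_le, Rmult_le_compat_l; lra.
      * unfold D, lap_kernel.
        assert (E : sum_n (fun k => u k x) N = (RtoC (h x) * sum_n (fun k => (- z) ^ k * RtoC (x ^ k / INR (fact k))) N)%C).
        { rewrite <- sum_n_Cmult. apply sum_n_ext. intros k. unfold u. Cring. }
        rewrite E, RtoC_m1. ring.
  - rewrite RInt_const. unfold scal; cbn -[pow]. unfold mult; cbn -[pow].
    replace (2 * ((T - 0) * (M * exp (2 * r * T) * (/ 2) ^ N))) with (K * (/ 2) ^ N) by (unfold K; ring).
    apply Rle_trans with ((K + 1) * (eps / (K + 1))); [|right; field; lra].
    apply Rmult_le_compat; try lra. apply pow_le; lra.
Qed.

Lemma mul_exp_neg_le c y : 0 <= c -> 0 < y -> c * exp (- (c * y)) <= / y.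
Proof.
  intros Hc Hy. assert (H := exp_ineq1_le (c * y)).
  apply Rmult_le_reg_r with y; auto. rewrite Rinv_l by lra.
  apply Rmult_le_reg_r with (exp (c * y)); [apply exp_pos|].
  replace (c * exp (- (c * y)) * y * exp (c * y)) with (c * y * (exp (- (c * y)) * exp (c * y))) by ring.
  rewrite <- exp_plus, Rplus_opp_l, exp_0. lra.
Qed.

(** On the circle |z| = r one has r ^ 2 = z * conj z, so that
    1 + (z / r) ^ 2 = 2 Re z / conj z: this factor compensates the pole 1 / Re z of
    the bounds on both half circles. *)
Lemma Cmod_newman_kernel z r : 0 < r -> Cmod z = r ->
  Cmod (1 + z * z * RtoC (/ (r * r)))%C = 2 * Rabs (Re z) / r.
Proof.
  intros Hr Hz.
  assert (Hz2 : (z * Cconj z)%C = RtoC (r * r)).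
  { rewrite <- Cmod2_conj, Hz.
    f_equal. ring. }
  assert (E : ((1 + z * z * RtoC (/ (r * r))) * RtoC (r * r) = z * RtoC (2 * Re z))%C).
  { replace ((1 + z * z * RtoC (/ (r * r))) * RtoC (r * r))%C with
      (RtoC (r * r) + z * z * (RtoC (/ (r * r)) * RtoC (r * r)))%C by ring.
    rewrite <- (RtoC_mult (/ (r * r))), Rinv_l by nra. rewrite <- Hz2.
    replace (RtoC (2 * Re z)) with (z + Cconj z)%C.
    - ring.
    - destruct z as [x y]. unfold Cconj, Cplus, RtoC, Re; cbn. f_equal; ring. }
  apply (f_equal Cmod) in E. rewrite !Cmod_mult, !Cmod_R, Hz in E.
  rewrite !Rabs_mult, (Rabs_pos_eq 2), (Rabs_pos_eq r) in E by lra.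
  apply Rmult_eq_reg_r with (r * r); [|nra]. rewrite E. field. lra.
Qed.

(** If h tends to 0 and its Laplace transform continues to a power series G on a
    disc about 0, the integral of h converges to G 0. Let h_T be the transform
    of h restricted to [0, T]. The function (G - h_T) exp (T z) (1 + (z / r) ^ 2)
    is a uniform limit of polynomials, so its value at 0, which is
    G 0 - int_0^T h, is at most its maximum on the circle. For Re z > 0,
    G - h_T is the transform of the tail of h; for Re z < 0, exp (T z) makes G
    negligible and turns h_T into a convolution of h with a decaying exponential. *)
Theorem newman_tauberian (h : R -> R) (g : nat -> C) (r M : R) :
  cont h -> 0 < r -> (forall x, 0 <= x -> Rabs (h x) <= M) -> is_lim h p_infty 0 ->
  ex_series (fun k => Cmod (g k) * r ^ k) ->
  (forall z, Cmod z = r -> 0 < Re z -> is_Cseries (fun k => g k * z ^ k)%C (CInt0oo (lap_kernel h z))) ->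
  forall eps, 0 < eps -> exists T0, forall T, T0 < T -> Cmod (g 0%nat - RtoC (RInt h 0 T)) <= eps.
Proof.
  intros Hh Hr HM Hlim Hg HL.
  set (CG := Series (fun k => Cmod (g k) * r ^ k)).
  assert (HgC : forall z, Cmod z <= r -> forall k, Cmod (g k * z ^ k)%C <= Cmod (g k) * r ^ k).
  { intros z Hz k. rewrite Cmod_mult, Cmod_pow. apply Rmult_le_compat_l; [apply Cmod_ge_0|].
    apply pow_incr; split; auto using Cmod_ge_0. }
  set (G := fun z => CSeries (fun k => g k * z ^ k)%C).
  assert (HG : forall z, Cmod z <= r -> is_Cseries (fun k => g k * z ^ k)%C (G z)).
  { intros z Hz. exact (CSeries_correct _ _ (HgC z Hz) Hg). }
  assert (HGb : forall z, Cmod z <= r -> Cmod (G z) <= CG).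
  { intros z Hz. exact (is_Cseries_bound _ _ _ (HgC z Hz) Hg (HG z Hz)). }
  assert (HG0 : G (RtoC 0) = g 0%nat).
  { apply (is_Cseries_unique (fun k => g k * RtoC 0 ^ k)%C).
    - apply HG. rewrite Cmod_0. lra.
    - eapply is_Cseries_ext; [|apply is_Cseries_single]. intros [|k]; cbn; ring. }
  assert (HCG : 0 <= CG) by (eapply Rle_trans; [apply Cmod_ge_0|apply (HGb (RtoC 0)); rewrite Cmod_0; lra]).
  assert (HM0 : 0 <= M) by (eapply Rle_trans; [apply Rabs_pos|apply (HM 0); lra]).
  intros eps0 He0.
  (* the bounds below add up to at most 5 eps / r *)
  set (eps := eps0 * r / 12). assert (He : 0 < eps) by (unfold eps; apply Rdiv_lt_0_compat; [nra|lra]).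
  apply is_lim_spec in Hlim. destruct (Hlim (mkposreal eps He)) as [X0 HX0]. cbn [pos] in HX0.
  set (X := Rmax X0 0 + 1).
  assert (HX : 0 < X) by (unfold X; generalize (Rmax_r X0 0); lra).
  assert (HXe : forall x, X <= x -> Rabs (h x) <= eps).
  { intros x Hx. assert (X0 < x) by (unfold X in Hx; generalize (Rmax_l X0 0); lra).
    specialize (HX0 x H). rewrite Rminus_0_r in HX0. lra. }
  (* on the left half circle, [0, X] and G contribute at most Q / (r (T - X)) *)
  set (Q := 4 * M * X + 2 * CG).
  assert (HQ : 0 <= Q) by (unfold Q; assert (0 <= M * X) by (apply Rmult_le_pos; lra); lra).
  exists (X + Q / eps + 1). intros T HT.
  assert (HQe : 0 <= Q / eps) by (apply Rdiv_le_0_compat; auto).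
  assert (HTX : Q / eps < T - X) by lra.
  assert (HTX0 : 0 < T - X) by lra.
  set (A := fun z => ((G z + RtoC (-1) * CInt (lap_kernel h z) 0 T) * cexp (z * RtoC T) * (1 + z * z * RtoC (/ (r * r))))%C).
  assert (HA0 : A (RtoC 0) = (g 0%nat - RtoC (RInt h 0 T))%C).
  { unfold A. rewrite HG0. replace (RtoC 0 * RtoC T)%C with (RtoC 0) by ring.
    rewrite cexp_RtoC, exp_0.
    rewrite (CInt_ext (lap_kernel h (RtoC 0)) (fun x => RtoC (h x))).
    - rewrite CInt_RtoC, RtoC_m1. ring.
    - intros x. unfold lap_kernel. replace (- (RtoC 0 * RtoC x))%C with (RtoC 0) by ring.
      rewrite cexp_RtoC, exp_0. ring. }
  rewrite <- HA0. apply (poly_approx_max r A); [|lra|].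
  { apply poly_approx_mult; [apply poly_approx_mult|].
    - apply poly_approx_plus.
      + apply (poly_approx_series r g); auto; lra.
      + apply poly_approx_mult; [apply poly_approx_poly, poly_const|]. apply (poly_approx_truncated_laplace h T r M); auto; lra.
    - apply (poly_approx_series r (fun k => RtoC (T ^ k / INR (fact k)))); [lra| |].
      + apply ex_series_ext with (fun k => (T * r) ^ k / INR (fact k)); [|eexists; apply exp_series].
        intros k. rewrite Cmod_R, Rabs_pos_eq, Rpow_mult_distr; [unfold Rdiv; Rring|].
        apply Rdiv_le_0_compat; [apply pow_le; lra|apply INR_fact_lt_0].
      + intros z _. eapply is_Cseries_ext; [|apply cexp_series]. intros k. cbv beta.
        rewrite Cpow_mult_l, RtoC_div, RtoC_pow by apply INR_fact_neq_0. unfold Cdiv. ring.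
    - apply poly_approx_plus; [apply poly_approx_poly, poly_const|].
      apply poly_approx_ext with (fun z => (z * (z * RtoC (/ (r * r))))%C); [intros; ring|].
      apply poly_approx_poly. apply (poly_shift (fun z => z * RtoC (/ (r * r)))%C).
      apply (poly_shift (fun z => RtoC (/ (r * r)))%C). apply poly_const. }
  intros z Hz. unfold A. rewrite !Cmod_mult, Cmod_newman_kernel, Cmod_cexp by auto.
  replace (Re (z * RtoC T)%C) with (Re z * T) by (unfold Re, Cmult, RtoC; cbn; ring).
  replace (G z + RtoC (-1) * CInt (lap_kernel h z) 0 T)%C with (G z - CInt (lap_kernel h z) 0 T)%C
    by (rewrite RtoC_m1; ring).
  assert (Hbound : 4 * eps / r + (4 * M * X + 2 * CG) / (r * (T - X)) <= eps0).
  { fold Q. assert (Q / (r * (T - X)) <= eps / r).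
    { apply Rmult_le_reg_r with (r * (T - X)); [nra|].
      replace (Q / (r * (T - X)) * (r * (T - X))) with Q by (field; lra).
      replace (eps / r * (r * (T - X))) with (eps * (T - X)) by (field; lra).
      apply Rlt_le. apply Rmult_lt_reg_r with (/ eps); [apply Rinv_0_lt_compat; auto|].
      replace (eps * (T - X) * / eps) with (T - X) by (field; lra). exact HTX. }
    assert (5 * (eps / r) <= eps0).
    { unfold eps. replace (eps0 * r / 12 / r) with (eps0 / 12) by (field; lra). lra. }
    replace (4 * eps / r) with (4 * (eps / r)) by (unfold Rdiv; ring). lra. }
  eapply Rle_trans; [|exact Hbound].
  assert (HrTX : 0 < r * (T - X)) by nra.
  assert (Hi : 0 < / r) by (apply Rinv_0_lt_compat; auto).
  assert (Hpos2 : 0 <= (4 * M * X + 2 * CG) / (r * (T - X))) by (apply Rdiv_le_0_compat; auto).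
  destruct (Rtotal_order (Re z) 0) as [Hneg|[Hzero|Hposz]].
  - set (c := - Re z). assert (Hc : 0 < c) by (unfold c; lra).
    replace (Re z) with (- c) by (unfold c; ring). rewrite Rabs_Ropp, (Rabs_pos_eq c) by lra.
    replace (- c * T) with (- (c * T)) by ring.
    assert (B1 : Cmod (CInt (lap_kernel h z) 0 X) <= 2 * (X * (M * exp (c * X)))).
    { apply Rle_trans with (2 * RInt (fun _ => M * exp (c * X)) 0 X).
      - apply CInt_bound; auto using lap_kernel_Ccont, cont_const; [lra|].
        intros x Hx. rewrite Cmod_lap_kernel. fold c. apply Rmult_le_compat; auto using Rabs_pos.
        + apply Rlt_le, exp_pos.
        + apply HM; lra.
        + apply exp_le, Rmult_le_compat_l; lra.
      - rewrite RInt_const. unfold scal; cbn. unfold mult; cbn. lra. }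
    assert (B2 : Cmod (CInt (lap_kernel h z) X T) <= 2 * (eps / c * exp (c * T))).
    { apply Rle_trans with (2 * RInt (fun x => eps * exp (- (- c) * x)) X T).
      - apply CInt_bound; auto using lap_kernel_Ccont; [apply cont_scal, cont_exp|lra|].
        intros x Hx. rewrite Cmod_lap_kernel. fold c. rewrite Ropp_involutive.
        apply Rmult_le_compat_r; [apply Rlt_le, exp_pos|]. apply HXe; lra.
      - rewrite (is_RInt_unique _ _ _ _ (is_RInt_exp eps (- c) X T ltac:(lra))).
        rewrite Ropp_involutive.
        replace (eps / - c) with (- (eps / c)) by (field; lra).
        assert (0 <= eps / c * exp (c * X)).
        { apply Rmult_le_pos; [apply Rdiv_le_0_compat; lra|apply Rlt_le, exp_pos]. }
        lra. }
    assert (B : Cmod (G z - CInt (lap_kernel h z) 0 T) <= CG + (2 * (X * (M * exp (c * X))) + 2 * (eps / c * exp (c * T)))).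
    { unfold Cminus. eapply Rle_trans; [apply Cmod_triangle|]. rewrite Cmod_opp.
      apply Rplus_le_compat; [apply HGb; lra|].
      rewrite (CInt_Chasles _ 0 X T) by now apply lap_kernel_Ccont.
      eapply Rle_trans; [apply Cmod_triangle|]. now apply Rplus_le_compat. }
    apply Rle_trans with ((CG + (2 * (X * (M * exp (c * X))) + 2 * (eps / c * exp (c * T)))) * exp (- (c * T)) * (2 * c / r)).
    { apply Rmult_le_compat_r; [apply Rdiv_le_0_compat; lra|].
      apply Rmult_le_compat_r; [apply Rlt_le, exp_pos|exact B]. }
    assert (E1 : exp (c * T) * exp (- (c * T)) = 1) by (rewrite <- exp_plus, Rplus_opp_r, exp_0; auto).
    assert (E2 : exp (c * X) * exp (- (c * T)) = exp (- (c * (T - X)))).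
    { rewrite <- exp_plus. f_equal. ring. }
    replace ((CG + (2 * (X * (M * exp (c * X))) + 2 * (eps / c * exp (c * T)))) * exp (- (c * T)) * (2 * c / r))
      with (2 * CG / r * (c * exp (- (c * T))) + 4 * M * X / r * (c * (exp (c * X) * exp (- (c * T))))
        + 4 * eps / r * (exp (c * T) * exp (- (c * T)))) by (field; lra).
    rewrite E1, E2.
    assert (F1 := mul_exp_neg_le c (T - X) ltac:(lra) HTX0).
    assert (F2 : c * exp (- (c * T)) <= / (T - X)).
    { eapply Rle_trans; [apply mul_exp_neg_le; lra|]. apply Rinv_le_contravar; lra. }
    replace ((4 * M * X + 2 * CG) / (r * (T - X))) with (2 * CG / r * / (T - X) + 4 * M * X / r * / (T - X))
      by (field; lra).
    assert (2 * CG / r * (c * exp (- (c * T))) <= 2 * CG / r * / (T - X)).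
    { apply Rmult_le_compat_l; auto. apply Rdiv_le_0_compat; lra. }
    assert (4 * M * X / r * (c * exp (- (c * (T - X)))) <= 4 * M * X / r * / (T - X)).
    { apply Rmult_le_compat_l; auto. apply Rdiv_le_0_compat; auto.
      apply Rmult_le_pos; lra. }
    lra.
  - rewrite Hzero, Rabs_R0.
    replace (2 * 0 / r) with 0 by (field; lra). rewrite Rmult_0_r.
    assert (0 <= 4 * eps / r) by (apply Rdiv_le_0_compat; lra). lra.
  - set (c := Re z) in *. rewrite (Rabs_pos_eq c) by lra.
    assert (HGz : G z = CInt0oo (lap_kernel h z)).
    { apply (is_Cseries_unique _ _ _ (HG z ltac:(lra))). now apply HL. }
    assert (B : Cmod (G z - CInt (lap_kernel h z) 0 T) <= 2 * (eps / c * exp (- c * T))).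
    { rewrite HGz. apply (CInt0oo_tail _ M); auto; try lra.
      - split; [now apply lap_kernel_Ccont|]. intros x Hx. rewrite Cmod_lap_kernel. fold c.
        apply Rmult_le_compat_r; [apply Rlt_le, exp_pos|auto].
      - intros x Hx. rewrite Cmod_lap_kernel. fold c.
        apply Rmult_le_compat_r; [apply Rlt_le, exp_pos|]. apply HXe; lra. }
    apply Rle_trans with (2 * (eps / c * exp (- c * T)) * exp (c * T) * (2 * c / r)).
    { apply Rmult_le_compat_r; [apply Rdiv_le_0_compat; lra|].
      apply Rmult_le_compat_r; [apply Rlt_le, exp_pos|exact B]. }
    replace (2 * (eps / c * exp (- c * T)) * exp (c * T) * (2 * c / r))
      with (4 * eps / r * (exp (- c * T) * exp (c * T))) by (field; lra).
    rewrite <- exp_plus. replace (- c * T + c * T) with 0 by ring. rewrite exp_0. lra.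
Qed.

Lemma Claplace_fun_0 g z x : Claplace_fun g z 0 x = lap_kernel g z x.
Proof.
  unfold Claplace_fun, lap_kernel. do 2 f_equal. cbn [pow fact INR]. field.
Qed.

(** * From moments to the Hankel integral *)

(** At a real point the coefficients [Claplace] are real. *)
Definition laplace (g : R -> R) (p : R) (j : nat) : R :=
  Int0oo (fun x => x ^ j / INR (fact j) * g x * exp (- (p * x))).

Lemma Claplace_RtoC g p j : Claplace g (RtoC p) j = RtoC (laplace g p j).
Proof.
  unfold Claplace, laplace. rewrite <- CInt0oo_RtoC. apply CInt0oo_ext. intros x _. unfold Claplace_fun.
  rewrite <- RtoC_mult, <- RtoC_opp, cexp_RtoC, <- RtoC_mult. reflexivity.
Qed.

Lemma geom_bound_of_linear (u : nat -> C) K rho : 0 <= K -> 1 < rho ->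
  (forall m, Cmod (u m) <= K * (INR m + 1)) -> geom_bound (K * (1 + / (rho - 1))) rho u.
Proof.
  intros HK Hrho H j. eapply Rle_trans; [apply H|]. rewrite Rmult_assoc.
  apply Rmult_le_compat_l; auto.
  assert (B : 1 + INR j * (rho - 1) <= rho ^ j).
  { replace rho with (1 + (rho - 1)) at 2 by ring. apply poly; lra. }
  assert (H1 : 1 <= rho ^ j) by (apply pow_R1_Rle; lra).
  assert (Hi : 0 < / (rho - 1)) by (apply Rinv_0_lt_compat; lra).
  assert (INR j <= / (rho - 1) * rho ^ j).
  { apply Rmult_le_reg_l with (rho - 1); [lra|]. rewrite <- Rmult_assoc, Rinv_r, Rmult_1_l by lra.
    generalize (pos_INR j). lra. }
  lra.
Qed.

(** Let f = sum c_k x ^ k / k! and h = f G, where G = x J in the application to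
    J = J_n. Writing f as a series of powers gives the Taylor coefficients of the
    Laplace transform of h in terms of those of G, by the binomial shift of weights
    c_k, wherever sum and integral may be exchanged, that is for p > al. The shift
    makes sense for all p > 0, because al < 1 and the coefficients for G are
    O(rho ^ m) for every rho > 1, and it commutes with a change of centre;
    so the relation persists down to p = 0, where the coefficients z0 for G are
    limits. *)
Section Transfer.
Variables (J f h : R -> R) (c : nat -> C) (A al Mk : R) (z0 : nat -> R).
Let G := fun x => x * J x.
Hypothesis (Hc : geom_bound A al c) (Hal : 0 < al < 1).
Hypothesis (Hf : cont f).
Hypothesis (Hser : forall x, 0 <= x -> is_Cseries (fun k => c k * RtoC (x ^ k / INR (fact k)))%C (RtoC (f x))).
Hypothesis (HG : lin_growth Mk G).
Hypothesis (Hh : forall x, h x = f x * G x).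
Hypothesis (Hbd : forall P, 0 < P -> exists K, 0 <= K /\ forall p m, 0 < p <= P -> Rabs (laplace G p m) <= K * (INR m + 1)).
Hypothesis (Hz0 : forall m, filterlim (fun p => laplace G p m) (at_right 0) (locally (z0 m))).
Variable (M : R).
Hypothesis (HhM : forall x, 0 <= x -> Rabs (h x) <= M) (Hh0 : is_lim h p_infty 0).

Lemma h_cont : cont h.
Proof.
  apply cont_ext with (fun x => f x * G x); [intros; now rewrite Hh|].
  apply cont_mult; auto. apply HG.
Qed.

Lemma M_nonneg : 0 <= M.
Proof. eapply Rle_trans; [apply Rabs_pos|apply (HhM 0); lra]. Qed.

Lemma h_growth : lin_growth M h.
Proof.
  split; [apply h_cont|]. intros x Hx. eapply Rle_trans; [now apply HhM|].
  rewrite <- (Rmult_1_r M) at 1. apply Rmult_le_compat_l; [apply M_nonneg|lra].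
Qed.

Lemma transfer_far p : al < p -> is_binom_shift c (Claplace G (RtoC p)) (Claplace h (RtoC p)).
Proof.
  intros Hp j.
  set (s := (al + p) / 2). assert (Hs : al < s < p) by (unfold s; lra).
  destruct (Claplace_fun_decay Mk G (RtoC p) j s HG ltac:(cbn; lra)) as [M' HM'].
  assert (HH := CInt0oo_series (Claplace_fun G (RtoC p) j) c (fun x => RtoC (f x)) M' s A al HM' Hc
    ltac:(lra) (Ccont_RtoC _ Hf) Hser).
  replace (Claplace h (RtoC p) j) with (CInt0oo (fun x => RtoC (f x) * Claplace_fun G (RtoC p) j x)%C).
  - eapply is_Cseries_ext; [|exact HH]. intros k. cbv beta.
    rewrite <- Cmult_assoc. f_equal.
    destruct (Claplace_fun_decay Mk G (RtoC p) (k + j) s HG ltac:(cbn; lra)) as [M'' HM''].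
    unfold Claplace. rewrite <- (CInt0oo_scal (RtoC (binom k j)) M'' s _ ltac:(lra) HM'').
    apply CInt0oo_ext. intros x _. unfold Claplace_fun. rewrite !Cmult_assoc, <- !RtoC_mult. f_equal. f_equal.
    unfold binom. rewrite pow_add. field. repeat split; apply INR_fact_neq_0.
  - unfold Claplace. apply CInt0oo_ext. intros x _. unfold Claplace_fun. rewrite Hh.
    rewrite !Cmult_assoc, <- !RtoC_mult. f_equal. f_equal. ring.
Qed.

Lemma geom_bound_G rho p : 1 < rho -> 0 < p -> exists K, geom_bound K rho (Claplace G (RtoC p)).
Proof.
  intros Hr Hp. destruct (Hbd p Hp) as [K [HK HK']].
  eexists. apply (geom_bound_of_linear _ K rho HK Hr).
  intros m. rewrite Claplace_RtoC, Cmod_R. apply HK'. lra.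
Qed.

Lemma ratio_exists t : 0 <= t -> al + t < 1 -> exists rho, 1 < rho /\ (al + t) * rho < 1.
Proof.
  intros Ht Hat. exists ((1 + / (al + t)) / 2).
  assert (H : 1 < / (al + t)) by (rewrite <- Rinv_1; apply Rinv_lt_contravar; lra).
  split; [lra|]. replace ((al + t) * ((1 + / (al + t)) / 2)) with ((al + t) / 2 + / 2) by (field; lra). lra.
Qed.

(** Analytic continuation, one step: both sides are re-expanded about p - t. *)
Lemma transfer_step p t : 0 < t < p -> al + t < 1 ->
  is_binom_shift c (Claplace G (RtoC p)) (Claplace h (RtoC p)) ->
  is_binom_shift c (Claplace G (RtoC (p - t))) (Claplace h (RtoC (p - t))).
Proof.
  intros Ht Hat HT.
  destruct (ratio_exists t ltac:(lra) Hat) as [rho [Hr1 Hr2]].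
  destruct (geom_bound_G rho p Hr1 ltac:(lra)) as [K HK].
  assert (Hmt : Cmod (RtoC t) = t) by (rewrite Cmod_R, Rabs_pos_eq; lra).
  assert (Hg := geom_bound_pow (RtoC t)). rewrite Hmt in Hg.
  rewrite RtoC_minus.
  apply (binom_shift_comm c (fun k => RtoC t ^ k)%C (Claplace G (RtoC p)) (Claplace h (RtoC p)) _ _ A 1 K al t rho); auto; try lra.
  - apply (Claplace_shift Mk); auto. rewrite Hmt. cbn. lra.
  - apply (Claplace_shift M); auto using h_growth. rewrite Hmt. cbn. lra.
Qed.

(** Steps of constant length lead from the half line p > al to any p > 0. *)
Lemma transfer_all p : 0 < p -> is_binom_shift c (Claplace G (RtoC p)) (Claplace h (RtoC p)).
Proof.
  intros Hp.
  set (t := Rmin p (1 - al) / 2).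
  assert (Ht : 0 < t /\ t < p /\ al + t < 1).
  { assert (H1 := Rmin_l p (1 - al)). assert (H2 := Rmin_r p (1 - al)).
    assert (0 < Rmin p (1 - al)) by (apply Rmin_pos; lra). unfold t. lra. }
  assert (Hind : forall N q, p <= q -> al < q + INR N * t -> is_binom_shift c (Claplace G (RtoC q)) (Claplace h (RtoC q))).
  { induction N as [|N IH]; intros q Hq HN.
    - apply transfer_far. cbn in HN. lra.
    - replace q with ((q + t) - t) by ring. apply transfer_step; try lra.
      apply IH; [lra|]. rewrite S_INR in HN. lra. }
  destruct (INR_unbounded (al / t)) as [N HN].
  apply (Hind N p); [lra|].
  assert (al < INR N * t); [|lra].
  apply Rmult_lt_reg_r with (/ t); [apply Rinv_0_lt_compat; lra|].
  rewrite Rmult_assoc, Rinv_r, Rmult_1_r by lra. exact HN.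
Qed.

(** The expansion about p has radius at least 1 > p, hence is continuous up to the
    point 0, which lies on the boundary of the disc where the Laplace integral
    itself converges. *)
Lemma shift_to_zero p : 0 < p < 1 -> is_binom_shift (fun k => RtoC p ^ k)%C (Claplace G (RtoC p)) (fun m => RtoC (z0 m)).
Proof.
  intros Hp m.
  set (a := fun k => binom k m * laplace G p (k + m)).
  assert (Hterm : forall t k, (RtoC t ^ k * RtoC (binom k m) * Claplace G (RtoC p) (k + m)%nat)%C = RtoC (a k * t ^ k)).
  { intros t k. rewrite Claplace_RtoC, <- RtoC_pow, <- !RtoC_mult. f_equal. unfold a. ring. }
  (* 1 < rho < 1 / p, and then p < q < 1 / rho *)
  set (rho := (1 + / p) / 2).
  assert (Hip : 1 < / p) by (rewrite <- Rinv_1; apply Rinv_lt_contravar; lra).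
  assert (Hrho : 1 < rho < / p) by (unfold rho; lra).
  destruct (geom_bound_G rho p ltac:(lra) ltac:(lra)) as [K HK].
  set (q := (p + / rho) / 2).
  assert (Hq : p < q /\ q * rho < 1).
  { assert (p < / rho).
    { rewrite <- (Rinv_inv p). apply Rinv_lt_contravar; [|lra]. apply Rmult_lt_0_compat; lra. }
    split; [unfold q; lra|]. apply Rmult_lt_reg_r with (/ rho); [apply Rinv_0_lt_compat; lra|].
    rewrite Rmult_assoc, Rinv_r by lra. unfold q; lra. }
  assert (Hmq : Cmod (RtoC q) = q) by (rewrite Cmod_R, Rabs_pos_eq; lra).
  assert (Hgq := geom_bound_pow (RtoC q)). rewrite Hmq in Hgq.
  assert (Habs : ex_series (fun k => Rabs (a k * q ^ k))).
  { apply ex_series_ext with (fun k => Cmod (RtoC q ^ k * RtoC (binom k m) * Claplace G (RtoC p) (k + m)%nat)%C).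
    { intros k. now rewrite Hterm, Cmod_R. }
    apply (ex_series_dom _ (fun k => 1 * K * rho ^ m * (binom k m * (q * rho) ^ k))).
    - intros k. rewrite Rabs_pos_eq by apply Cmod_ge_0.
      replace (1 * K * rho ^ m * (binom k m * (q * rho) ^ k)) with
        (1 * q ^ k * binom k m * (K * rho ^ (k + m))) by (rewrite pow_add, Rpow_mult_distr; ring).
      apply Cmod_term_le; [apply Hgq|apply Rlt_le, binom_pos|apply HK].
    - apply ex_series_Rscal, ex_series_binom. split; [|apply Hq]. apply Rmult_le_pos; lra. }
  assert (HCV : Rbar_lt (Rabs p) (CV_radius a)).
  { apply CV_radius_gt with q; [rewrite Rabs_pos_eq; lra|now apply ex_series_Rabs]. }
  assert (Hsub : forall x y : R, x - (x - y) = y) by (intros; ring).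
  assert (HPS : PSeries a p = z0 m).
  { assert (Hcont := PSeries_continuity a p HCV).
    apply continuity_pt_filterlim in Hcont.
    assert (H1 : filterlim (fun e => PSeries a (p - e)) (at_right 0) (locally (PSeries a p))).
    { eapply filterlim_comp; [|exact Hcont].
      apply (filterlim_filter_le_1 (F := locally 0)).
      { apply filter_le_within. }
      replace (locally p) with (locally (p - 0)) by (f_equal; ring).
      exact (continuous_minus (fun _ => p) (fun e => e) 0 (continuous_const p 0) (continuous_id 0)). }
    assert (H2 : filterlim (fun e => PSeries a (p - e)) (at_right 0) (locally (z0 m))).
    { eapply filterlim_ext_loc; [|exact (Hz0 m)].
      exists (mkposreal p (proj1 Hp)). intros e He Hpos.
      assert (Hep : e < p).
      { change (Rabs (e - 0) < p) in He. rewrite Rminus_0_r, Rabs_pos_eq in He; lra. }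
      symmetry. apply is_series_unique.
      assert (Hmt : Cmod (RtoC (p - e)) = p - e) by (rewrite Cmod_R, Rabs_pos_eq; lra).
      assert (HS := Claplace_shift Mk G (RtoC p) (RtoC (p - e)) HG ltac:(rewrite Hmt; cbn; lra) m).
      rewrite <- RtoC_minus, Claplace_RtoC in HS. rewrite (Hsub p e) in HS.
      destruct HS as [HS _]. cbn [Re RtoC fst] in HS.
      eapply is_series_ext; [|exact HS]. intros k. cbv beta. rewrite Hterm. reflexivity. }
    exact (filterlim_locally_unique _ _ _ H1 H2). }
  apply is_Cseries_ext with (fun k => RtoC (a k * p ^ k)); [intros k; now rewrite Hterm|].
  apply is_Cseries_RtoC. rewrite <- HPS. apply is_pseries_R, PSeries_correct.
  now apply CV_radius_inside.
Qed.

Lemma z0_bound : exists K, 0 <= K /\ forall m, Cmod (RtoC (z0 m)) <= K * (INR m + 1).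
Proof.
  destruct (Hbd 1 Rlt_0_1) as [K [HK HK']]. exists K. split; auto. intros m.
  rewrite Cmod_R.
  assert (Hl : filterlim (fun p => Rabs (laplace G p m)) (at_right 0) (locally (Rabs (z0 m)))).
  { eapply filterlim_comp; [apply Hz0|apply continuous_Rabs]. }
  refine (filterlim_le (F := at_right 0) (fun p => Rabs (laplace G p m)) (fun _ => K * (INR m + 1))
    (Finite (Rabs (z0 m))) (Finite (K * (INR m + 1))) _ Hl _).
  - exists (mkposreal 1 Rlt_0_1). intros p Hp Hpos. apply HK'.
    change (Rabs (p - 0) < 1) in Hp. rewrite Rminus_0_r, Rabs_pos_eq in Hp; lra.
  - apply filterlim_const.
Qed.

(** Let v be the shift of z0 by the weights c. By [transfer_all] and re-expansion, the
    coefficients for h at p are the shift of v by the powers of - p, first for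
    small real p, then for complex p of positive real part by vertical steps. Thus
    the Laplace transform of h is a power series near 0 with constant term v_0, and
    [newman_tauberian] applies. *)
Theorem moment_series_integral : exists S : C,
  is_Cseries (fun k => c k * RtoC (z0 k))%C S /\
  forall eps, 0 < eps -> exists T0, forall T, T0 < T -> Cmod (S - RtoC (RInt h 0 T)) <= eps.
Proof.
  destruct (ratio_exists 0 (Rle_refl 0) ltac:(lra)) as [rho [Hr1 Hr2]]. rewrite Rplus_0_r in Hr2.
  destruct z0_bound as [Kz [HKz HKz']].
  assert (Hgz := geom_bound_of_linear _ Kz rho HKz Hr1 HKz').
  destruct (binom_shift_ex c (fun m => RtoC (z0 m)) _ _ al rho Hc Hgz ltac:(lra) ltac:(lra) Hr2) as [v Hv].
  set (kap := rho * / (1 - (1 + al * rho) / 2)).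
  assert (Hkap : 0 < kap).
  { apply Rmult_lt_0_compat; [lra|]. apply Rinv_0_lt_compat. lra. }
  destruct (binom_shift_geom_bound c _ v _ _ al rho Hc Hgz ltac:(lra) ltac:(lra) Hr2 Hv) as [Kv HKv]. fold kap in HKv.
  (* kap bounds the growth of v and of the coefficients for h at every real p; with
     4 kap r <= 1, two moves of length at most r stay inside the discs of convergence *)
  set (r := Rmin ((1 - al) / 2) (/ (4 * kap))).
  assert (Hr : 0 < r /\ r <= (1 - al) / 2 /\ r * kap <= / 4).
  { assert (H4 : 0 < / (4 * kap)) by (apply Rinv_0_lt_compat; lra).
    assert (G1 := Rmin_l ((1 - al) / 2) (/ (4 * kap))). assert (G2 := Rmin_r ((1 - al) / 2) (/ (4 * kap))).
    fold r in G1, G2.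
    repeat split; auto.
    - apply Rmin_pos; lra.
    - replace (/ 4) with (/ (4 * kap) * kap) by (field; lra). apply Rmult_le_compat_r; lra. }
  destruct Hr as [Hr [Hra Hrk]].
  assert (Hreal : forall x, 0 < x <= r -> is_binom_shift (fun k => (- RtoC x) ^ k)%C v (Claplace h (RtoC x))).
  { intros x Hx.
    assert (Hmx : Cmod (RtoC x) = x) by (rewrite Cmod_R, Rabs_pos_eq; lra).
    assert (Hgx := geom_bound_pow (RtoC x)). rewrite Hmx in Hgx.
    assert (Hgx' := geom_bound_pow (- RtoC x)%C). rewrite Cmod_opp, Hmx in Hgx'.
    destruct (ratio_exists x ltac:(lra) ltac:(lra)) as [rho' [Hr1' Hr2']].
    destruct (geom_bound_G rho' x Hr1' ltac:(lra)) as [K HK].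
    destruct (geom_bound_G rho x Hr1 ltac:(lra)) as [K2 HK2].
    assert (HT := transfer_all x ltac:(lra)).
    assert (HP : is_binom_shift (fun k => RtoC x ^ k)%C (Claplace h (RtoC x)) v).
    { apply (binom_shift_comm (fun k => RtoC x ^ k)%C c (Claplace G (RtoC x)) (fun m => RtoC (z0 m)) _ _ 1 A K x al rho');
        auto; try lra. apply shift_to_zero; lra. }
    destruct (binom_shift_geom_bound c _ _ _ _ al rho Hc HK2 ltac:(lra) ltac:(lra) Hr2 HT) as [Kh HKh]. fold kap in HKh.
    assert (Hxk : x * kap <= / 4) by (eapply Rle_trans; [apply Rmult_le_compat_r; [lra|apply Hx]|exact Hrk]).
    destruct (binom_shift_ex (fun k => (- RtoC x) ^ k)%C v _ _ x kap Hgx' HKv ltac:(lra) ltac:(lra) ltac:(lra)) as [y Hy].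
    assert (HI := binom_shift_pow_add (RtoC x) (- RtoC x)%C _ _ _ _ _ HKh (Rlt_le _ _ Hkap)
      ltac:(rewrite Cmod_opp, Hmx; lra) HP Hy).
    assert (HI0 : is_binom_shift (fun k => 0 ^ k)%C (Claplace h (RtoC x)) y).
    { eapply binom_shift_ext; [|exact HI]. intros k. cbv beta. f_equal. ring. }
    assert (Heq := binom_shift_pow_0 _ _ HI0).
    intros j. rewrite <- Heq. apply Hy. }
  assert (Hcomplex : forall z, Cmod z = r -> 0 < Re z -> is_binom_shift (fun k => (- z) ^ k)%C v (Claplace h z)).
  { intros z Hz Hrez. set (x := Re z). set (y := Im z).
    assert (Hx : 0 < x <= r).
    { split; auto. rewrite <- Hz. eapply Rle_trans; [apply Rle_abs|apply re_le_Cmod]. }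
    destruct (INR_unbounded (Rabs y / x + 1)) as [N HN].
    assert (HyN : 0 <= Rabs y / x) by (apply Rdiv_le_0_compat; [apply Rabs_pos|lra]).
    assert (HN0 : 1 < INR N) by lra.
    set (w := (Ci * RtoC (y / INR N))%C).
    assert (Hw : Cmod w = Rabs y / INR N).
    { unfold w. rewrite Cmod_mult, Cmod_Ci, Cmod_R, Rmult_1_l. unfold Rdiv.
      rewrite Rabs_mult, (Rabs_pos_eq (/ INR N)); auto. apply Rlt_le, Rinv_0_lt_compat; lra. }
    assert (Hyr : Rabs y <= r) by (rewrite <- Hz; apply Im_le_Cmod).
    assert (Hwx : Cmod w < x).
    { rewrite Hw. apply Rmult_lt_reg_r with (INR N / x); [apply Rdiv_lt_0_compat; lra|].
      replace (Rabs y / INR N * (INR N / x)) with (Rabs y / x) by (field; lra).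
      replace (x * (INR N / x)) with (INR N) by (field; lra). lra. }
    assert (Hstep : forall i, (i <= N)%nat ->
      is_binom_shift (fun k => (- (RtoC x + RtoC (INR i) * w)) ^ k)%C v (Claplace h (RtoC x + RtoC (INR i) * w)%C)).
    { induction i as [|i IH]; intros Hi.
      - cbn [INR]. replace (RtoC x + RtoC 0 * w)%C with (RtoC x) by ring. now apply Hreal.
      - specialize (IH ltac:(lia)).
        set (p := (RtoC x + RtoC (INR i) * w)%C) in *.
        assert (Hp' : (RtoC x + RtoC (INR (S i)) * w)%C = (p - (- w))%C).
        { unfold p. rewrite S_INR, RtoC_plus. ring. }
        rewrite Hp'.
        assert (Hrep : Re p = x).
        { unfold p, w, Re, Ci, RtoC, Cmult, Cplus; cbn [fst snd]. ring. }
        assert (HS := Claplace_shift M h p (- w)%C h_growth ltac:(rewrite Cmod_opp, Hrep; exact Hwx)).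
        assert (Hpr : Cmod p <= r).
        { rewrite <- Hz. apply Rsqr_incr_0_var; [|apply Cmod_ge_0].
          rewrite !Rsqr_pow2, !Cmod2_alt. rewrite Hrep. fold x y.
          assert (Himp : Im p = INR i / INR N * y).
          { unfold p, w, Im, Ci, RtoC, Cmult, Cplus; cbn [fst snd]. field. lra. }
          rewrite Himp. apply Rplus_le_compat_l. rewrite Rpow_mult_distr.
          rewrite <- (Rmult_1_l (y ^ 2)) at 2. apply Rmult_le_compat_r; [apply pow2_ge_0|].
          assert (0 <= INR i / INR N <= 1).
          { split; [apply Rdiv_le_0_compat; [apply pos_INR|lra]|].
            apply Rdiv_le_1; [lra|]. apply le_INR. lia. }
          nra. }
        assert (HG2 : (Cmod (- p)%C + Cmod (- w)%C) * kap < 1).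
        { rewrite !Cmod_opp. assert (Cmod w <= r) by lra.
          apply Rle_lt_trans with ((r + r) * kap); [apply Rmult_le_compat_r; lra|lra]. }
        assert (HI := binom_shift_pow_add (- p)%C (- w)%C _ _ _ _ _ HKv (Rlt_le _ _ Hkap) HG2 IH HS).
        eapply binom_shift_ext; [|exact HI]. intros k. cbv beta. f_equal. ring. }
    specialize (Hstep N (le_n N)).
    assert (Ez : (RtoC x + RtoC (INR N) * w)%C = z).
    { unfold w. rewrite (Cre_im z). fold x y.
      replace (RtoC y) with (RtoC (INR N) * RtoC (y / INR N))%C.
      - ring.
      - rewrite <- RtoC_mult. f_equal. field. lra. }
    now rewrite Ez in Hstep. }
  exists (v 0%nat). split.
  { eapply is_Cseries_ext; [|exact (Hv 0%nat)]. intros k. cbv beta. rewrite binom_0_r, Nat.add_0_r. ring. }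
  set (g := fun k => (RtoC ((-1) ^ k) * v k)%C).
  assert (Hg0 : v 0%nat = g 0%nat) by (unfold g; cbn; ring).
  rewrite Hg0.
  apply (newman_tauberian h g r M); auto using h_cont.
  - apply (ex_series_dom _ (fun k => Kv * (kap * r) ^ k)).
    + intros k. unfold g. rewrite Cmod_mult, Cmod_R, pow_1_abs, Rmult_1_l.
      rewrite Rabs_pos_eq by (apply Rmult_le_pos; [apply Cmod_ge_0|apply pow_le; lra]).
      rewrite Rpow_mult_distr, <- Rmult_assoc. apply Rmult_le_compat_r; [apply pow_le; lra|apply HKv].
    + apply ex_series_Rscal. eexists. apply is_series_geom. rewrite Rabs_pos_eq; [lra|].
      apply Rmult_le_pos; lra.
  - intros z Hz Hrez. assert (HT := Hcomplex z Hz Hrez 0%nat).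
    replace (CInt0oo (lap_kernel h z)) with (Claplace h z 0).
    + eapply is_Cseries_ext; [|exact HT]. intros k. cbv beta. rewrite binom_0_r, Nat.add_0_r.
      unfold g. replace (- z)%C with (RtoC (-1) * z)%C by (rewrite RtoC_m1; ring).
      rewrite Cpow_mult_l, <- RtoC_pow. ring.
    + unfold Claplace. apply CInt0oo_ext. intros x _. apply Claplace_fun_0.
Qed.
End Transfer.

(** * Bessel functions of natural order *)

Notation J := BesselJ_nat.

Definition bessel_coef (n m : nat) : R := (-1) ^ m / (INR (fact m) * INR (fact (m + n))).

Lemma bessel_coef_radius n : CV_radius (bessel_coef n) = p_infty.
Proof.
  assert (H : forall q : R, Rbar_le q (CV_radius (bessel_coef n))).
  { intros q. apply (proj1 (Lub_Rbar_correct (CV_disk (bessel_coef n))) q).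
    apply (ex_series_dom _ (fun m => Rabs q ^ m / INR (fact m))).
    - intros m. rewrite Rabs_Rabsolu. unfold bessel_coef. rewrite Rabs_mult, <- RPow_abs.
      unfold Rdiv. rewrite Rabs_mult, pow_1_abs, Rmult_1_l.
      rewrite Rmult_comm. apply Rmult_le_compat_l; [apply pow_le, Rabs_pos|].
      assert (H1 := INR_fact_lt_0 m). assert (H2 := INR_fact_lt_0 (m + n)).
      assert (H3 : 1 <= INR (fact (m + n))).
      { change 1 with (INR 1). apply le_INR. apply lt_O_fact. }
      rewrite Rabs_pos_eq by (apply Rlt_le, Rinv_0_lt_compat; nra).
      apply Rinv_le_contravar; auto. nra.
    - eexists. apply exp_series. }
  destruct (CV_radius (bessel_coef n)) as [r| |]; auto.
  - specialize (H (r + 1)). cbn in H. lra.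
  - specialize (H 0). contradiction.
Qed.

Lemma ex_pseries_bessel_coef n x : ex_pseries (bessel_coef n) x.
Proof. apply CV_radius_inside. rewrite bessel_coef_radius. exact I. Qed.

(** J_n x = (x / 2) ^ n * bessel_entire n ((x / 2) ^ 2), and differentiation of these
    entire functions is a mere shift of n: all recurrences of J_n follow. *)
Definition bessel_entire (n : nat) (y : R) : R := PSeries (bessel_coef n) y.

Lemma J_bessel_entire n x : J n x = (x / 2) ^ n * bessel_entire n ((x / 2) ^ 2).
Proof.
  unfold BesselJ_nat, bessel_entire, PSeries. rewrite <- Series_scal_l. apply Series_ext.
  intros m. unfold bessel_coef. rewrite pow_add, pow_mult. ring.
Qed.

Lemma bessel_entire_derive n (y : R) : is_derive (bessel_entire n) y (- bessel_entire (S n) y).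
Proof.
  assert (H := is_derive_PSeries (bessel_coef n) y). rewrite bessel_coef_radius in H. specialize (H I).
  replace (- bessel_entire (S n) y) with (PSeries (PS_derive (bessel_coef n)) y); auto.
  unfold bessel_entire. rewrite <- PSeries_opp. apply PSeries_ext. intros m.
  unfold PS_derive, PS_opp, bessel_coef. cbn [pow]. replace (S m + n)%nat with (m + S n)%nat by lia.
  rewrite fact_S_INR, S_INR. unfold opp; cbn -[fact pow INR]. field.
  repeat split; try apply INR_fact_neq_0. generalize (pos_INR m); lra.
Qed.

Lemma bessel_entire_rec n y : bessel_entire n y = INR (S n) * bessel_entire (S n) y - y * bessel_entire (S (S n)) y.
Proof.
  unfold bessel_entire. rewrite <- PSeries_scal, <- PSeries_incr_1, <- PSeries_minus.
  - apply PSeries_ext. intros m. unfold PS_minus, PS_plus, PS_opp, PS_scal, PS_incr_1.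
    unfold plus, opp, scal; cbn [AbelianMonoid.plus]. cbn -[fact INR Nat.add pow bessel_coef]. unfold mult; cbn -[fact INR Nat.add pow bessel_coef].
    destruct m as [|m]; unfold bessel_coef.
    + unfold zero; cbn -[fact INR]. rewrite (fact_S_INR n), S_INR. cbn [fact INR].
      field. split; [apply INR_fact_neq_0|generalize (pos_INR n); lra].
    + replace (m + S (S n))%nat with (S (S (m + n))) by lia.
      replace (S m + S n)%nat with (S (S (m + n))) by lia.
      replace (S m + n)%nat with (S (m + n)) by lia. cbn [pow].
      rewrite !fact_S_INR, !S_INR, plus_INR. field.
      generalize (pos_INR n) (pos_INR m). intros. repeat split; try apply INR_fact_neq_0; lra.
  - apply (ex_pseries_scal (V := R_NormedModule)); [apply Rmult_comm|apply ex_pseries_bessel_coef].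
  - apply (ex_pseries_incr_1 (V := R_NormedModule)), ex_pseries_bessel_coef.
Qed.

Definition dJ (n : nat) (x : R) : R :=
  match n with O => - J 1 x | S m => (J m x - J (S (S m)) x) / 2 end.

Lemma J_rec n x : x * (J n x + J (S (S n)) x) = 2 * INR (S n) * J (S n) x.
Proof.
  rewrite !J_bessel_entire, (bessel_entire_rec n). cbn [pow].
  set (s := x / 2). replace x with (2 * s) by (unfold s; field). ring.
Qed.

Lemma J_derive n (x : R) : is_derive (J n) x (dJ n x).
Proof.
  apply is_derive_ext with (fun x => (x / 2) ^ n * bessel_entire n ((x / 2) ^ 2)); [intros t; now rewrite J_bessel_entire|].
  assert (H : is_derive (fun x => (x / 2) ^ n * bessel_entire n ((x / 2) ^ 2)) x
    (INR n * (1 / 2) * (x / 2) ^ pred n * bessel_entire n ((x / 2) ^ 2) + (x / 2) ^ n * (- bessel_entire (S n) ((x / 2) ^ 2) * (x / 2)))).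
  { auto_derive.
    - eexists. apply bessel_entire_derive.
    - change (x * / 2 * (x * / 2 * 1)) with ((x / 2) ^ 2).
      rewrite (is_derive_unique _ _ _ (bessel_entire_derive n _)). change (x * / 2) with (x / 2). set (s := x / 2). Rfield. }
  replace (dJ n x) with (INR n * (1 / 2) * (x / 2) ^ pred n * bessel_entire n ((x / 2) ^ 2) + (x / 2) ^ n * (- bessel_entire (S n) ((x / 2) ^ 2) * (x / 2))); auto.
  destruct n as [|n]; unfold dJ; rewrite !J_bessel_entire.
  - cbn [INR pred pow]. ring.
  - rewrite (bessel_entire_rec n). cbn [pred pow]. set (s := x / 2). field.
Qed.

Lemma J_cont n : cont (J n).
Proof. apply cont_derive with (dJ n). apply J_derive. Qed.

Lemma dJ_eq n x : x * dJ n x = INR n * J n x - x * J (S n) x.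
Proof.
  destruct n as [|n]; unfold dJ; [cbn [INR]; ring|].
  assert (H := J_rec n x). rewrite S_INR in *. lra.
Qed.

Lemma dJ_S_eq n x : x * dJ (S n) x = x * J n x - INR (S n) * J (S n) x.
Proof.
  unfold dJ. assert (H := J_rec n x). lra.
Qed.

Lemma J_0 n : J n 0 = if n then 1 else 0.
Proof.
  rewrite J_bessel_entire. replace (0 / 2) with 0 by field.
  destruct n as [|n]; [|cbn [pow]; ring].
  cbn [pow]. replace (0 * (0 * 1)) with 0 by ring. unfold bessel_entire. rewrite PSeries_0. unfold bessel_coef. cbn. field.
Qed.

(** Its derivative is (2 n + 1) J_n J_(n+1) / x, smaller by a factor O(1 / x ^ 2) than
    the function itself for large x, which is then comparable to
    x (J_n ^ 2 + J_(n+1) ^ 2): hence J_n = O(x ^ (-1/2)). *)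
Definition J_energy n x := x * (J n x ^ 2 + J (S n) x ^ 2) - (2 * INR n + 1) * (J n x * J (S n) x).

Lemma J_energy_derive n (x : R) : 0 < x ->
  is_derive (J_energy n) x ((2 * INR n + 1) * (J n x * J (S n) x) / x).
Proof.
  intros Hx. unfold J_energy.
  evar_last.
  - auto_derive; repeat split; try (eexists; apply J_derive).
  - rewrite !(is_derive_unique _ _ _ (J_derive _ _)).
    assert (H1 := dJ_eq n x). assert (H2 := dJ_S_eq n x). rewrite S_INR in H2.
    assert (E1 : dJ n x = (INR n * J n x - x * J (S n) x) / x) by (rewrite <- H1; field; lra).
    assert (E2 : dJ (S n) x = (x * J n x - (INR n + 1) * J (S n) x) / x) by (rewrite <- H2; field; lra).
    rewrite E1, E2. field. lra.
Qed.

Lemma mul_le_half_sq (a b : R) : a * b <= (a ^ 2 + b ^ 2) / 2.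
Proof. assert (H := pow2_ge_0 (a - b)). lra. Qed.

Lemma J_decay_far n : exists K, 0 <= K /\ forall x, 2 * INR n + 1 <= x -> x * J n x ^ 2 <= K.
Proof.
  set (x0 := 2 * INR n + 1).
  assert (Hx0 : 1 <= x0) by (unfold x0; generalize (pos_INR n); lra).
  (* the exponential is an integrating factor: W is non-increasing beyond x0 *)
  set (W := fun x => J_energy n x * exp (x0 / x)).
  assert (HQ : forall x, x0 <= x -> x / 2 * (J n x ^ 2 + J (S n) x ^ 2) <= J_energy n x).
  { intros x Hx. unfold J_energy. fold x0.
    set (a := J n x). set (b := J (S n) x).
    assert (Ha := mul_le_half_sq a b).
    assert (Hb : 0 <= (a ^ 2 + b ^ 2) / 2) by (generalize (pow2_ge_0 a) (pow2_ge_0 b); lra).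
    assert (Hp : x0 * (a * b) <= x * ((a ^ 2 + b ^ 2) / 2)).
    { apply Rle_trans with (x0 * ((a ^ 2 + b ^ 2) / 2)).
      - apply Rmult_le_compat_l; lra.
      - apply Rmult_le_compat_r; lra. }
    lra. }
  assert (HW : forall x, x0 <= x -> W x <= W x0).
  { intros x Hx.
    destruct (MVT_gen W x0 x (fun t => (x0 * (J n t * J (S n) t) / t - x0 / t ^ 2 * J_energy n t) * exp (x0 / t)))
      as [t [Ht Heq]].
    - intros t Ht. rewrite Rmin_left, Rmax_right in Ht by lra. unfold W.
      evar_last.
      + apply (is_derive_mult (J_energy n) (fun x => exp (x0 / x))); [apply J_energy_derive; lra| |intros; apply Rmult_comm].
        auto_derive; [lra|reflexivity].
      + unfold plus, mult; cbn. fold x0. change (x0 * / t) with (x0 / t). field. lra.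
    - intros t Ht. rewrite Rmin_left, Rmax_right in Ht by lra.
      apply continuity_pt_filterlim. unfold W.
      apply (continuous_mult (J_energy n) (fun x => exp (x0 / x))).
      + apply (ex_derive_continuous (V := R_NormedModule)). eexists. apply J_energy_derive. lra.
      + apply (ex_derive_continuous (V := R_NormedModule) (fun x => exp (x0 / x))). auto_derive. lra.
    - rewrite Rmin_left, Rmax_right in Ht by lra.
      assert (Hneg : (x0 * (J n t * J (S n) t) / t - x0 / t ^ 2 * J_energy n t) * exp (x0 / t) * (x - x0) <= 0).
      { assert (He := exp_pos (x0 / t)).
        assert (Hin : x0 * (J n t * J (S n) t) / t - x0 / t ^ 2 * J_energy n t <= 0).
        { assert (H := HQ t (proj1 Ht)).
          replace (x0 * (J n t * J (S n) t) / t - x0 / t ^ 2 * J_energy n t)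
            with (- (x0 / t ^ 2) * (J_energy n t - t * (J n t * J (S n) t))) by (field; lra).
          assert (Hd : 0 < x0 / t ^ 2) by (apply Rdiv_lt_0_compat; [lra|apply pow_lt; lra]).
          assert (t * (J n t * J (S n) t) <= t / 2 * (J n t ^ 2 + J (S n) t ^ 2)).
          { assert (Hm := mul_le_half_sq (J n t) (J (S n) t)).
            replace (t / 2 * (J n t ^ 2 + J (S n) t ^ 2)) with (t * ((J n t ^ 2 + J (S n) t ^ 2) / 2)) by field.
            apply Rmult_le_compat_l; lra. }
          nra. }
        assert (0 <= exp (x0 / t) * (x - x0)) by (apply Rmult_le_pos; lra). rewrite Rmult_assoc. nra. }
      lra. }
  exists (2 * W x0).
  assert (Hall : forall x, x0 <= x -> x * J n x ^ 2 <= 2 * W x0).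
  { intros x Hx. assert (H1 := HQ x Hx). assert (H2 := HW x Hx).
    assert (H3 : J_energy n x <= W x).
    { unfold W. rewrite <- (Rmult_1_r (J_energy n x)) at 1. apply Rmult_le_compat_l.
      - eapply Rle_trans; [|exact H1]. apply Rmult_le_pos; [lra|auto using pow2_ge_0, Rplus_le_le_0_compat].
      - assert (H4 := exp_ineq1_le (x0 / x)). assert (0 <= x0 / x) by (apply Rdiv_le_0_compat; lra). lra. }
    assert (0 <= x / 2 * J (S n) x ^ 2) by (apply Rmult_le_pos; [lra|auto using pow2_ge_0, Rplus_le_le_0_compat]). lra. }
  split; auto. eapply Rle_trans; [|apply (Hall x0); lra]. apply Rmult_le_pos; [lra|auto using pow2_ge_0, Rplus_le_le_0_compat].
Qed.

Lemma J_bounds n : exists K, 0 <= K /\ forall x, 0 <= x -> Rabs (J n x) <= K /\ sqrt x * Rabs (J n x) <= K.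
Proof.
  destruct (J_decay_far n) as [K [HK HKx]].
  set (x0 := 2 * INR n + 1) in *.
  assert (Hx0 : 1 <= x0) by (unfold x0; generalize (pos_INR n); lra).
  destruct (continuity_ab_maj (fun x => Rabs (J n x)) 0 x0 ltac:(lra)) as [xm [Hm _]].
  { intros x _. apply continuity_pt_filterlim.
    apply (continuous_comp (J n) Rabs); [apply J_cont|apply continuous_Rabs]. }
  set (B := Rabs (J n xm)) in *.
  assert (HB : 0 <= B) by apply Rabs_pos.
  assert (Hs0 : 1 <= sqrt x0) by (rewrite <- sqrt_1; apply sqrt_le_1_alt; lra).
  exists (sqrt x0 * B + sqrt K).
  assert (HsK := sqrt_pos K).
  assert (HsB : 0 <= sqrt x0 * B) by (apply Rmult_le_pos; lra).
  split; [lra|]. intros x Hx.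
  destruct (Rle_dec x x0) as [Hle|Hgt].
  - assert (H1 := Hm x ltac:(lra)). cbv beta in H1.
    split.
    + assert (B <= sqrt x0 * B) by nra. lra.
    + assert (sqrt x * Rabs (J n x) <= sqrt x0 * B); [|lra].
      apply Rmult_le_compat; auto using sqrt_pos, Rabs_pos. apply sqrt_le_1_alt; lra.
  - assert (H1 : sqrt x * Rabs (J n x) <= sqrt K).
    { rewrite <- (sqrt_Rsqr_abs (J n x)), <- sqrt_mult_alt by lra. apply sqrt_le_1_alt.
      rewrite Rsqr_pow2. apply HKx. lra. }
    assert (1 <= sqrt x) by (rewrite <- sqrt_1; apply sqrt_le_1_alt; lra).
    assert (Rabs (J n x) <= sqrt x * Rabs (J n x)) by (generalize (Rabs_pos (J n x)); nra).
    lra.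
Qed.

(** * The Laplace transform of Bessel functions *)

Definition laplace_fun (g : R -> R) (p : R) (j : nat) (x : R) : R :=
  x ^ j / INR (fact j) * g x * exp (- (p * x)).

Lemma laplace_fun_decay M g p j s : lin_growth M g -> s < p -> exists M', exp_decay M' s (laplace_fun g p j).
Proof.
  intros Hg Hs. destruct (Claplace_fun_decay M g (RtoC p) j s Hg Hs) as [M' H].
  exists M'. destruct (Cexp_decay_Re _ _ _ H) as [H1 H2].
  assert (E : forall x, Re (Claplace_fun g (RtoC p) j x) = laplace_fun g p j x).
  { intros x. unfold Claplace_fun, laplace_fun. rewrite <- RtoC_mult, <- RtoC_opp, cexp_RtoC, <- RtoC_mult.
    reflexivity. }
  split.
  - apply (cont_ext _ _ E H1).
  - intros x Hx. rewrite <- E. apply H2; auto.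
Qed.

Lemma bounded_lin_growth K g : cont g -> (forall x, 0 <= x -> Rabs (g x) <= K) -> lin_growth K g.
Proof.
  intros Hc H. split; auto. intros x Hx.
  assert (HK : 0 <= K) by (eapply Rle_trans; [apply Rabs_pos|apply (H 0); lra]).
  specialize (H x Hx). nra.
Qed.

Lemma lin_growth_mul_id K g : cont g -> 0 <= K -> (forall x, 0 <= x -> Rabs (g x) <= K) ->
  lin_growth K (fun x => x * g x).
Proof.
  intros Hc HK H. split; [apply cont_mult; auto using cont_id|]. intros x Hx.
  rewrite Rabs_mult, (Rabs_pos_eq x) by auto. specialize (H x Hx).
  generalize (Rabs_pos (g x)). nra.
Qed.

Lemma laplace_fun_lim M g p j : lin_growth M g -> 0 < p -> is_lim (laplace_fun g p j) p_infty 0.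
Proof.
  intros Hg Hp. destruct (laplace_fun_decay M g p j (p / 2) Hg ltac:(lra)) as [M' [_ H]].
  assert (Hl : is_lim (fun x => M' * exp (- (p / 2) * x)) p_infty 0).
  { replace (Finite 0) with (Rbar_mult M' 0) by (cbn; f_equal; ring).
    apply is_lim_scal_l. apply exp_neg_lim. lra. }
  apply (is_lim_le_le_loc (fun x => - (M' * exp (- (p / 2) * x))) (fun x => M' * exp (- (p / 2) * x))).
  - exists 0. intros x Hx. apply Rabs_le_between. apply H; lra.
  - replace (Finite 0) with (Rbar_opp 0) by (cbn; f_equal; ring). now apply is_lim_opp.
  - exact Hl.
Qed.

Lemma laplace_bound M g p : lin_growth M g -> (forall x, 0 <= x -> Rabs (g x) <= M) -> 0 < p ->
  Rabs (laplace g p 0) <= M / p.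
Proof.
  intros [Hc _] H Hp. apply Int0oo_bound; auto. split.
  - apply cont_mult; [apply cont_mult; auto; apply cont_monomial|].
    apply cont_ext with (fun x => exp ((- p) * x)); [|apply cont_exp]. intros x; f_equal; ring.
  - intros x Hx. cbn [pow fact INR].
    replace (1 / 1 * g x * exp (- (p * x))) with (g x * exp (- p * x)).
    + rewrite Rabs_mult, (Rabs_pos_eq (exp _)) by apply Rlt_le, exp_pos.
      apply Rmult_le_compat_r; [apply Rlt_le, exp_pos|auto].
    + replace (- (p * x)) with (- p * x) by ring. field.
Qed.

Lemma laplace_derive Mu Mv u v p : lin_growth Mu u -> lin_growth Mv v ->
  (forall x, is_derive u x (v x)) -> 0 < p ->
  laplace v p 0 = p * laplace u p 0 - u 0 /\
  forall m, laplace v p (S m) = p * laplace u p (S m) - laplace u p m.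
Proof.
  intros Hu Hv Hd Hp.
  assert (Hpp : p / 2 < p) by lra. assert (Hp2 : 0 < p / 2) by lra.
  split.
  - destruct (laplace_fun_decay Mu u p 0 _ Hu Hpp) as [M1 H1].
    destruct (laplace_fun_decay Mv v p 0 _ Hv Hpp) as [M2 H2].
    assert (HI : Int0oo (fun x => laplace_fun v p 0 x + - p * laplace_fun u p 0 x) = laplace v p 0 + - p * laplace u p 0).
    { etransitivity; [exact (Int0oo_plus _ _ (p / 2) _ _ Hp2 H2 (exp_decay_scal (- p) _ _ _ H1))|].
      apply f_equal. exact (Int0oo_scal (- p) _ (p / 2) _ Hp2 H1). }
    assert (E : laplace v p 0 + - p * laplace u p 0 = - laplace_fun u p 0 0).
    { rewrite <- HI. apply Int0oo_FTC.
      - intros x. unfold laplace_fun. cbn [pow fact INR]. evar_last.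
        + auto_derive; [eexists; apply Hd|reflexivity].
        + replace (Derive (fun x0 => u x0) x) with (v x) by (symmetry; apply is_derive_unique, Hd). Rfield.
      - apply cont_plus; [apply H2|apply cont_scal, H1].
      - apply (laplace_fun_lim Mu); auto. }
    unfold laplace_fun in E. cbn [pow fact INR] in E. rewrite Rmult_0_r, Ropp_0, exp_0 in E. lra.
  - intros m.
    destruct (laplace_fun_decay Mu u p (S m) _ Hu Hpp) as [M1 H1].
    destruct (laplace_fun_decay Mv v p (S m) _ Hv Hpp) as [M2 H2].
    destruct (laplace_fun_decay Mu u p m _ Hu Hpp) as [M3 H3].
    assert (HI : Int0oo (fun x => (laplace_fun v p (S m) x + - p * laplace_fun u p (S m) x) + laplace_fun u p m x)
      = laplace v p (S m) + - p * laplace u p (S m) + laplace u p m).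
    { etransitivity; [exact (Int0oo_plus _ _ (p / 2) _ _ Hp2 (exp_decay_plus _ _ _ _ _ H2 (exp_decay_scal (- p) _ _ _ H1)) H3)|].
      apply (f_equal (fun t => t + laplace u p m)).
      etransitivity; [exact (Int0oo_plus _ _ (p / 2) _ _ Hp2 H2 (exp_decay_scal (- p) _ _ _ H1))|].
      apply f_equal. exact (Int0oo_scal (- p) _ (p / 2) _ Hp2 H1). }
    assert (E : laplace v p (S m) + - p * laplace u p (S m) + laplace u p m = - laplace_fun u p (S m) 0).
    { rewrite <- HI. apply Int0oo_FTC.
      - intros x. unfold laplace_fun. evar_last.
        + auto_derive; [eexists; apply Hd|reflexivity].
        + replace (Derive (fun x0 => u x0) x) with (v x) by (symmetry; apply is_derive_unique, Hd). change (fact m + m * fact m)%nat with (fact (S m)).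
          change (match m with O => 1 | S _ => INR m + 1 end) with (INR (S m)).
          rewrite S_INR, fact_S_INR. cbn [pow].
          lazymatch goal with |- @eq _ ?a ?b => change (@eq R a b) end. field.
          split; [apply INR_fact_neq_0|generalize (pos_INR m); lra].
      - apply cont_plus; [apply cont_plus; [apply H2|apply cont_scal, H1]|apply H3].
      - apply (laplace_fun_lim Mu); auto. }
    unfold laplace_fun in E. cbn [pow] in E. unfold Rdiv in E. rewrite !Rmult_0_l in E. lra.
Qed.

Lemma laplace_mul_id M g p m : lin_growth M g -> 0 < p ->
  laplace (fun x => x * g x) p m = (INR m + 1) * laplace g p (S m).
Proof.
  intros Hg Hp. destruct (laplace_fun_decay M g p (S m) (p / 2) Hg ltac:(lra)) as [M1 H1].
  unfold laplace. change (Int0oo (fun x => x ^ S m / INR (fact (S m)) * g x * exp (- (p * x)))) with (Int0oo (laplace_fun g p (S m))).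
  rewrite <- (Int0oo_scal (INR m + 1) M1 (p / 2) (laplace_fun g p (S m)) ltac:(lra) H1).
  apply Int0oo_ext. intros x _. unfold laplace_fun. rewrite fact_S_INR. cbn [pow]. field.
  split; [apply INR_fact_neq_0|generalize (pos_INR m); lra].
Qed.

Lemma laplace_lin M N u v p m a b : lin_growth M u -> lin_growth N v -> 0 < p ->
  laplace (fun x => a * u x + b * v x) p m = a * laplace u p m + b * laplace v p m.
Proof.
  intros Hu Hv Hp.
  destruct (laplace_fun_decay M u p m (p / 2) Hu ltac:(lra)) as [M1 H1].
  destruct (laplace_fun_decay N v p m (p / 2) Hv ltac:(lra)) as [M2 H2].
  assert (Hp2 : 0 < p / 2) by lra.
  unfold laplace.
  change (Int0oo (fun x => x ^ m / INR (fact m) * u x * exp (- (p * x)))) with (Int0oo (laplace_fun u p m)).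
  change (Int0oo (fun x => x ^ m / INR (fact m) * v x * exp (- (p * x)))) with (Int0oo (laplace_fun v p m)).
  rewrite <- (Int0oo_scal a M1 (p / 2) _ Hp2 H1), <- (Int0oo_scal b M2 (p / 2) _ Hp2 H2).
  rewrite <- (Int0oo_plus _ _ (p / 2) _ _ Hp2 (exp_decay_scal a _ _ _ H1) (exp_decay_scal b _ _ _ H2)).
  apply Int0oo_ext. intros x _. unfold laplace_fun. ring.
Qed.

Definition JLap (n : nat) (p : R) (m : nat) : R := laplace (J n) p m.

Lemma J_lin n : exists K, 0 <= K /\ lin_growth K (J n) /\ (forall x, 0 <= x -> Rabs (J n x) <= K)
  /\ lin_growth K (fun x => x * J n x).
Proof.
  destruct (J_bounds n) as [K [HK H]]. exists K.
  assert (H' : forall x, 0 <= x -> Rabs (J n x) <= K) by (intros x Hx; apply H; auto).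
  repeat split; auto using J_cont.
  - apply (bounded_lin_growth K); auto using J_cont.
  - apply (lin_growth_mul_id K); auto using J_cont.
  - apply (lin_growth_mul_id K); auto using J_cont.
Qed.

Lemma laplace_opp M u p m : lin_growth M u -> 0 < p -> laplace (fun x => - u x) p m = - laplace u p m.
Proof.
  intros Hu Hp. transitivity (laplace (fun x => (-1) * u x + 0 * u x) p m).
  - apply Int0oo_ext. intros x _. ring.
  - rewrite (laplace_lin M M); auto. ring.
Qed.

Lemma JLap_1 p : 0 < p -> JLap 1 p 0 = 1 - p * JLap 0 p 0 /\ forall m, JLap 1 p (S m) = JLap 0 p m - p * JLap 0 p (S m).
Proof.
  intros Hp.
  destruct (J_lin 0) as [K0 [HK0 [H0 _]]]. destruct (J_lin 1) as [K1 [HK1 [H1 [H1' _]]]].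
  assert (H1n : lin_growth K1 (fun x => - J 1 x)).
  { apply bounded_lin_growth.
    - apply cont_ext with (fun x => (-1) * J 1 x); [intros; ring|]. apply cont_scal, J_cont.
    - intros x Hx. rewrite Rabs_Ropp. auto. }
  destruct (laplace_derive K0 K1 (J 0) (fun x => - J 1 x) p H0 H1n (J_derive 0) Hp) as [E1 E2].
  rewrite (laplace_opp K1) in E1 by auto. rewrite J_0 in E1. unfold JLap. split; [lra|].
  intros m. specialize (E2 m). rewrite (laplace_opp K1) in E2 by auto. lra.
Qed.

Lemma JLap_SS n p : 0 < p -> JLap (S (S n)) p 0 = JLap n p 0 - 2 * p * JLap (S n) p 0 /\
  forall m, JLap (S (S n)) p (S m) = JLap n p (S m) - 2 * p * JLap (S n) p (S m) + 2 * JLap (S n) p m.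
Proof.
  intros Hp.
  destruct (J_lin n) as [K0 [HK0 [H0 [H0' _]]]]. destruct (J_lin (S n)) as [K1 [HK1 [H1 [H1' _]]]].
  destruct (J_lin (S (S n))) as [K2 [HK2 [H2 [H2' _]]]].
  assert (Hd : lin_growth ((K0 + K2) / 2) (dJ (S n))).
  { apply bounded_lin_growth.
    - apply cont_ext with (fun x => / 2 * (J n x + (-1) * J (S (S n)) x)); [intros; unfold dJ; field|].
      apply cont_scal, cont_plus; [apply J_cont|apply cont_scal, J_cont].
    - intros x Hx. unfold dJ. unfold Rdiv. rewrite Rabs_mult, (Rabs_pos_eq (/ 2)) by lra.
      apply Rmult_le_compat_r; [lra|]. unfold Rminus. eapply Rle_trans; [apply Rabs_triang|].
      rewrite Rabs_Ropp. apply Rplus_le_compat; auto. }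
  assert (Hlin : forall m, laplace (dJ (S n)) p m = / 2 * JLap n p m + - / 2 * JLap (S (S n)) p m).
  { intros m. transitivity (laplace (fun x => / 2 * J n x + - / 2 * J (S (S n)) x) p m).
    - apply Int0oo_ext. intros x _. unfold dJ. field. apply INR_fact_neq_0.
    - now apply (laplace_lin K0 K2). }
  destruct (laplace_derive K1 _ (J (S n)) (dJ (S n)) p H1 Hd (J_derive (S n)) Hp) as [E1 E2].
  rewrite Hlin, J_0 in E1. fold (JLap (S n) p 0) in E1. split; [lra|].
  intros m. specialize (E2 m). rewrite Hlin in E2. fold (JLap (S n) p (S m)) in E2. fold (JLap (S n) p m) in E2. lra.
Qed.

(** Laplace transformation of Bessel's equation, in the form (x J_1)' = x J_0 and
    J_0' = - J_1. *)
Lemma JLap_0_rec p : 0 < p -> (1 + p * p) * JLap 0 p 1 = p * JLap 0 p 0 /\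
  forall m, (1 + p * p) * (INR m + 2) * JLap 0 p (S (S m)) = p * (2 * INR m + 3) * JLap 0 p (S m) - (INR m + 1) * JLap 0 p m.
Proof.
  intros Hp.
  destruct (J_lin 0) as [K0 [HK0 [H0 [H0' H0x]]]]. destruct (J_lin 1) as [K1 [HK1 [H1 [H1' H1x]]]].
  assert (Hd : forall x, is_derive (fun x => x * J 1 x) x (x * J 0 x)).
  { intros x. evar_last.
    - apply (is_derive_mult (fun x => x) (J 1)); [apply is_derive_id|apply J_derive|intros; apply Rmult_comm].
    - unfold plus, mult, one; cbn -[BesselJ_nat].
      assert (H := dJ_S_eq 0 x). cbn [dJ INR] in H. lra. }
  destruct (laplace_derive K1 K0 _ _ p H1x H0x Hd Hp) as [E1 E2].
  rewrite (laplace_mul_id K0), (laplace_mul_id K1), Rmult_0_l in E1 by auto.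
  destruct (JLap_1 p Hp) as [_ B]. fold (JLap 0 p 1) in E1. fold (JLap 1 p 1) in E1.
  rewrite (B 0%nat) in E1. cbn [INR] in E1. split; [lra|].
  intros m. specialize (E2 m). rewrite (laplace_mul_id K0), !(laplace_mul_id K1) in E2 by auto.
  fold (JLap 0 p (S (S m))) in E2. fold (JLap 1 p (S (S m))) in E2. fold (JLap 1 p (S m)) in E2.
  rewrite !B, S_INR in E2. lra.
Qed.

(** Up to normalization the JLap 0 p m are Legendre polynomials in
    p / sqrt (1 + p ^ 2), bounded by 1. The recurrence contracts the positive definite
    quadratic form d ^ 2 + b ^ 2, with b = JLap 0 p (m + 1) and d = JLap 0 p m - p b: the
    next values are c = (p b - k d) / (1 + p ^ 2) and b - p c = (b + k p d) / (1 + p ^ 2)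
    for some 0 <= k <= 1. *)
Lemma JLap_0_energy p : 0 < p -> forall m,
  (JLap 0 p m - p * JLap 0 p (S m)) ^ 2 + JLap 0 p (S m) ^ 2 <= (JLap 0 p 0 - p * JLap 0 p 1) ^ 2 + JLap 0 p 1 ^ 2.
Proof.
  intros Hp. destruct (JLap_0_rec p Hp) as [_ Hrec].
  induction m as [|m IH]; [lra|]. eapply Rle_trans; [|exact IH].
  specialize (Hrec m). assert (Hm := pos_INR m).
  set (a := JLap 0 p m) in *. set (b := JLap 0 p (S m)) in *. set (c := JLap 0 p (S (S m))) in *.
  set (k := (INR m + 1) / (INR m + 2)).
  assert (Hk : 0 <= k <= 1).
  { split; [apply Rdiv_le_0_compat|apply Rdiv_le_1]; lra. }
  set (d := a - p * b) in *.
  assert (Hc : c = (p * b - k * d) / (1 + p * p)).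
  { assert (0 < 1 + p * p) by nra. unfold d, k.
    apply Rmult_eq_reg_l with ((1 + p * p) * (INR m + 2)); [|nra]. rewrite Hrec. field. lra. }
  assert (Hs : 0 < 1 + p * p) by nra.
  assert (E : (b - p * c) ^ 2 + c ^ 2 = (b ^ 2 + k * k * d ^ 2) / (1 + p * p)).
  { rewrite Hc. field. lra. }
  rewrite E. apply Rmult_le_reg_r with (1 + p * p); auto.
  replace ((b ^ 2 + k * k * d ^ 2) / (1 + p * p) * (1 + p * p)) with (b ^ 2 + k * k * d ^ 2) by (field; lra).
  assert (Hkk : k * k <= 1) by nra.
  assert (Hd2 := pow2_ge_0 d). assert (Hb2 := pow2_ge_0 b).
  assert (k * k * d ^ 2 <= d ^ 2) by nra.
  assert (0 <= (d ^ 2 + b ^ 2) * (p * p)) by (apply Rmult_le_pos; [lra|nra]).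
  lra.
Qed.

Lemma JLap_derive n p : 0 < p -> is_derive (fun q => JLap n q 0) p (- JLap n p 1).
Proof.
  intros Hp. destruct (J_lin n) as [K [HK [HJ _]]].
  set (a := JLap n p).
  assert (Hser : forall t, Rabs t < p -> is_series (fun k => a k * t ^ k) (JLap n (p - t) 0)).
  { intros t Ht.
    assert (HS := Claplace_shift K (J n) (RtoC p) (RtoC t) HJ ltac:(rewrite Cmod_R; exact Ht) 0%nat).
    rewrite <- RtoC_minus, Claplace_RtoC in HS. destruct HS as [HS _]. cbn [Re RtoC fst] in HS.
    eapply is_series_ext; [|exact HS]. intros k. cbv beta.
    rewrite Claplace_RtoC, <- RtoC_pow, <- !RtoC_mult, binom_0_r, Nat.add_0_r. cbn [Re RtoC fst].
    unfold a, JLap. Rring. }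
  assert (HCV : Rbar_lt (Rabs 0) (CV_radius a)).
  { apply CV_radius_gt with (p / 2); [rewrite Rabs_R0; lra|].
    eexists. apply Hser. rewrite Rabs_pos_eq; lra. }
  assert (Hd := is_derive_PSeries a 0 HCV).
  rewrite PSeries_0 in Hd.
  assert (H1 : PS_derive a 0 = JLap n p 1) by (unfold PS_derive, a; cbn [INR]; ring).
  rewrite H1 in Hd.
  apply is_derive_ext_loc with (fun q => PSeries a (p - q)).
  - exists (mkposreal p Hp). intros q Hq.
    apply is_series_unique. replace (JLap n q 0) with (JLap n (p - (p - q)) 0) by (f_equal; ring).
    apply Hser. rewrite Rabs_minus_sym. exact Hq.
  - evar_last.
    + apply (is_derive_comp (PSeries a) (fun q => p - q)).
      * replace (p - p) with 0 by ring. exact Hd.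
      * auto_derive; auto.
    + change (- (1) * JLap n p 1 = - JLap n p 1). ring.
Qed.

(** The product has derivative 0 by the recurrence of order 0, and tends to 1
    at infinity. *)
Lemma JLap_0_0 p : 0 < p -> JLap 0 p 0 * sqrt (1 + p * p) = 1.
Proof.
  set (phi := fun p => JLap 0 p 0 * sqrt (1 + p * p)).
  assert (Hd : forall q, 0 < q -> is_derive phi q 0).
  { intros q Hq. assert (Hs : 0 < 1 + q * q) by nra.
    evar_last.
    - apply (is_derive_mult (fun q => JLap 0 q 0) (fun q => sqrt (1 + q * q))); [now apply JLap_derive| |intros; apply Rmult_comm].
      auto_derive; [exact Hs|reflexivity].
    - unfold plus, mult; cbn.
      destruct (JLap_0_rec q Hq) as [E _].
      assert (E' : JLap 0 q 1 = q * JLap 0 q 0 / (1 + q * q)) by (rewrite <- E; field; lra).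
      rewrite E'. assert (Hr := sqrt_lt_R0 _ Hs). set (r := sqrt (1 + q * q)) in *.
      assert (Hrr : 1 + q * q = r * r) by (unfold r; rewrite sqrt_sqrt; lra).
      rewrite Hrr. lazymatch goal with |- @eq _ ?a ?b => change (@eq R a b) end. field. lra. }
  assert (Hconst : forall q1 q2, 0 < q1 < q2 -> phi q1 = phi q2).
  { intros q1 q2 Hq. destruct (MVT_gen phi q1 q2 (fun _ => 0)) as [t [_ Ht]].
    - intros t Ht. rewrite Rmin_left in Ht by lra. apply Hd. lra.
    - intros t Ht. rewrite Rmin_left in Ht by lra. apply continuity_pt_filterlim.
      apply (ex_derive_continuous (V := R_NormedModule)). eexists. apply Hd. lra.
    - lra. }
  intros Hp. change (phi p = 1).
  destruct (J_lin 1) as [K [HK [H1 [H1' _]]]].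
  assert (Hclose : forall q, p < q -> 1 < q -> Rabs (phi p - 1) <= (2 * K + 1) / q).
  { intros q Hq Hq1. rewrite (Hconst p q) by lra.
    destruct (JLap_1 q ltac:(lra)) as [E _].
    assert (HB := laplace_bound K (J 1) q H1 H1' ltac:(lra)). fold (JLap 1 q 0) in HB.
    set (b := JLap 1 q 0) in *.
    assert (HA : JLap 0 q 0 = (1 - b) / q) by (rewrite E; field; lra).
    unfold phi. rewrite HA.
    set (r := sqrt (1 + q * q) / q).
    assert (Hr : 1 <= r <= 1 + / q).
    { unfold r. split.
      - apply Rmult_le_reg_r with q; [lra|]. unfold Rdiv. rewrite Rmult_assoc, Rinv_l, Rmult_1_r, Rmult_1_l by lra.
        rewrite <- (sqrt_square q) at 1 by lra. apply sqrt_le_1_alt. lra.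
      - apply Rmult_le_reg_r with q; [lra|]. unfold Rdiv. rewrite Rmult_assoc, Rinv_l, Rmult_1_r by lra.
        rewrite Rmult_plus_distr_r, Rinv_l, Rmult_1_l by lra.
        rewrite <- (sqrt_square (q + 1)) by lra. apply sqrt_le_1_alt. nra. }
    replace ((1 - b) / q * sqrt (1 + q * q) - 1) with ((r - 1) - b * r) by (unfold r; field; lra).
    assert (Hiq : 0 < / q < 1) by (split; [apply Rinv_0_lt_compat; lra|rewrite <- Rinv_1; apply Rinv_lt_contravar; lra]).
    unfold Rminus at 1. eapply Rle_trans; [apply Rabs_triang|].
    rewrite Rabs_Ropp, Rabs_mult, (Rabs_pos_eq r), (Rabs_pos_eq (r - 1)) by lra.
    assert (Rabs b * r <= K / q * 2) by (apply Rmult_le_compat; auto using Rabs_pos; lra).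
    unfold Rdiv in *. lra. }
  assert (H0 : Rabs (phi p - 1) <= 0).
  { apply le_of_forall_eps. intros eps He. rewrite Rplus_0_l.
    set (q := p + 1 + (2 * K + 1) / eps).
    assert (Hq : 0 < (2 * K + 1) / eps) by (apply Rdiv_lt_0_compat; lra).
    eapply Rle_trans; [apply (Hclose q); unfold q; lra|].
    apply Rmult_le_reg_r with q; [unfold q; lra|].
    unfold Rdiv at 1. rewrite Rmult_assoc, Rinv_l, Rmult_1_r by (unfold q; lra).
    unfold q. rewrite Rmult_plus_distr_l.
    replace (eps * ((2 * K + 1) / eps)) with (2 * K + 1) by (field; lra). nra. }
  assert (H2 := Rabs_pos (phi p - 1)).
  assert (H3 : Rabs (phi p - 1) = 0) by lra.
  destruct (Req_dec (phi p - 1) 0) as [H4|H4]; [lra|]. exfalso. now apply (Rabs_no_R0 _ H4).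
Qed.

Lemma JLap_0_bound p m : 0 < p -> Rabs (JLap 0 p m) <= 1.
Proof.
  intros Hp. assert (H0 := JLap_0_0 p Hp). assert (Hs : 1 <= 1 + p * p) by nra.
  destruct (JLap_0_rec p Hp) as [E1 _].
  set (A := JLap 0 p 0) in *. set (r := sqrt (1 + p * p)) in *.
  assert (Hrr : r * r = 1 + p * p) by (unfold r; apply sqrt_sqrt; lra).
  assert (Hr : 1 <= r) by (unfold r; rewrite <- sqrt_1 at 1; apply sqrt_le_1_alt; lra).
  assert (HA2 : A ^ 2 * (1 + p * p) = 1) by (rewrite <- Hrr; replace (A ^ 2 * (r * r)) with ((A * r) * (A * r)) by ring; rewrite H0; ring).
  assert (Hsq : forall y, y ^ 2 <= 1 -> Rabs y <= 1).
  { intros y Hy. rewrite <- (Rabs_pos_eq 1) by lra. apply Rsqr_le_abs_0. rewrite !Rsqr_pow2. lra. }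
  assert (HA : A ^ 2 <= 1).
  { assert (H := pow2_ge_0 A). nra. }
  destruct m as [|m]; [now apply Hsq|].
  apply Hsq.
  assert (HE := JLap_0_energy p Hp m). fold A in HE.
  assert (HY1 : JLap 0 p 1 = p * A / (1 + p * p)) by (rewrite <- E1; field; lra).
  assert (HE0 : (A - p * JLap 0 p 1) ^ 2 + JLap 0 p 1 ^ 2 = A ^ 2 / (1 + p * p)).
  { rewrite HY1. field. lra. }
  rewrite HE0 in HE.
  assert (HA3 : A ^ 2 / (1 + p * p) <= 1).
  { apply Rmult_le_reg_r with (1 + p * p); [lra|].
    replace (A ^ 2 / (1 + p * p) * (1 + p * p)) with (A ^ 2) by (field; lra). lra. }
  assert (H := pow2_ge_0 (JLap 0 p m - p * JLap 0 p (S m))). lra.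
Qed.

Lemma JLap_bound p : 0 < p -> forall n m, Rabs (JLap n p m) <= (3 + 2 * p) ^ n.
Proof.
  intros Hp.
  assert (Hstep : forall n, (forall m, Rabs (JLap n p m) <= (3 + 2 * p) ^ n) /\ (forall m, Rabs (JLap (S n) p m) <= (3 + 2 * p) ^ S n)).
  { induction n as [|n [IH1 IH2]].
    - split.
      + intros m. cbn [pow]. now apply JLap_0_bound.
      + destruct (JLap_1 p Hp) as [E1 E2]. cbn [pow].
        intros [|m].
        * rewrite E1. assert (H := JLap_0_bound p 0 Hp). apply Rabs_le_between in H.
          apply Rabs_le_between. nra.
        * rewrite E2. assert (H := JLap_0_bound p m Hp). assert (H' := JLap_0_bound p (S m) Hp).
          apply Rabs_le_between in H, H'. apply Rabs_le_between. nra.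
    - split; auto.
      destruct (JLap_SS n p Hp) as [E1 E2].
      assert (Hq : 0 < (3 + 2 * p) ^ n) by (apply pow_lt; lra).
      assert (HS : (3 + 2 * p) ^ S (S n) = (3 + 2 * p) ^ S n * (3 + 2 * p)) by (cbn [pow]; ring).
      assert (HS1 : (3 + 2 * p) ^ n <= (3 + 2 * p) ^ S n) by (cbn [pow]; nra).
      rewrite HS. set (Q := (3 + 2 * p) ^ S n) in *.
      intros [|m].
      + rewrite E1. assert (H := IH1 0%nat). assert (H' := IH2 0%nat).
        apply Rabs_le_between in H, H'. apply Rabs_le_between. nra.
      + rewrite E2. assert (H := IH1 (S m)). assert (H' := IH2 (S m)). assert (H'' := IH2 m).
        apply Rabs_le_between in H, H', H''. apply Rabs_le_between. nra. }
  intros n m. exact (proj1 (Hstep n) m).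
Qed.

(** * The Gamma function *)
Definition gamma_fun (x t : R) : R := Rpower t (x - 1) * exp (- t).

Lemma gamma_fun_pos x t : 0 < gamma_fun x t.
Proof. apply Rmult_lt_0_compat; apply exp_pos. Qed.

Lemma gamma_fun_cont x t : 0 < t -> continuous (gamma_fun x) t.
Proof.
  intros Ht. apply (ex_derive_continuous (V := R_NormedModule)). unfold gamma_fun, Rpower.
  auto_derive. exact Ht.
Qed.

Lemma gamma_fun_ex x a b : 0 < a <= b -> ex_RInt (gamma_fun x) a b.
Proof.
  intros Hab. apply (ex_RInt_continuous (V := R_CompleteNormedModule)).
  intros t Ht. rewrite Rmin_left in Ht by lra. apply gamma_fun_cont. lra.
Qed.

Lemma gamma_fun_tail x : exists K, 0 <= K /\ forall t, 1 <= t -> gamma_fun x t <= K * exp (- (/ 2) * t).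
Proof.
  destruct (INR_unbounded (x - 1)) as [N HN].
  exists (INR (fact N) * (/ / 2) ^ N). split.
  { apply Rmult_le_pos; [apply pos_INR|apply pow_le; lra]. }
  intros t Ht. unfold gamma_fun.
  assert (H1 : Rpower t (x - 1) <= t ^ N).
  { rewrite <- Rpower_pow by lra. apply Rle_Rpower; lra. }
  assert (H2 := pow_fact_exp (/ 2) N t ltac:(lra) ltac:(lra)).
  assert (Hf := INR_fact_lt_0 N).
  assert (H3 : t ^ N <= INR (fact N) * (/ / 2) ^ N * exp (/ 2 * t)).
  { apply Rmult_le_reg_r with (/ INR (fact N)); [now apply Rinv_0_lt_compat|].
    replace (INR (fact N) * (/ / 2) ^ N * exp (/ 2 * t) * / INR (fact N))
      with ((/ / 2) ^ N * exp (/ 2 * t)) by (field; lra).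
    exact H2. }
  apply Rle_trans with (INR (fact N) * (/ / 2) ^ N * exp (/ 2 * t) * exp (- t)).
  - apply Rmult_le_compat_r; [apply Rlt_le, exp_pos|lra].
  - right. rewrite Rmult_assoc, <- exp_plus. do 2 f_equal. field.
Qed.

Lemma gamma_fun_mono x a b a' b' : 0 < a' <= a -> a <= b <= b' ->
  RInt (gamma_fun x) a b <= RInt (gamma_fun x) a' b'.
Proof.
  intros Ha Hb.
  rewrite <- (RInt_Chasles (gamma_fun x) a' a b') by (apply gamma_fun_ex; lra).
  rewrite <- (RInt_Chasles (gamma_fun x) a b b') by (apply gamma_fun_ex; lra).
  assert (H : forall s t, 0 < s <= t -> 0 <= RInt (gamma_fun x) s t).
  { intros s t Hst. apply RInt_ge_0; [lra|apply gamma_fun_ex; lra|].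
    intros; apply Rlt_le, gamma_fun_pos. }
  assert (H1 := H a' a ltac:(lra)). assert (H2 := H b b' ltac:(lra)).
  change (RInt (gamma_fun x) a b <=
    RInt (gamma_fun x) a' a + (RInt (gamma_fun x) a b + RInt (gamma_fun x) b b')).
  lra.
Qed.

Lemma gamma_fun_bounded x : 0 < x -> exists K, forall a b, 0 < a <= b -> RInt (gamma_fun x) a b <= K.
Proof.
  intros Hx. destruct (gamma_fun_tail x) as [C [HC HCt]].
  exists (/ x + 2 * C).
  intros a b Hab.
  set (a' := Rmin a (/ 2)). set (b' := Rmax b 2).
  assert (Ha' : 0 < a' <= a /\ a' < 1).
  { unfold a'. split; [split; [apply Rmin_pos; lra|apply Rmin_l]|]. generalize (Rmin_r a (/ 2)); lra. }
  assert (Hb' : b <= b' /\ 2 <= b') by (unfold b'; split; [apply Rmax_l|apply Rmax_r]).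
  eapply Rle_trans; [apply (gamma_fun_mono x a b a' b'); lra|].
  rewrite <- (RInt_Chasles (gamma_fun x) a' 1 b') by (apply gamma_fun_ex; lra).
  apply Rplus_le_compat.
  - assert (HI : is_RInt (fun t => Rpower t (x - 1)) a' 1 (/ x * Rpower 1 x - / x * Rpower a' x)).
    { apply (is_RInt_derive (V := R_CompleteNormedModule) (fun t => / x * Rpower t x)).
      - intros t Ht. rewrite Rmin_left in Ht by lra. unfold Rpower. auto_derive; [lra|].
        replace ((x - 1) * ln t) with (x * ln t + - ln t) by ring.
        rewrite exp_plus, exp_Ropp, exp_ln by lra. field. lra.
      - intros t Ht. rewrite Rmin_left in Ht by lra.
        apply (ex_derive_continuous (V := R_NormedModule)). unfold Rpower. auto_derive. lra. }
    apply Rle_trans with (RInt (fun t => Rpower t (x - 1)) a' 1).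
    + apply RInt_le; [lra|apply gamma_fun_ex; lra|eexists; exact HI|].
      intros t Ht. unfold gamma_fun. rewrite <- (Rmult_1_r (Rpower t (x - 1))) at 2.
      apply Rmult_le_compat_l; [apply Rlt_le, exp_pos|].
      apply exp_le_1. lra.
    + rewrite (is_RInt_unique _ _ _ _ HI).
      assert (E1 : Rpower 1 x = 1) by (unfold Rpower; rewrite ln_1, Rmult_0_r, exp_0; auto).
      rewrite E1. assert (0 < / x * Rpower a' x).
      { apply Rmult_lt_0_compat; [now apply Rinv_0_lt_compat|apply exp_pos]. }
      lra.
  - apply Rle_trans with (RInt (fun t => C * exp (- (/ 2) * t)) 1 b').
    + apply RInt_le; [lra|apply gamma_fun_ex; lra|apply cont_ex_RInt, cont_scal, cont_exp|].
      intros t Ht. apply HCt. lra.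
    + rewrite (is_RInt_unique _ _ _ _ (is_RInt_exp C (/ 2) 1 b' ltac:(lra))).
      assert (0 <= C / / 2 * exp (- / 2 * b')).
      { apply Rmult_le_pos; [apply Rdiv_le_0_compat; lra|apply Rlt_le, exp_pos]. }
      assert (exp (- / 2 * 1) <= 1).
      { apply exp_le_1. lra. }
      assert (HC2 : C / / 2 = 2 * C) by field.
      assert (C / / 2 * exp (- / 2 * 1) <= C / / 2 * 1) by (apply Rmult_le_compat_l; [rewrite HC2; lra|auto]).
      lra.
Qed.

Lemma gamma_fun_RInt_gen x : 0 < x -> exists l, is_RInt_gen (gamma_fun x) (at_right 0) (Rbar_locally p_infty) l /\
  forall a b, 0 < a <= b -> RInt (gamma_fun x) a b <= l.
Proof.
  intros Hx. destruct (gamma_fun_bounded x Hx) as [K HK].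
  set (E := fun v => exists a b, 0 < a <= b /\ v = RInt (gamma_fun x) a b).
  destruct (completeness E) as [l [Hub Hlub]].
  { exists K. intros v [a [b [Hab ->]]]. auto. }
  { exists (RInt (gamma_fun x) 1 1), 1, 1. split; [lra|auto]. }
  exists l. assert (Hle : forall a b, 0 < a <= b -> RInt (gamma_fun x) a b <= l).
  { intros a b Hab. apply Hub. now exists a, b. }
  split; auto.
  intros P [eps HP].
  assert (Hex : exists a b, 0 < a <= b /\ l - eps < RInt (gamma_fun x) a b).
  { apply Classical_Prop.NNPP. intros Hn.
    assert (Hl : l <= l - eps).
    { apply Hlub. intros v [a [b [Hab ->]]]. apply Rnot_lt_le. intros Hlt. apply Hn. now exists a, b. }
    generalize (cond_pos eps). lra. }
  destruct Hex as [a0 [b0 [Hab Hlt]]].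
  apply (Filter_prod _ _ _ (fun a => 0 < a < a0) (fun b => b0 < b)).
  - exists (mkposreal a0 (proj1 Hab)). intros a Ha Hpos. split; auto.
    change (Rabs (a - 0) < a0) in Ha. rewrite Rminus_0_r, Rabs_pos_eq in Ha; lra.
  - now exists b0.
  - intros a b Ha Hb. exists (RInt (gamma_fun x) a b). split.
    + apply (RInt_correct (gamma_fun x)). apply gamma_fun_ex. cbn. lra.
    + apply HP. change (Rabs (RInt (gamma_fun x) a b - l) < eps).
      assert (H1 := Hle a b ltac:(lra)).
      assert (H2 := gamma_fun_mono x a0 b0 a b ltac:(lra) ltac:(lra)).
      apply Rabs_lt_between. lra.
Qed.

(** Along the intervals [1 / (n + 1), n + 1] the improper integral becomes the limit of
    a sequence. *)
Lemma Euler_Gamma_spec x : 0 < x ->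
  is_lim_seq (fun n => RInt (gamma_fun x) (/ INR (S n)) (INR (S n))) (Euler_Gamma x) /\ 0 < Euler_Gamma x.
Proof.
  intros Hx. destruct (gamma_fun_RInt_gen x Hx) as [l [Hl Hle]].
  assert (E : Euler_Gamma x = l).
  { unfold Euler_Gamma. apply is_RInt_gen_unique. exact Hl. }
  rewrite E. split.
  - apply is_lim_seq_spec. intros eps.
    assert (HP : locally l (fun y => Rabs (y - l) < eps)) by (exists eps; intros y Hy; exact Hy).
    destruct (Hl _ HP) as [Q R0 [d HQ] [M HR] HQR].
    destruct (INR_unbounded (Rmax M (/ d) + 1)) as [N HN].
    exists N. intros n Hn.
    assert (HnN : INR N <= INR n) by (apply le_INR; lia).
    assert (Hd := cond_pos d). assert (HM1 := Rmax_l M (/ d)). assert (HM2 := Rmax_r M (/ d)).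
    assert (Hid : 0 < / d) by (apply Rinv_0_lt_compat; auto).
    rewrite S_INR. set (b := INR n + 1). assert (Hb : / d < b /\ M < b /\ 1 < b) by (unfold b; lra).
    assert (Hib : 0 < / b < d).
    { split; [apply Rinv_0_lt_compat; lra|]. rewrite <- (Rinv_inv d). apply Rinv_lt_contravar; [|lra].
      apply Rmult_lt_0_compat; lra. }
    destruct (HQR (/ b) b) as [y [Hy1 Hy2]].
    + apply HQ; [|lra]. change (Rabs (/ b - 0) < d). rewrite Rminus_0_r, Rabs_pos_eq; lra.
    + apply HR. lra.
    + cbn [fst snd] in Hy1.
      rewrite (is_RInt_unique (gamma_fun x) (/ b) b y Hy1). exact Hy2.
  - eapply Rlt_le_trans; [|apply (Hle 1 2); lra].
    apply RInt_gt_0; [lra| |].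
    + intros; apply gamma_fun_pos.
    + intros t Ht. apply gamma_fun_cont. lra.
Qed.

Lemma Euler_Gamma_S x : 0 < x -> Euler_Gamma (x + 1) = x * Euler_Gamma x.
Proof.
  intros Hx.
  destruct (Euler_Gamma_spec x Hx) as [H1 _].
  destruct (Euler_Gamma_spec (x + 1) ltac:(lra)) as [H2 _].
  set (bd := fun t => Rpower t x * exp (- t)).
  assert (HI : forall n, RInt (gamma_fun (x + 1)) (/ INR (S n)) (INR (S n)) =
     x * RInt (gamma_fun x) (/ INR (S n)) (INR (S n)) - (bd (INR (S n)) - bd (/ INR (S n)))).
  { intros n. set (b := INR (S n)).
    assert (Hb : 1 <= b) by (unfold b; rewrite S_INR; generalize (pos_INR n); lra).
    assert (Hib : 0 < / b <= 1).
    { split; [apply Rinv_0_lt_compat; lra|]. rewrite <- Rinv_1. apply Rinv_le_contravar; lra. }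
    assert (Hd : is_RInt (fun t => x * gamma_fun x t - gamma_fun (x + 1) t) (/ b) b (bd b - bd (/ b))).
    { apply (is_RInt_derive (V := R_CompleteNormedModule) bd).
      - intros t Ht. rewrite Rmin_left in Ht by lra. unfold bd, gamma_fun, Rpower. auto_derive; [lra|].
        replace (x + 1 - 1) with x by ring.
        replace ((x - 1) * ln t) with (x * ln t + - ln t) by ring.
        rewrite exp_plus, (exp_Ropp (ln t)), exp_ln by lra. field. lra.
      - intros t Ht. rewrite Rmin_left in Ht by lra.
        apply (continuous_minus (fun t => x * gamma_fun x t) (gamma_fun (x + 1))); [|apply gamma_fun_cont; lra].
        apply (continuous_mult (fun _ => x) (gamma_fun x)); [apply continuous_const|apply gamma_fun_cont; lra]. }
    apply (is_RInt_unique (V := R_CompleteNormedModule)) in Hd.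
    assert (Hm : RInt (fun t => x * gamma_fun x t - gamma_fun (x + 1) t) (/ b) b = x * RInt (gamma_fun x) (/ b) b - RInt (gamma_fun (x + 1)) (/ b) b).
    { assert (E1 : ex_RInt (gamma_fun x) (/ b) b) by (apply gamma_fun_ex; lra).
      assert (E2 : ex_RInt (gamma_fun (x + 1)) (/ b) b) by (apply gamma_fun_ex; lra).
      assert (E3 : ex_RInt (fun t => x * gamma_fun x t) (/ b) b) by exact (ex_RInt_scal (gamma_fun x) (/ b) b x E1).
      assert (E4 : RInt (fun t => x * gamma_fun x t) (/ b) b = x * RInt (gamma_fun x) (/ b) b)
        by exact (RInt_scal (gamma_fun x) (/ b) b x E1).
      rewrite <- E4. exact (RInt_minus (fun t => x * gamma_fun x t) (gamma_fun (x + 1)) (/ b) b E3 E2). }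
    lra. }
  assert (Hn : is_lim_seq (fun n => INR (S n)) p_infty).
  { apply (is_lim_seq_incr_1 INR). apply is_lim_seq_INR. }
  assert (Hbd1 : is_lim_seq (fun n => bd (INR (S n))) 0).
  { destruct (gamma_fun_tail (x + 1)) as [C [HC HCt]].
    apply is_lim_seq_le_le with (fun _ => 0) (fun n => C * exp (- (/ 2) * INR (S n))).
    - intros n. split; [apply Rmult_le_pos; apply Rlt_le, exp_pos|].
      assert (Hb : 1 <= INR (S n)) by (rewrite S_INR; generalize (pos_INR n); lra).
      specialize (HCt _ Hb). unfold gamma_fun in HCt. replace (x + 1 - 1) with x in HCt by ring. exact HCt.
    - apply is_lim_seq_const.
    - replace (Finite 0) with (Rbar_mult C 0) by (cbn; f_equal; ring). apply is_lim_seq_scal_l.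
      apply (is_lim_comp_seq (fun x => exp (- / 2 * x)) (fun n => INR (S n)) p_infty 0); auto.
      + apply exp_neg_lim. lra.
      + exists 0%nat. intros; discriminate. }
  assert (Hbd2 : is_lim_seq (fun n => bd (/ INR (S n))) 0).
  { apply is_lim_seq_le_le with (fun _ => 0) (fun n => exp (- x * ln (INR (S n)))).
    - intros n. split; [apply Rmult_le_pos; apply Rlt_le, exp_pos|].
      assert (Hb : 1 <= INR (S n)) by (rewrite S_INR; generalize (pos_INR n); lra).
      unfold bd, Rpower. rewrite ln_Rinv by lra.
      replace (x * - ln (INR (S n))) with (- x * ln (INR (S n))) by ring.
      rewrite <- (Rmult_1_r (exp (- x * _))) at 2. apply Rmult_le_compat_l; [apply Rlt_le, exp_pos|].
      apply exp_le_1. assert (0 < / INR (S n)) by (apply Rinv_0_lt_compat; lra). lra.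
    - apply is_lim_seq_const.
    - apply (is_lim_comp_seq (fun x0 => exp (- x * x0)) (fun n => ln (INR (S n))) p_infty 0).
      + now apply exp_neg_lim.
      + exists 0%nat. intros; discriminate.
      + apply (is_lim_comp_seq ln (fun n => INR (S n)) p_infty p_infty); auto.
        * apply is_lim_ln_p.
        * exists 0%nat. intros; discriminate. }
  assert (H3 : is_lim_seq (fun n => RInt (gamma_fun (x + 1)) (/ INR (S n)) (INR (S n))) (x * Euler_Gamma x)).
  { apply is_lim_seq_ext with (1 := fun n => eq_sym (HI n)).
    replace (Finite (x * Euler_Gamma x)) with (Finite (x * Euler_Gamma x - (0 - 0))) by (f_equal; ring).
    apply is_lim_seq_minus'; [|now apply is_lim_seq_minus'].
    apply (is_lim_seq_scal_l _ x (Finite (Euler_Gamma x))). exact H1. }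
  apply is_lim_seq_unique in H2, H3. rewrite H2 in H3. now injection H3.
Qed.

Lemma Gamma_shift_pos x : 0 < x -> Gamma_shift x = 0%nat.
Proof.
  intros Hx. unfold Gamma_shift. destruct (archimed (- x)) as [_ H].
  assert (IZR (up (- x)) < 1) by lra. apply lt_IZR in H0. lia.
Qed.

Lemma Gamma_shift_neg x : x <= 0 -> Gamma_shift x = S (Gamma_shift (x + 1)).
Proof.
  intros Hx. unfold Gamma_shift. destruct (archimed (- x)) as [H1 H2].
  assert (H3 : (0 < up (- x))%Z) by (apply lt_IZR; lra).
  assert (E : up (- (x + 1)) = (up (- x) - 1)%Z).
  { symmetry. apply tech_up; rewrite minus_IZR; lra. }
  rewrite E. lia.
Qed.

Lemma rising_S x m : rising x (S m) = x * rising (x + 1) m.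
Proof.
  induction m as [|m IH]; [cbn; ring|].
  change (rising x (S (S m))) with (rising x (S m) * (x + INR (S m))). rewrite IH.
  change (rising (x + 1) (S m)) with (rising (x + 1) m * (x + 1 + INR m)). rewrite S_INR. ring.
Qed.

Lemma Gamma_pos_eq x : 0 < x -> Gamma x = Euler_Gamma x.
Proof.
  intros Hx. unfold Gamma. rewrite Gamma_shift_pos by auto. cbn. rewrite Rplus_0_r. field.
Qed.

Lemma Gamma_S x : 0 < x -> Gamma (x + 1) = x * Gamma x.
Proof. intros Hx. rewrite !Gamma_pos_eq by lra. now apply Euler_Gamma_S. Qed.

Lemma rGamma_pos_eq x : 0 < x -> rGamma x = / Euler_Gamma x.
Proof.
  intros Hx. unfold rGamma. rewrite Gamma_shift_pos by auto. cbn. rewrite Rplus_0_r.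
  field. apply Rgt_not_eq, Euler_Gamma_spec; auto.
Qed.

Lemma rGamma_S x : rGamma x = x * rGamma (x + 1).
Proof.
  destruct (Rlt_le_dec 0 x) as [Hx|Hx].
  - rewrite !rGamma_pos_eq by lra. rewrite Euler_Gamma_S by auto.
    field. split; [apply Rgt_not_eq, Euler_Gamma_spec; auto|lra].
  - unfold rGamma. rewrite (Gamma_shift_neg x Hx), rising_S, S_INR.
    replace (x + (INR (Gamma_shift (x + 1)) + 1)) with (x + 1 + INR (Gamma_shift (x + 1))) by ring.
    unfold Rdiv. ring.
Qed.

Lemma Gamma_rGamma x : 0 < x -> Gamma x * rGamma x = 1.
Proof.
  intros Hx. rewrite Gamma_pos_eq, rGamma_pos_eq by auto.
  apply Rinv_r. apply Rgt_not_eq, Euler_Gamma_spec; auto.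
Qed.

Lemma Gamma_fact k : Gamma (INR k + 1) = INR (fact k).
Proof.
  assert (H1 : Gamma 1 = 1).
  { rewrite Gamma_pos_eq by lra.
    destruct (Euler_Gamma_spec 1 Rlt_0_1) as [H _].
    apply is_lim_seq_unique in H.
    assert (H' : is_lim_seq (fun n => RInt (gamma_fun 1) (/ INR (S n)) (INR (S n))) 1).
    { apply is_lim_seq_ext with (fun n => exp (- (1) * / INR (S n)) - exp (- (1) * INR (S n))).
      - intros n. symmetry.
        assert (Hb : 1 <= INR (S n)) by (rewrite S_INR; generalize (pos_INR n); lra).
        assert (Hib : 0 < / INR (S n)) by (apply Rinv_0_lt_compat; lra).
        assert (Hib1 : / INR (S n) <= INR (S n)).
        { apply Rle_trans with 1; auto. rewrite <- Rinv_1. apply Rinv_le_contravar; lra. }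
        rewrite (RInt_ext (gamma_fun 1) (fun t => 1 * exp (- (1) * t))).
        + rewrite (is_RInt_unique _ _ _ _ (is_RInt_exp 1 1 (/ INR (S n)) (INR (S n)) ltac:(lra))).
          field.
        + intros t Ht. rewrite Rmin_left in Ht by lra. unfold gamma_fun, Rpower.
          replace ((1 - 1) * ln t) with 0 by ring. rewrite exp_0. do 2 f_equal. ring.
      - assert (Hn : is_lim_seq (fun n => INR (S n)) p_infty) by (apply (is_lim_seq_incr_1 INR), is_lim_seq_INR).
        replace (Finite 1) with (Finite (exp (- (1) * 0) - 0)) by (f_equal; rewrite Rmult_0_r, exp_0; ring).
        apply is_lim_seq_minus'.
        + apply (is_lim_seq_continuous (fun x => exp (- (1) * x)) (fun n => / INR (S n)) 0).
          * apply continuity_pt_filterlim. apply (cont_exp (- (1)) 0).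
          * replace (Finite 0) with (Rbar_inv p_infty) by reflexivity. apply is_lim_seq_inv; auto. discriminate.
        + apply (is_lim_comp_seq (fun x => exp (- (1) * x)) (fun n => INR (S n)) p_infty 0); auto.
          * apply (exp_neg_lim 1). lra.
          * exists 0%nat. intros; discriminate. }
    apply is_lim_seq_unique in H'. rewrite H in H'. now injection H'. }
  induction k as [|k IH].
  - cbn [INR fact]. now rewrite Rplus_0_l.
  - rewrite S_INR, Gamma_S by (generalize (pos_INR k); lra). rewrite IH, fact_S_INR. reflexivity.
Qed.

(** * Regularized moments of Bessel functions *)

(** The value at p = 0 of [JLap], that is, the Abel-regularized integral of
    x ^ m / m! * J_n x over the half line. *)
Definition Jmom (n m : nat) : R :=
  2 ^ m * Gamma ((INR n + INR m + 1) / 2) * rGamma ((INR n - INR m + 1) / 2) / INR (fact m).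

Lemma Jmom_0 n : Jmom n 0 = 1.
Proof.
  unfold Jmom. cbn [pow fact INR]. rewrite Rplus_0_r, Rminus_0_r.
  rewrite Rmult_assoc, Gamma_rGamma; [field|]. generalize (pos_INR n); lra.
Qed.

Lemma Jmom_0_1 : Jmom 0 1 = 0.
Proof.
  unfold Jmom. cbn [INR]. replace ((0 - 1 + 1) / 2) with (- INR 0) by (cbn; field).
  rewrite rGamma_pole. unfold Rdiv. ring.
Qed.

Lemma Jmom_0_SS m : Jmom 0 (S (S m)) = - ((INR m + 1) / (INR m + 2)) * Jmom 0 m.
Proof.
  assert (Hm := pos_INR m). unfold Jmom. rewrite !fact_S_INR, !S_INR. cbn [INR pow].
  replace ((0 + (INR m + 1 + 1) + 1) / 2) with ((0 + INR m + 1) / 2 + 1) by field.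
  rewrite Gamma_S by lra.
  rewrite (rGamma_S ((0 - (INR m + 1 + 1) + 1) / 2)).
  replace ((0 - (INR m + 1 + 1) + 1) / 2 + 1) with ((0 - INR m + 1) / 2) by field.
  field. split; [apply INR_fact_neq_0|split; lra].
Qed.

Lemma Jmom_1_S m : Jmom 1 (S m) = Jmom 0 m.
Proof.
  assert (Hm := pos_INR m). unfold Jmom. rewrite !fact_S_INR, !S_INR. cbn [INR pow].
  replace ((0 + 1 + (INR m + 1) + 1) / 2) with ((0 + INR m + 1) / 2 + 1) by field.
  rewrite Gamma_S by lra.
  replace ((0 + 1 - (INR m + 1) + 1) / 2) with ((0 - INR m + 1) / 2) by field.
  field. split; [apply INR_fact_neq_0|lra].
Qed.

Lemma Jmom_SS_S n m : Jmom (S (S n)) (S m) = Jmom n (S m) + 2 * Jmom (S n) m.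
Proof.
  assert (Hm := pos_INR m). assert (Hn := pos_INR n).
  unfold Jmom. rewrite !fact_S_INR, !S_INR. cbn [pow].
  replace ((INR n + 1 + 1 + (INR m + 1) + 1) / 2) with ((INR n + (INR m + 1) + 1) / 2 + 1) by field.
  rewrite Gamma_S by lra.
  rewrite (rGamma_S ((INR n - (INR m + 1) + 1) / 2)).
  replace ((INR n - (INR m + 1) + 1) / 2 + 1) with ((INR n + 1 - INR m + 1) / 2) by field.
  replace ((INR n + 1 + 1 - (INR m + 1) + 1) / 2) with ((INR n + 1 - INR m + 1) / 2) by field.
  replace ((INR n + 1 + INR m + 1) / 2) with ((INR n + (INR m + 1) + 1) / 2) by field.
  field. split; [apply INR_fact_neq_0|lra].
Qed.

Definition lim0 (u : R -> R) (l : R) : Prop := filterlim u (at_right 0) (locally l).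

Lemma lim0_plus u v a b : lim0 u a -> lim0 v b -> lim0 (fun p => u p + v p) (a + b).
Proof.
  intros H1 H2. eapply filterlim_comp_2; [exact H1|exact H2|].
  apply (filterlim_plus (V := R_NormedModule) a b).
Qed.
Lemma lim0_mult u v a b : lim0 u a -> lim0 v b -> lim0 (fun p => u p * v p) (a * b).
Proof.
  intros H1 H2. eapply filterlim_comp_2; [exact H1|exact H2|].
  apply (filterlim_mult (K := R_AbsRing) a b).
Qed.
Lemma lim0_const c : lim0 (fun _ => c) c.
Proof. apply filterlim_const. Qed.
Lemma lim0_cont u : continuous u 0 -> lim0 u (u 0).
Proof. intros H. apply (filterlim_filter_le_1 (F := locally 0)); auto. apply filter_le_within. Qed.
Lemma lim0_id : lim0 (fun p => p) 0.
Proof. apply (lim0_cont (fun p => p)), continuous_id. Qed.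
Lemma lim0_ext u v l : (forall p, 0 < p -> u p = v p) -> lim0 u l -> lim0 v l.
Proof.
  intros H. apply filterlim_ext_loc. exists (mkposreal 1 Rlt_0_1). intros p _ Hp. now apply H.
Qed.

(** [Jmom] satisfies the recurrences of [JLap] at p = 0. *)
Lemma JLap_lim0_0 m : lim0 (fun p => JLap 0 p m) (Jmom 0 m) /\ lim0 (fun p => JLap 0 p (S m)) (Jmom 0 (S m)).
Proof.
  assert (Hs : forall p, 0 < 1 + p * p) by (intros p; generalize (Rle_0_sqr p); unfold Rsqr; lra).
  induction m as [|m [IH1 IH2]].
  - assert (H0 : lim0 (fun p => JLap 0 p 0) (Jmom 0 0)).
    { rewrite Jmom_0. apply lim0_ext with (fun p => / sqrt (1 + p * p)).
      - intros p Hp. assert (E := JLap_0_0 p Hp). assert (Hr := sqrt_lt_R0 _ (Hs p)).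
        apply Rmult_eq_reg_r with (sqrt (1 + p * p)); [|lra]. rewrite E. field. lra.
      - assert (HL : lim0 (fun p => / sqrt (1 + p * p)) (/ sqrt (1 + 0 * 0))).
        { apply (lim0_cont (fun p => / sqrt (1 + p * p))).
          apply (ex_derive_continuous (V := R_NormedModule)). auto_derive.
          split; [apply Hs|split; auto]. apply Rgt_not_eq. apply sqrt_lt_R0. apply Hs. }
        rewrite Rmult_0_l, Rplus_0_r, sqrt_1, Rinv_1 in HL. exact HL. }
    split; auto. rewrite Jmom_0_1.
    apply lim0_ext with (fun p => (p * / (1 + p * p)) * JLap 0 p 0).
    + intros p Hp. destruct (JLap_0_rec p Hp) as [E _].
      apply Rmult_eq_reg_l with (1 + p * p); [|apply Rgt_not_eq, Hs]. rewrite E. field. apply Rgt_not_eq, Hs.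
    + assert (E0 : (0 * / (1 + 0 * 0)) * Jmom 0 0 = 0) by ring.
      refine (eq_ind _ (lim0 _) _ _ E0).
      apply lim0_mult; auto. apply (lim0_cont (fun p => p * / (1 + p * p))).
      apply (ex_derive_continuous (V := R_NormedModule)). auto_derive. apply Rgt_not_eq, Hs.
  - split; auto. assert (Hm := pos_INR m).
    apply lim0_ext with (fun p => (p * (2 * INR m + 3) * / ((1 + p * p) * (INR m + 2))) * JLap 0 p (S m) +
       (- (INR m + 1) * / ((1 + p * p) * (INR m + 2))) * JLap 0 p m).
    + intros p Hp. destruct (JLap_0_rec p Hp) as [_ E]. specialize (E m). specialize (Hs p).
      apply Rmult_eq_reg_l with ((1 + p * p) * (INR m + 2)); [|nra]. rewrite E. field. split; lra.
    + replace (Jmom 0 (S (S m))) with ((0 * (2 * INR m + 3) * / ((1 + 0 * 0) * (INR m + 2))) * Jmom 0 (S m) +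
       (- (INR m + 1) * / ((1 + 0 * 0) * (INR m + 2))) * Jmom 0 m).
      * apply lim0_plus; apply lim0_mult; auto.
        -- apply (lim0_cont (fun p => p * (2 * INR m + 3) * / ((1 + p * p) * (INR m + 2)))).
           apply (ex_derive_continuous (V := R_NormedModule)). auto_derive. specialize (Hs 0). nra.
        -- apply (lim0_cont (fun p => - (INR m + 1) * / ((1 + p * p) * (INR m + 2)))).
           apply (ex_derive_continuous (V := R_NormedModule)). auto_derive. specialize (Hs 0). nra.
      * rewrite Jmom_0_SS. field. lra.
Qed.

Lemma JLap_lim0 n : (forall m, lim0 (fun p => JLap n p m) (Jmom n m)) /\ (forall m, lim0 (fun p => JLap (S n) p m) (Jmom (S n) m)).
Proof.
  induction n as [|n [IH1 IH2]].
  - split; [intros m; exact (proj1 (JLap_lim0_0 _))|].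
    intros [|m].
    + apply lim0_ext with (fun p => 1 + ((-1) * p) * JLap 0 p 0).
      * intros p Hp. destruct (JLap_1 p Hp) as [E _]. rewrite E. ring.
      * rewrite Jmom_0. assert (E0 : 1 + ((-1) * 0) * Jmom 0 0 = 1) by ring.
        refine (eq_ind _ (lim0 _) _ _ E0).
        apply lim0_plus; [apply lim0_const|]. apply lim0_mult; [|exact (proj1 (JLap_lim0_0 _))].
        apply lim0_mult; [apply lim0_const|apply lim0_id].
    + apply lim0_ext with (fun p => JLap 0 p m + ((-1) * p) * JLap 0 p (S m)).
      * intros p Hp. destruct (JLap_1 p Hp) as [_ E]. rewrite E. ring.
      * rewrite Jmom_1_S. replace (Jmom 0 m) with (Jmom 0 m + ((-1) * 0) * Jmom 0 (S m)) by ring.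
        apply lim0_plus; [exact (proj1 (JLap_lim0_0 _))|]. apply lim0_mult; [|exact (proj1 (JLap_lim0_0 _))].
        apply lim0_mult; [apply lim0_const|apply lim0_id].
  - split; auto. intros [|m].
    + apply lim0_ext with (fun p => JLap n p 0 + ((-2) * p) * JLap (S n) p 0).
      * intros p Hp. destruct (JLap_SS n p Hp) as [E _]. rewrite E. ring.
      * rewrite Jmom_0. replace 1 with (Jmom n 0 + ((-2) * 0) * Jmom (S n) 0) by (rewrite !Jmom_0; ring).
        apply lim0_plus; [apply IH1|]. apply lim0_mult; [|apply IH2].
        apply lim0_mult; [apply lim0_const|apply lim0_id].
    + apply lim0_ext with (fun p => JLap n p (S m) + ((-2) * p) * JLap (S n) p (S m) + 2 * JLap (S n) p m).
      * intros p Hp. destruct (JLap_SS n p Hp) as [_ E]. rewrite E. ring.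
      * rewrite Jmom_SS_S. replace (Jmom n (S m)) with (Jmom n (S m) + ((-2) * 0) * Jmom (S n) (S m)) by ring.
        apply lim0_plus; [apply lim0_plus|].
        -- apply IH1.
        -- apply lim0_mult; [|apply IH2]. apply lim0_mult; [apply lim0_const|apply lim0_id].
        -- apply lim0_mult; [apply lim0_const|apply IH2].
Qed.

(** * The Hankel transform *)

Lemma Jmom_bound n m : Rabs (Jmom n m) <= 5 ^ n.
Proof.
  assert (Hl : filterlim (fun p => Rabs (JLap n p m)) (at_right 0) (locally (Rabs (Jmom n m)))).
  { eapply filterlim_comp; [apply (proj1 (JLap_lim0 n) m)|apply continuous_Rabs]. }
  refine (filterlim_le (F := at_right 0) (fun p => Rabs (JLap n p m)) (fun _ => 5 ^ n)
    (Finite (Rabs (Jmom n m))) (Finite (5 ^ n)) _ Hl _).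
  - exists (mkposreal 1 Rlt_0_1). intros p Hp Hpos.
    change (Rabs (p - 0) < 1) in Hp. rewrite Rminus_0_r, Rabs_pos_eq in Hp by lra.
    eapply Rle_trans; [now apply JLap_bound|]. apply pow_incr. lra.
  - apply filterlim_const.
Qed.

Lemma entire_cont (c : nat -> R) (f : R -> R) :
  (forall x, is_series (fun k => c k * (x ^ k / INR (fact k))) (f x)) -> cont f.
Proof.
  intros H.
  set (a := fun k => c k / INR (fact k)).
  assert (Hs : forall x, is_series (fun k => a k * x ^ k) (f x)).
  { intros x. eapply is_series_ext; [|apply H]. intros k. unfold a. cbv beta. unfold Rdiv. Rring. }
  assert (Hf : forall x, PSeries a x = f x) by (intros x; apply is_series_unique, Hs).
  assert (HCV : forall x, Rbar_lt (Rabs x) (CV_radius a)).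
  { intros x. apply CV_radius_gt with (Rabs x + 1); [lra|]. eexists. apply Hs. }
  apply (cont_ext (PSeries a)); auto.
  intros x. apply continuity_pt_filterlim, PSeries_continuity, HCV.
Qed.

Lemma lim_bounded h : cont h -> is_lim h p_infty 0 -> exists M, forall x, 0 <= x -> Rabs (h x) <= M.
Proof.
  intros Hc Hl. apply is_lim_spec in Hl. destruct (Hl (mkposreal 1 Rlt_0_1)) as [X HX]. cbn in HX.
  destruct (continuity_ab_maj (fun x => Rabs (h x)) 0 (Rabs X) (Rabs_pos X)) as [xm [Hm _]].
  { intros x _. apply continuity_pt_filterlim.
    apply (continuous_comp h Rabs); [apply Hc|apply continuous_Rabs]. }
  exists (Rabs (h xm) + 1). intros x Hx. assert (H0 := Rabs_pos (h xm)).
  destruct (Rle_dec x (Rabs X)) as [Hle|Hgt].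
  - specialize (Hm x (conj Hx Hle)). cbv beta in Hm. lra.
  - assert (HXx : X < x) by (generalize (Rle_abs X); lra).
    specialize (HX x HXx). rewrite Rminus_0_r in HX. lra.
Qed.

Lemma laplace_xJ n p m : 0 < p -> laplace (fun x => x * J n x) p m = (INR m + 1) * JLap n p (S m).
Proof. intros Hp. destruct (J_lin n) as [K [_ [HJ _]]]. now apply (laplace_mul_id K). Qed.

(** The case q = 1 for a real function of exponential type al < 1. The integrand is
    sqrt x f(x) * sqrt x J_n(x), hence bounded and o(1) at infinity, as
    [moment_series_integral] requires. *)
Theorem Hankel_core (n : nat) (f : R -> R) (c : nat -> R) (A al : R) :
  0 < al < 1 -> (forall k, Rabs (c k) <= A * al ^ k) ->
  (forall x, is_series (fun k => c k * (x ^ k / INR (fact k))) (f x)) ->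
  is_lim (fun x => sqrt x * f x) p_infty 0 ->
  exists l, is_series (fun k => c k * ((INR k + 1) * Jmom n (S k))) l /\
    is_lim (fun T => RInt (fun x => x * J n x * f x) 0 T) p_infty l.
Proof.
  intros Hal Hc Hser Hlim.
  assert (Hf := entire_cont c f Hser).
  set (h := fun x => x * J n x * f x).
  destruct (J_bounds n) as [K [HK HJ]]. destruct (J_lin n) as [K2 [HK2 [_ [_ Hx]]]].
  assert (Hh : cont h).
  { apply cont_mult; auto. apply cont_mult; [apply cont_id|apply J_cont]. }
  assert (Hh0 : is_lim h p_infty 0).
  { assert (Hl : is_lim (fun x => K * Rabs (sqrt x * f x)) p_infty 0).
    { replace (Finite 0) with (Rbar_mult K (Rabs 0)) by (cbn; f_equal; rewrite Rabs_R0; ring).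
      apply is_lim_scal_l. eapply filterlim_comp; [exact Hlim|apply continuous_Rabs]. }
    apply (is_lim_le_le_loc (fun x => - (K * Rabs (sqrt x * f x))) (fun x => K * Rabs (sqrt x * f x))); auto.
    - exists 0. intros x Hx0. apply Rabs_le_between. unfold h.
      rewrite <- (sqrt_sqrt x) at 1 by lra.
      replace (sqrt x * sqrt x * J n x * f x) with ((sqrt x * J n x) * (sqrt x * f x)) by ring.
      rewrite Rabs_mult. apply Rmult_le_compat_r; [apply Rabs_pos|].
      rewrite Rabs_mult, (Rabs_pos_eq (sqrt x)) by apply sqrt_pos. apply HJ. lra.
    - replace (Finite 0) with (Rbar_opp 0) by (cbn; f_equal; ring). now apply is_lim_opp. }
  destruct (lim_bounded h Hh Hh0) as [M HM].
  destruct (moment_series_integral (J n) f h (fun k => RtoC (c k)) A al K2 (fun m => (INR m + 1) * Jmom n (S m)))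
    with (M := M) as [S [HS1 HS2]]; auto.
  - intros k. rewrite Cmod_R. apply Hc.
  - intros x _. apply is_Cseries_ext with (fun k => RtoC (c k * (x ^ k / INR (fact k)))).
    { intros k. now rewrite RtoC_mult. }
    now apply is_Cseries_RtoC.
  - intros x. unfold h. ring.
  - intros P HP. exists ((3 + 2 * P) ^ n). split; [apply pow_le; lra|].
    intros p m Hp. rewrite laplace_xJ by lra. rewrite Rabs_mult, Rmult_comm.
    rewrite (Rabs_pos_eq (INR m + 1)) by (generalize (pos_INR m); lra).
    apply Rmult_le_compat_r; [generalize (pos_INR m); lra|].
    eapply Rle_trans; [apply JLap_bound; lra|]. apply pow_incr. lra.
  - intros m. apply (lim0_ext (fun p => (INR m + 1) * JLap n p (Datatypes.S m))).
    + intros p Hp. symmetry. now apply laplace_xJ.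
    + apply lim0_mult; [apply lim0_const|exact (proj1 (JLap_lim0 n) _)].
  - exists (Re S). split.
    + destruct HS1 as [HS1 _]. eapply is_series_ext; [|exact HS1].
      intros k. cbv beta. rewrite <- RtoC_mult. reflexivity.
    + apply is_lim_spec. intros eps. destruct (HS2 (eps / 2)) as [T0 HT0].
      { generalize (cond_pos eps). lra. }
      exists T0. intros T HT. specialize (HT0 T HT).
      assert (H1 := re_le_Cmod (S - RtoC (RInt h 0 T))%C).
      replace (Re (S - RtoC (RInt h 0 T))%C) with (Re S - RInt h 0 T) in H1
        by (unfold Re, Cminus, Cplus, Copp, RtoC; cbn [fst snd]; ring).
      rewrite Rabs_minus_sym in H1. generalize (cond_pos eps). unfold h in *. lra.
Qed.

Lemma is_series_C (u : nat -> C) (l : C) : is_series (V := C_R_NormedModule) u l <-> is_Cseries u l.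
Proof.
  split.
  - intros H. apply is_Cseries_eps. intros eps He.
    assert (He2 : 0 < eps / 2) by lra.
    destruct (proj1 (filterlim_locally (U := C_R_NormedModule) _ _) H (mkposreal _ He2)) as [N HN].
    exists N. intros m Hm. destruct (HN m Hm) as [H1 H2].
    change (Rabs (Re (sum_n u m - l)%C) < eps / 2) in H1.
    change (Rabs (Im (sum_n u m - l)%C) < eps / 2) in H2.
    eapply Rle_lt_trans; [apply Cmod_le_Re_Im|]. lra.
  - intros H. apply (filterlim_locally (U := C_R_NormedModule)). intros eps.
    destruct (proj1 (is_Cseries_eps _ _) H eps (cond_pos eps)) as [N HN].
    exists N. intros m Hm. specialize (HN m Hm). split.
    + change (Rabs (Re (sum_n u m - l)%C) < eps). eapply Rle_lt_trans; [apply re_le_Cmod|exact HN].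
    + change (Rabs (Im (sum_n u m - l)%C) < eps). eapply Rle_lt_trans; [apply Im_le_Cmod|exact HN].
Qed.

Lemma Hankel_weight (m k : nat) :
  Gamma (INR k / 2 + INR m / 2 + 1) * rGamma (INR m / 2 - INR k / 2) / Gamma (INR k + 1) =
  (INR k + 1) * Jmom m (S k) / 2 ^ S k.
Proof.
  rewrite Gamma_fact. unfold Jmom. rewrite fact_S_INR, S_INR.
  replace ((INR m + (INR k + 1) + 1) / 2) with (INR k / 2 + INR m / 2 + 1) by field.
  replace ((INR m - (INR k + 1) + 1) / 2) with (INR m / 2 - INR k / 2) by field.
  assert (0 < 2 ^ S k) by (apply pow_lt; lra).
  assert (Hk := pos_INR k). field. repeat split; first [apply INR_fact_neq_0|lra].
Qed.

(** Order -1 is minus order 1, for the weights as well: this is the functional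
    equation of Gamma used once in the numerator and once in the denominator. *)
Lemma order_reduction (n : Z) : (-1 <= n)%Z -> exists (s : R) (m : nat), Rabs s = 1 /\
  (forall x, BesselJ n x = s * J m x) /\
  forall k, Gamma (INR k / 2 + IZR n / 2 + 1) * rGamma (IZR n / 2 - INR k / 2) / Gamma (INR k + 1) =
    s * ((INR k + 1) * Jmom m (S k) / 2 ^ S k).
Proof.
  intros Hn. destruct (Z_le_gt_dec 0 n) as [H0|H0].
  - exists 1, (Z.to_nat n). split; [apply Rabs_R1|]. split.
    + intros x. rewrite Rmult_1_l. destruct n as [|p|p]; auto. lia.
    + intros k. rewrite Rmult_1_l, <- Hankel_weight.
      rewrite (INR_IZR_INZ (Z.to_nat n)), Z2Nat.id by lia. reflexivity.
  - assert (n = -1)%Z as -> by lia. exists (-1), 1%nat. split; [|split].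
    + rewrite <- (Rabs_R1), <- Rabs_Ropp. f_equal. ring.
    + intros x. change (BesselJ (-1) x) with ((-1) ^ 1 * J 1 x). ring.
    + intros k. assert (Hk := pos_INR k). rewrite <- Hankel_weight. cbn [INR].
       replace (INR k / 2 + 1 / 2 + 1) with (INR k / 2 + IZR (-1) / 2 + 1 + 1) by field.
      rewrite (Gamma_S (INR k / 2 + IZR (-1) / 2 + 1)) by lra.
      rewrite (rGamma_S (IZR (-1) / 2 - INR k / 2)).
      replace (IZR (-1) / 2 - INR k / 2 + 1) with (1 / 2 - INR k / 2) by field.
      rewrite Gamma_fact. field. apply INR_fact_neq_0.
Qed.

Lemma Hankel_RInt_scale m q (g : R -> R) T : 0 < q -> cont g ->
  RInt (fun x => x * J m (q * x) * g x) 0 T = / q ^ 2 * RInt (fun u => u * J m u * g (u / q)) 0 (q * T).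
Proof.
  intros Hq Hg.
  set (w := fun u => u * J m u * g (u / q)).
  assert (Hw : cont w).
  { apply cont_mult; [apply cont_mult; [apply cont_id|apply J_cont]|].
    intros x. apply (continuous_comp (fun u => u / q) g); [|apply Hg].
    apply (cont_mult (fun u => u) (fun _ => / q) cont_id (cont_const _)). }
  assert (H := RInt_comp_lin w q 0 0 T (cont_ex_RInt _ _ _ Hw)).
  rewrite Rmult_0_r, !Rplus_0_r in H. rewrite <- H.
  assert (Hs : ex_RInt (fun y => scal q (w (q * y + 0))) 0 T).
  { apply (cont_ex_RInt (fun y => q * w (q * y + 0))). apply cont_scal.
    intros x. apply (continuous_comp (fun y => q * y + 0) w); [|apply Hw].
    apply (cont_plus (fun y => q * y) (fun _ => 0)); [apply cont_scal, cont_id|apply cont_const]. }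
  refine (eq_trans _ (RInt_scal (fun y => scal q (w (q * y + 0))) 0 T (/ q ^ 2) Hs)).
  apply RInt_ext. intros x _.
  change (x * J m (q * x) * g x = / q ^ 2 * (q * w (q * x + 0))).
  unfold w. rewrite Rplus_0_r. replace (q * x / q) with x by (field; lra). field. lra.
Qed.

Lemma is_lim_dilate q : 0 < q -> is_lim (fun x => q * x) p_infty p_infty.
Proof.
  intros Hq. apply is_lim_spec. intros M. exists (M / q). intros x Hx.
  apply Rmult_lt_reg_r with (/ q); [now apply Rinv_0_lt_compat|].
  replace (q * x * / q) with x by (field; lra). exact Hx.
Qed.

(** The substitution u = q x turns type a into type a / q < 1. *)
Lemma Hankel_real (m : nat) (f : R -> R) (c : nat -> R) (A a q : R) :
  0 < a < q -> (forall k, Rabs (c k) <= A * a ^ k) ->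
  (forall x, is_series (fun k => c k * (x ^ k / INR (fact k))) (f x)) ->
  is_lim (fun x => sqrt x * f x) p_infty 0 ->
  exists S, is_series (fun k => c k / q ^ k * ((INR k + 1) * Jmom m (Datatypes.S k))) S /\
    is_lim (fun T => RInt (fun x => x * J m (q * x) * f x) 0 T) p_infty (/ q ^ 2 * S).
Proof.
  intros Hq Hc Hser Hlim.
  assert (Hq0 : 0 < q) by lra.
  destruct (Hankel_core m (fun u => f (u / q)) (fun k => c k / q ^ k) A (a / q)) as [S [HS1 HS2]].
  - split; [apply Rdiv_lt_0_compat|apply Rdiv_lt_1]; lra.
  - intros k. assert (Hqk : 0 < q ^ k) by now apply pow_lt.
    unfold Rdiv. rewrite Rabs_mult, Rpow_mult_distr, pow_inv, <- Rmult_assoc.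
    rewrite (Rabs_pos_eq (/ q ^ k)) by (apply Rlt_le, Rinv_0_lt_compat; auto).
    apply Rmult_le_compat_r; auto. apply Rlt_le, Rinv_0_lt_compat; auto.
  - intros x. eapply is_series_ext; [|apply (Hser (x / q))]. intros k. cbv beta.
    unfold Rdiv. rewrite Rpow_mult_distr, pow_inv. Rring.
  - assert (Hl : is_lim (fun u => sqrt q * (sqrt (u / q) * f (u / q))) p_infty 0).
    { replace (Finite 0) with (Rbar_mult (sqrt q) 0) by (cbn; f_equal; ring).
      apply is_lim_scal_l.
      apply (is_lim_comp (fun x => sqrt x * f x) (fun u => u / q) p_infty 0 p_infty); auto.
      - apply is_lim_ext with (fun u => / q * u); [intros u; unfold Rdiv; ring|].
        now apply is_lim_dilate, Rinv_0_lt_compat.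
      - exists 0. intros; discriminate. }
    eapply is_lim_ext_loc; [|exact Hl]. exists 0. intros u Hu.
    rewrite <- Rmult_assoc, <- sqrt_mult_alt by lra. do 2 f_equal. field. lra.
  - exists S. split; auto.
    assert (Hf := entire_cont c f Hser).
    apply is_lim_ext with (fun T => / q ^ 2 * RInt (fun u => u * J m u * f (u / q)) 0 (q * T)).
    { intros T. symmetry. now apply Hankel_RInt_scale. }
    apply (is_lim_scal_l _ (/ q ^ 2) p_infty (Finite S)).
    apply (is_lim_comp (fun T => RInt (fun u => u * J m u * f (u / q)) 0 T) (fun T => q * T) p_infty S p_infty); auto.
    + now apply is_lim_dilate.
    + exists 0. intros; discriminate.
Qed.

Theorem theorem4 (n : Z) (f : R -> C) (gs : C -> C) (delta A a : R)
  (hn : (-1 <= n)%Z)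
  (h1_even : Z.Even n -> ~ (forall x : R, f (- x) = f x))
  (h1_odd : Z.Odd n -> ~ (forall x : R, f (- x) = Copp (f x)))
  (h2_interp : forall k : nat,
      gs (RtoC (INR k)) = (RtoC ((-1) ^ k) * Derive_n_C f k 0)%C)
  (h2_taylor : forall x : R,
      is_series (V := C_R_NormedModule)
        (fun k : nat =>
           (gs (RtoC (INR k)) / RtoC (INR (fact k)) * RtoC ((- x) ^ k))%C)
        (f x))
  (h3 : filterlim (fun x : R => (RtoC (sqrt x) * f x)%C)
          (Rbar_locally p_infty) (locally (RtoC 0)))
  (hdelta : 3 / 4 < delta < 1)
  (ha : 0 < a)
  (h4_analytic : analytic_on (half_plane delta) gs)
  (h4_growth : forall s : C,
      half_plane delta s -> Cmod (gs s) < A * Rpower a (Re s)) :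
  exists S : R -> C,
    (forall q : R, a < q ->
       abs_convergent (Hankel_term n f q) /\
       is_series (V := C_R_NormedModule) (Hankel_term n f q) (S q) /\
       is_Hankel n f q (RtoC (2 / q ^ 2) * S q)%C) /\
    (forall q0 : R, a < q0 ->
       unif_series_on (fun q : R => q0 <= q) (Hankel_term n f) S).
Proof.
  set (c := Derive_n_C f) in *.
  assert (Hcb : forall k, Cmod (c k 0) <= A * a ^ k).
  { intros k. rewrite <- Rpower_pow by auto. apply Rlt_le.
    assert (H := h4_growth (RtoC (INR k))). cbn [Re RtoC fst] in H.
    rewrite h2_interp, Cmod_mult, Cmod_R, pow_1_abs, Rmult_1_l in H. apply H.
    unfold half_plane. cbn. generalize (pos_INR k); lra. }
  assert (Htay : forall x, is_Cseries (fun k => c k 0 * RtoC (x ^ k / INR (fact k)))%C (f x)).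
  { intros x. assert (H := proj1 (is_series_C _ _) (h2_taylor x)).
    eapply is_Cseries_ext; [|exact H]. intros k. cbv beta. rewrite h2_interp. fold c.
    replace (- x) with ((-1) * x) by ring. rewrite Rpow_mult_distr.
    unfold Cdiv, Rdiv. rewrite <- RtoC_inv by apply INR_fact_neq_0. rewrite !RtoC_mult.
    replace (RtoC ((-1) ^ k) * c k 0%R * RtoC (/ INR (fact k)) * (RtoC ((-1) ^ k) * RtoC (x ^ k)))%C
      with ((RtoC ((-1) ^ k) * RtoC ((-1) ^ k)) * (c k 0%R * (RtoC (x ^ k) * RtoC (/ INR (fact k)))))%C by ring.
    rewrite <- (RtoC_mult ((-1) ^ k)), <- Rpow_mult_distr.
    replace (-1 * -1) with 1 by ring. rewrite pow1. ring. }
  assert (Hre : forall x, is_series (fun k => Re (c k 0) * (x ^ k / INR (fact k))) (Re (f x))).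
  { intros x. destruct (Htay x) as [H _]. eapply is_series_ext; [|exact H]. intros k. cbv beta.
    unfold Re, Cmult, RtoC; cbn [fst snd]. Rring. }
  assert (Him : forall x, is_series (fun k => Im (c k 0) * (x ^ k / INR (fact k))) (Im (f x))).
  { intros x. destruct (Htay x) as [_ H]. eapply is_series_ext; [|exact H]. intros k. cbv beta.
    unfold Im, Cmult, RtoC; cbn [fst snd]. Rring. }
  assert (Hlre : is_lim (fun x => sqrt x * Re (f x)) p_infty 0).
  { apply is_lim_spec. intros eps.
    destruct (proj1 (filterlim_locally _ _) h3 eps) as [X HX]. exists X. intros x Hx.
    destruct (HX x Hx) as [H _]. change (Rabs (Re (RtoC (sqrt x) * f x)%C - 0) < eps) in H.
    replace (Re (RtoC (sqrt x) * f x)%C) with (sqrt x * Re (f x)) in H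
      by (unfold Re, Cmult, RtoC; cbn [fst snd]; ring). exact H. }
  assert (Hlim : is_lim (fun x => sqrt x * Im (f x)) p_infty 0).
  { apply is_lim_spec. intros eps.
    destruct (proj1 (filterlim_locally _ _) h3 eps) as [X HX]. exists X. intros x Hx.
    destruct (HX x Hx) as [_ H]. change (Rabs (Im (RtoC (sqrt x) * f x)%C - 0) < eps) in H.
    replace (Im (RtoC (sqrt x) * f x)%C) with (sqrt x * Im (f x)) in H
      by (unfold Im, Cmult, RtoC; cbn [fst snd]; ring). exact H. }
  destruct (order_reduction n hn) as [s [m [Hs [HBs HWs]]]].
  assert (HA : 0 <= A).
  { specialize (Hcb 0%nat). cbn in Hcb. rewrite Rmult_1_r in Hcb. eapply Rle_trans; [apply Cmod_ge_0|exact Hcb]. }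
  assert (Hterm : forall q k, 0 < q -> Hankel_term n f q k =
     (RtoC (s / 2 * ((INR k + 1) * Jmom m (Datatypes.S k)) / q ^ k) * c k 0)%C).
  { intros q k Hq. unfold Hankel_term. rewrite HWs. fold c.
    replace (s / 2 * ((INR k + 1) * Jmom m (Datatypes.S k)) / q ^ k) with
      (s * ((INR k + 1) * Jmom m (Datatypes.S k) / 2 ^ Datatypes.S k) * / (q / 2) ^ k).
    - rewrite (RtoC_mult _ (/ (q / 2) ^ k)). ring.
    - assert (0 < 2 ^ k) by (apply pow_lt; lra). assert (0 < q ^ k) by now apply pow_lt.
      replace ((q / 2) ^ k) with (q ^ k * / 2 ^ k)
        by (unfold Rdiv; rewrite Rpow_mult_distr, pow_inv; ring).
      cbn [pow]. field. lra. }
  (* binom k 1 = k + 1, so that [ex_series_binom] gives a convergent majorant *)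
  set (B := 5 ^ m * A).
  assert (HB5 : 0 < 5 ^ m) by (apply pow_lt; lra).
  assert (Hbound : forall q0 q k, a < q0 -> q0 <= q -> Cmod (Hankel_term n f q k) <= B * (binom k 1 * (a / q0) ^ k)).
  { intros q0 q k Hq0 Hq. rewrite Hterm, Cmod_mult, Cmod_R by lra.
    assert (Hk := pos_INR k).
    assert (Hbin : binom k 1 = INR k + 1).
    { unfold binom. rewrite Nat.add_1_r, fact_S_INR. change (fact 1) with 1%nat. change (INR 1) with 1. field. apply INR_fact_neq_0. }
    rewrite Hbin. assert (Hqk : 0 < q ^ k) by (apply pow_lt; lra). assert (Hq0k : 0 < q0 ^ k) by (apply pow_lt; lra).
    assert (Hak : 0 < a ^ k) by (apply pow_lt; lra).
    unfold Rdiv. rewrite !Rabs_mult, Hs, (Rabs_pos_eq (/ 2)), (Rabs_pos_eq (INR k + 1)) by lra.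
    rewrite (Rabs_pos_eq (/ q ^ k)) by (apply Rlt_le, Rinv_0_lt_compat; auto).
    assert (Hy := Jmom_bound m (Datatypes.S k)).
    assert (Hinv : / q ^ k <= / q0 ^ k).
    { apply Rinv_le_contravar; auto. apply pow_incr; lra. }
    rewrite Rpow_mult_distr, pow_inv. unfold B.
    apply Rle_trans with (1 * / 2 * ((INR k + 1) * 5 ^ m) * / q0 ^ k * (A * a ^ k)).
    - assert (Hi : 0 < / q ^ k) by (apply Rinv_0_lt_compat; auto).
      assert (Hy0 := Rabs_pos (Jmom m (Datatypes.S k))).
      apply Rmult_le_compat; auto using Cmod_ge_0.
      + repeat apply Rmult_le_pos; lra.
      + apply Rmult_le_compat; [repeat apply Rmult_le_pos; lra|lra| |auto].
        apply Rmult_le_compat_l; [lra|]. apply Rmult_le_compat_l; lra.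
    - assert (Hi : 0 < / q0 ^ k) by (apply Rinv_0_lt_compat; auto).
      assert (0 <= (INR k + 1) * 5 ^ m * / q0 ^ k * (A * a ^ k)) by (repeat apply Rmult_le_pos; lra).
      lra. }
  assert (Hex : forall q0, a < q0 -> ex_series (fun k => B * (binom k 1 * (a / q0) ^ k))).
  { intros q0 Hq0. apply ex_series_Rscal, ex_series_binom. split; [apply Rdiv_le_0_compat|apply Rdiv_lt_1]; lra. }
  set (S := fun q => CSeries (Hankel_term n f q)).
  assert (HS : forall q, a < q -> is_Cseries (Hankel_term n f q) (S q)).
  { intros q Hq. exact (CSeries_correct _ _ (fun k => Hbound q q k Hq (Rle_refl q)) (Hex q Hq)). }
  exists S. split.
  - intros q Hq. split; [|split].
    + apply (ex_series_dom _ (fun k => B * (binom k 1 * (a / q) ^ k))); [|now apply Hex].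
      intros k. rewrite Rabs_pos_eq by apply Cmod_ge_0. apply Hbound; lra.
    + apply is_series_C. now apply HS.
    + assert (Hq0 : 0 < q) by lra. assert (Haq : 0 < a < q) by lra.
      assert (Hcre : forall k, Rabs (Re (c k 0)) <= A * a ^ k).
      { intros k. eapply Rle_trans; [apply re_le_Cmod|apply Hcb]. }
      assert (Hcim : forall k, Rabs (Im (c k 0)) <= A * a ^ k).
      { intros k. eapply Rle_trans; [apply Im_le_Cmod|apply Hcb]. }
      destruct (Hankel_real m _ _ A a q Haq Hcre Hre Hlre) as [S1 [HS1 HL1]].
      destruct (Hankel_real m _ _ A a q Haq Hcim Him Hlim) as [S2 [HS2 HL2]].
      assert (HSq : S q = (s / 2 * S1, s / 2 * S2)).
      { apply (is_Cseries_unique _ _ _ (HS q Hq)). split; cbn [Re Im fst snd].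
        - eapply is_series_ext; [|exact (is_series_scal (s / 2) _ _ HS1)]. intros k.
          rewrite Hterm by auto. unfold Re, Cmult, RtoC; cbn [fst snd].
          unfold scal; cbn -[pow INR]. unfold mult; cbn -[pow INR]. unfold Re, Rdiv. Rring.
        - eapply is_series_ext; [|exact (is_series_scal (s / 2) _ _ HS2)]. intros k.
          rewrite Hterm by auto. unfold Im, Cmult, RtoC; cbn [fst snd].
          unfold scal; cbn -[pow INR]. unfold mult; cbn -[pow INR]. unfold Im, Rdiv. Rring. }
      assert (Hval : (RtoC (2 / q ^ 2) * S q)%C = (s * (/ q ^ 2 * S1), s * (/ q ^ 2 * S2))).
      { rewrite HSq. unfold RtoC, Cmult; cbn [fst snd]. f_equal; field; lra. }
      rewrite Hval.
      assert (Hfre := entire_cont _ _ Hre). assert (Hfim := entire_cont _ _ Him).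
      assert (Hcw : forall g, cont g -> cont (fun x => s * (x * J m (q * x) * g x))).
      { intros g Hg. apply cont_scal, cont_mult; auto. apply cont_mult; [apply cont_id|].
        intros x. apply (continuous_comp (fun x => q * x) (J m)); [apply (cont_scal q _ cont_id)|apply J_cont]. }
      assert (Hint : forall g T, cont g -> RInt (fun x => s * (x * J m (q * x) * g x)) 0 T =
        s * RInt (fun x => x * J m (q * x) * g x) 0 T).
      { intros g T Hg. apply (RInt_scal (fun x => x * J m (q * x) * g x)). apply cont_ex_RInt.
        apply cont_mult; auto. apply cont_mult; [apply cont_id|].
        intros x. apply (continuous_comp (fun x => q * x) (J m)); [apply (cont_scal q _ cont_id)|apply J_cont]. }
      assert (HL1' := is_lim_scal_l _ s p_infty _ HL1). assert (HL2' := is_lim_scal_l _ s p_infty _ HL2).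
      intros P [eps HP].
      apply is_lim_spec in HL1'. apply is_lim_spec in HL2'.
      destruct (HL1' eps) as [X1 HX1]. destruct (HL2' eps) as [X2 HX2].
      apply (Filter_prod _ _ _ (fun x => x = 0) (fun y => Rmax X1 X2 < y)).
      * reflexivity.
      * now exists (Rmax X1 X2).
      * intros x T -> HT.
        exists (RInt (fun x => s * (x * J m (q * x) * Re (f x))) 0 T,
                RInt (fun x => s * (x * J m (q * x) * Im (f x))) 0 T). split.
        -- cbn [fst snd]. apply (is_RInt_fct_extend_pair (U := R_NormedModule) (V := R_NormedModule)).
           ++ eapply is_RInt_ext; [|apply (RInt_correct (V := R_CompleteNormedModule)), cont_ex_RInt, (Hcw _ Hfre)].
              intros x _. rewrite HBs. unfold Re, Cmult, RtoC; cbn [fst snd]. Rring.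
           ++ eapply is_RInt_ext; [|apply (RInt_correct (V := R_CompleteNormedModule)), cont_ex_RInt, (Hcw _ Hfim)].
              intros x _. rewrite HBs. unfold Im, Cmult, RtoC; cbn [fst snd]. Rring.
        -- apply HP. split; cbn [fst snd].
           ++ rewrite (Hint _ _ Hfre). apply HX1. generalize (Rmax_l X1 X2); lra.
           ++ rewrite (Hint _ _ Hfim). apply HX2. generalize (Rmax_r X1 X2); lra.
  - intros q0 Hq0 eps He.
    assert (Hl := Series_correct _ (Hex q0 Hq0)). apply is_series_lim_seq, is_lim_seq_spec in Hl.
    destruct (Hl (mkposreal eps He)) as [N HN]. exists N. intros k Hk q Hq.
    specialize (HN k Hk). cbn [pos] in HN.
    eapply Rle_lt_trans; [|exact HN]. rewrite Rabs_minus_sym.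
    rewrite <- Cmod_opp.
    replace (- (sum_n (Hankel_term n f q) k - S q))%C with (S q - sum_n (Hankel_term n f q) k)%C by ring.
    eapply Rle_trans; [|apply Rle_abs].
    apply (is_Cseries_tail _ _ _ _ (fun i => Hbound q0 q i Hq0 Hq) (Hex q0 Hq0)). apply HS. lra.
Qed.
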